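(* Let $\mathbb{K}$ be a field of characteristic zero, let $n\ge3$ and $k\ge2$ be integers, let $m=(n-1)k+1$, and let $\nu$ be a partition of $m$. Then the multiplicity of $S^\nu$ in $\rho_{n,k}$ is less than or equal to the Littlewood–Richardson coefficient $c^{\lambda}_{\mu,\nu}$, where $$\lambda=(k^{n-1},k-1,k-2,\dots,1),\qquad \mu=(k-1,k-2,\dots,2).$$
   Context: A LAnKe (Lie algebra of the $n$th kind, or Filippov algebra) over $\mathbb{K}$ is a $\mathbb{K}$-vector space $\mathcal{L}$ with an $n$-linear bracket $[-,\dots,-]:\mathcal{L}^n\to\mathcal{L}$ such that for all $x_i,y_j\in\mathcal{L}$: (i) $[x_1,\dots,x_n]=\operatorname{sgn}(\sigma)[x_{\sigma(1)},\dots,x_{\sigma(n)}]$ for every $\sigma\in\mathfrak{S}_n$; (ii) $[[x_1,\dots,x_n],y_1,\dots,y_{n-1}]=\sum_{i=1}^n[x_1,\dots,x_{i-1},[x_i,y_1,\dots,y_{n-1}],x_{i+1},\dots,x_n]$. Let $m=(n-1)k+1$ and $[m]=\{1,\dots,m\}$. The multilinear component $\mathrm{Lie}_n(m)$ of the free LAnKe (with $n$-ary bracket) on the generating set $[m]$ is the subspace spanned by the bracketed words on $[m]$ in which each $i\in[m]$ appears exactly once (each such word has exactly $k$ brackets). The symmetric group $\mathfrak{S}_m$ acts on it by replacing $i$ by $\sigma(i)$ in each bracketed word; the resulting representation is denoted $\rho_{n,k}$. For a partition $\nu$ of $m$, $S^\nu$ is the irreducible Specht module of $\mathfrak{S}_m$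 over $\mathbb{K}$ (with $S^{(m)}$ trivial). $c^\lambda_{\mu,\nu}$ is the Littlewood–Richardson coefficient, i.e. the coefficient of the Schur function $s_\lambda$ in $s_\mu s_\nu$. In $\lambda$, $k^{n-1}$ means that the part $k$ appears $n-1$ times; $\mu$ is the empty partition when $k=2$. *)

(* Defs.v *)
From HB Require Import structures.
From mathcomp Require Import all_boot all_order all_algebra all_fingroup.
From mathcomp Require Import all_character.
From mathcomp Require Import boolp mpoly.

Set Implicit Arguments.
Unset Strict Implicit.
Unset Printing Implicit Defensive.

Import GRing.Theory.
Local Open Scope quotient_scope.
Local Open Scope ring_scope.

Definition upd (n : nat) (T : Type) (x : {ffun 'I_n -> T}) (i : 'I_n) (a : T) :
  {ffun 'I_n -> T} := [ffun j => if j == i then a else x j].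

Definition multilinear (K : fieldType) (n : nat) (L L' : lmodType K)
    (br : {ffun 'I_n -> L} -> L') : Prop :=
  forall (x : {ffun 'I_n -> L}) (i : 'I_n) (a : K) (u v : L),
    br (upd x i (a *: u + v)) = a *: br (upd x i u) + br (upd x i v).

(* In the last clause the family y stands for y_1, ..., y_(n-1): its entry at
   index 0 is overwritten, so that [br (upd y i0 a)] is [a, y_1, ..., y_(n-1)]
   and [upd x i a] is x_1, ..., x_(i-1), a, x_(i+1), ..., x_n. *)
Definition is_LAnKe (K : fieldType) (n : nat) (L : lmodType K)
    (br : {ffun 'I_n -> L} -> L) : Prop :=
  [/\ multilinear br,
      forall (s : 'S_n) (x : {ffun 'I_n -> L}),
        br x = (-1) ^+ s *: br [ffun i => x (s i)]
    & forall (x y : {ffun 'I_n -> L}) (i0 : 'I_n), i0 = 0%N :> nat ->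
        br (upd y i0 (br x)) =
          \sum_(i < n) br (upd x i (br (upd y i0 (x i))))].

(* Formal expressions modulo the smallest congruence that imposes the axioms
   of a vector space and of [is_LAnKe]. *)
Section FreeLAnKe.
Variables (K : fieldType) (n : nat) (X : Type).

Inductive expr : Type :=
| EGen of X
| EZero
| EAdd of expr & expr
| EScale of K & expr
| EBr of {ffun 'I_n -> expr}.

Inductive lanke_eq : expr -> expr -> Prop :=
| lkeq_refl t : lanke_eq t t
| lkeq_sym t u : lanke_eq t u -> lanke_eq u t
| lkeq_trans t u v : lanke_eq t u -> lanke_eq u v -> lanke_eq t v
| lkeq_congD t t' u u' :
    lanke_eq t t' -> lanke_eq u u' -> lanke_eq (EAdd t u) (EAdd t' u')
| lkeq_congZ a t t' : lanke_eq t t' -> lanke_eq (EScale a t) (EScale a t')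
| lkeq_congB (x x' : {ffun 'I_n -> expr}) :
    (forall i, lanke_eq (x i) (x' i)) -> lanke_eq (EBr x) (EBr x')
| lkeq_addA t u v : lanke_eq (EAdd t (EAdd u v)) (EAdd (EAdd t u) v)
| lkeq_addC t u : lanke_eq (EAdd t u) (EAdd u t)
| lkeq_add0 t : lanke_eq (EAdd EZero t) t
| lkeq_addN t : lanke_eq (EAdd (EScale (-1) t) t) EZero
| lkeq_scaleA a b t : lanke_eq (EScale a (EScale b t)) (EScale (a * b) t)
| lkeq_scale1 t : lanke_eq (EScale 1 t) t
| lkeq_scaleDr a t u :
    lanke_eq (EScale a (EAdd t u)) (EAdd (EScale a t) (EScale a u))
| lkeq_scaleDl a b t :
    lanke_eq (EScale (a + b) t) (EAdd (EScale a t) (EScale b t))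
| lkeq_linear (x : {ffun 'I_n -> expr}) i a u v :
    lanke_eq (EBr (upd x i (EAdd (EScale a u) v)))
             (EAdd (EScale a (EBr (upd x i u))) (EBr (upd x i v)))
| lkeq_antisym (s : 'S_n) (x : {ffun 'I_n -> expr}) :
    lanke_eq (EBr x) (EScale ((-1) ^+ s) (EBr [ffun i => x (s i)]))
| lkeq_filippov (x y : {ffun 'I_n -> expr}) (i0 : 'I_n) : i0 = 0%N :> nat ->
    lanke_eq (EBr (upd y i0 (EBr x)))
             (\big[EAdd/EZero]_(i < n) EBr (upd x i (EBr (upd y i0 (x i))))).

HB.instance Definition _ := gen_eqMixin expr.
HB.instance Definition _ := gen_choiceMixin expr.

Lemma lanke_equiv : equiv_class_of (fun t u : expr => `[< lanke_eq t u >]).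
Proof.
split=> [t|t u|u t v].
- exact/asboolP/lkeq_refl.
- by apply/asboolP/asboolP; apply: lkeq_sym.
- by move=> /asboolP h1 /asboolP h2; apply/asboolP; exact: lkeq_trans h1 h2.
Qed.

Definition lanke_equiv_rel : equiv_rel expr := EquivRelPack lanke_equiv.

Definition freeLAnKe : Type := {eq_quot lanke_equiv_rel}.
HB.instance Definition _ := Choice.on freeLAnKe.

Definition fcls (t : expr) : freeLAnKe :=
  \pi_({eq_quot lanke_equiv_rel}) t.
Definition frep (x : freeLAnKe) : expr :=
  generic_quotient.repr (x : {eq_quot lanke_equiv_rel}).

Lemma fclsP t u : fcls t = fcls u <-> lanke_eq t u.
Proof.
split=> [h|h].
  by apply/asboolP; move/eqmodP: h.
by apply/eqmodP/asboolP.
Qed.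

Lemma frepK x : fcls (frep x) = x. Proof. exact: reprK. Qed.

Lemma fcls_rep t : lanke_eq (frep (fcls t)) t.
Proof. by apply/fclsP; rewrite frepK. Qed.

Definition fzero : freeLAnKe := fcls EZero.
Definition fadd (x y : freeLAnKe) := fcls (EAdd (frep x) (frep y)).
Definition fscale (a : K) (x : freeLAnKe) := fcls (EScale a (frep x)).
Definition fopp (x : freeLAnKe) := fscale (-1) x.

Definition fgen (x : X) : freeLAnKe := fcls (EGen x).
Definition fbr (x : {ffun 'I_n -> freeLAnKe}) : freeLAnKe :=
  fcls (EBr [ffun i => frep (x i)]).

Lemma faddE t u : fadd (fcls t) (fcls u) = fcls (EAdd t u).
Proof. by apply/fclsP/lkeq_congD; exact: fcls_rep. Qed.
Lemma fscaleE a t : fscale a (fcls t) = fcls (EScale a t).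
Proof. by apply/fclsP/lkeq_congZ; exact: fcls_rep. Qed.

Lemma faddA : associative fadd.
Proof.
move=> x y z; rewrite -[x]frepK -[y]frepK -[z]frepK !faddE.
exact/fclsP/lkeq_addA.
Qed.
Lemma faddC : commutative fadd.
Proof.
by move=> x y; rewrite -[x]frepK -[y]frepK !faddE; exact/fclsP/lkeq_addC.
Qed.
Lemma fadd0 : left_id fzero fadd.
Proof. by move=> x; rewrite -[x]frepK !faddE; exact/fclsP/lkeq_add0. Qed.
Lemma faddN : left_inverse fzero fopp fadd.
Proof.
by move=> x; rewrite -[x]frepK /fopp fscaleE faddE; exact/fclsP/lkeq_addN.
Qed.
HB.instance Definition _ :=
  GRing.isZmodule.Build freeLAnKe faddA faddC fadd0 faddN.

Lemma fscaleA a b x : fscale a (fscale b x) = fscale (a * b) x.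
Proof. by rewrite -[x]frepK !fscaleE; exact/fclsP/lkeq_scaleA. Qed.
Lemma fscale1 : left_id 1 fscale.
Proof. by move=> x; rewrite -[x]frepK !fscaleE; exact/fclsP/lkeq_scale1. Qed.
Lemma fclsD t u : fcls (EAdd t u) = fcls t + fcls u.
Proof. exact/esym/faddE. Qed.
Lemma fscaleDr : right_distributive fscale +%R.
Proof.
move=> a x y; rewrite -[x]frepK -[y]frepK -fclsD !fscaleE -fclsD.
exact/fclsP/lkeq_scaleDr.
Qed.
Lemma fscaleDl x : {morph fscale^~ x : a b / a + b}.
Proof.
move=> a b; rewrite -[x]frepK !fscaleE -fclsD.
exact/fclsP/lkeq_scaleDl.
Qed.
HB.instance Definition _ :=
  GRing.Zmodule_isLmodule.Build K freeLAnKe fscaleA fscale1 fscaleDr fscaleDl.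

Lemma fclsZ a t : fcls (EScale a t) = a *: fcls t.
Proof. exact/esym/fscaleE. Qed.
Lemma fclsB (x : {ffun 'I_n -> expr}) :
  fcls (EBr x) = fbr [ffun i => fcls (x i)].
Proof.
by apply/fclsP/lkeq_congB => i; rewrite !ffunE; apply/lkeq_sym/fcls_rep.
Qed.

Lemma fbr_upd (x : {ffun 'I_n -> freeLAnKe}) i t :
  fbr (upd x i (fcls t)) = fcls (EBr (upd [ffun j => frep (x j)] i t)).
Proof.
rewrite fclsB; congr fbr; apply/ffunP => j; rewrite !ffunE.
by case: eqP => // _; rewrite ?ffunE frepK.
Qed.

Lemma fbr_is_LAnKe : is_LAnKe fbr.
Proof.
split=> [x i a u v|s x|x y i0 hi0].
- rewrite -[u]frepK -[v]frepK -fclsZ -fclsD !fbr_upd -fclsZ -fclsD.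
  exact/fclsP/lkeq_linear.
- rewrite {1}/fbr -fclsZ; apply/fclsP/(lkeq_trans (lkeq_antisym s _)).
  apply/lkeq_congZ/lkeq_congB => i; rewrite !ffunE; exact: lkeq_refl.
rewrite -[fbr x]/(fcls (EBr [ffun j => frep (x j)])) fbr_upd.
have -> : \sum_(i < n) fbr (upd x i (fbr (upd y i0 (x i)))) =
    fcls (\big[EAdd/EZero]_(i < n)
      EBr (upd [ffun j => frep (x j)] i
        (EBr (upd [ffun j => frep (y j)] i0 ([ffun j => frep (x j)] i))))).
  rewrite (big_morph fcls fclsD (erefl _ : fcls EZero = 0)).
  by apply: eq_bigr => i _; rewrite -{1}[x i]frepK [fbr (upd y _ _)]fbr_upd fbr_upd ffunE.
exact/fclsP/lkeq_filippov.
Qed.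

Section Universal.
Variables (L : lmodType K) (br : {ffun 'I_n -> L} -> L) (f : X -> L).

Fixpoint eval_expr (t : expr) : L :=
  match t with
  | EGen x => f x
  | EZero => 0
  | EAdd t u => eval_expr t + eval_expr u
  | EScale a t => a *: eval_expr t
  | EBr x => br [ffun i => eval_expr (x i)]
  end.

Hypothesis brP : is_LAnKe br.

Lemma eval_upd (x : {ffun 'I_n -> expr}) i t :
  [ffun j => eval_expr (upd x i t j)] =
  upd [ffun j => eval_expr (x j)] i (eval_expr t).
Proof. by apply/ffunP => j; rewrite !ffunE; case: eqP; rewrite ?ffunE. Qed.

Lemma eval_eq t u : lanke_eq t u -> eval_expr t = eval_expr u.
Proof.
case: brP => hlin hanti hfil.
elim=> //= {t u}.
- by move=> t u v _ -> _ ->.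
- by move=> t t' u u' _ -> _ ->.
- by move=> a t t' _ ->.
- by move=> x x' _ h; congr br; apply/ffunP => i; rewrite !ffunE.
- by move=> t u v; rewrite addrA.
- by move=> t u; rewrite addrC.
- by move=> t; rewrite add0r.
- by move=> t; rewrite scaleN1r addNr.
- by move=> a b t; rewrite scalerA.
- by move=> t; rewrite scale1r.
- by move=> a t u; rewrite scalerDr.
- by move=> a b t; rewrite scalerDl.
- by move=> x i a u v; rewrite !eval_upd /= hlin.
- move=> s x; rewrite (hanti s); congr (_ *: br _).
  by apply/ffunP => i; rewrite !ffunE.
move=> x y i0 hi0; rewrite (big_morph eval_expr (id1 := 0) (op1 := +%R)) //.
rewrite eval_upd /= hfil //; apply: eq_bigr => i _.
by rewrite /= eval_upd /= eval_upd ffunE.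
Qed.

Definition flift (x : freeLAnKe) : L := eval_expr (frep x).

Lemma flift_cls t : flift (fcls t) = eval_expr t.
Proof. exact/eval_eq/fcls_rep. Qed.

Lemma flift_linear : linear flift.
Proof.
by move=> a x y; rewrite -[x]frepK -[y]frepK -fclsZ -fclsD !flift_cls.
Qed.

Lemma flift_gen x : flift (fgen x) = f x.
Proof. by rewrite flift_cls. Qed.

Lemma flift_br x : flift (fbr x) = br [ffun i => flift (x i)].
Proof. by rewrite flift_cls /=; congr br; apply/ffunP=> i; rewrite !ffunE. Qed.

Lemma flift_uniq (g : freeLAnKe -> L) :
  linear g -> (forall x, g (fgen x) = f x) ->
  (forall x, g (fbr x) = br [ffun i => g (x i)]) -> g =1 flift.
Proof.
move=> glin ggen gbr x; rewrite -[x]frepK flift_cls.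
pose G := GRing.isLinear.Build _ _ _ _ g glin.
pose g' : {linear freeLAnKe -> L} := HB.pack g G.
have gE : g =1 g' by [].
move: (frep x); fix IH 1; case=> [y||t u|a t|y] /=.
- exact: ggen.
- by rewrite gE -[fcls _]/(0 : freeLAnKe) raddf0.
- by rewrite fclsD -!IH gE raddfD.
- by rewrite fclsZ -IH gE linearZ.
- by rewrite fclsB gbr; congr br; apply/ffunP=> i; rewrite !ffunE IH.
Qed.

End Universal.

(* The universal property: [freeLAnKe] is the free Filippov algebra on [X]. *)
Lemma freeLAnKe_universal (L : lmodType K) (br : {ffun 'I_n -> L} -> L)
    (f : X -> L) : is_LAnKe br ->
  exists! g : freeLAnKe -> L,
    [/\ linear g, forall x, g (fgen x) = f x
      & forall x, g (fbr x) = br [ffun i => g (x i)]].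
Proof.
move=> brP; exists (flift br f); split.
  split; [exact: flift_linear|exact: flift_gen|exact: flift_br].
by move=> g [h1 h2 h3]; apply/funext => x; rewrite (flift_uniq brP h1 h2 h3).
Qed.

End FreeLAnKe.

Inductive bword (n : nat) (X : Type) : Type :=
| WGen of X
| WBr of {ffun 'I_n -> bword n X}.
Arguments WGen n {X} _.

Fixpoint wval (K : fieldType) (n : nat) (X : Type) (w : bword n X) :
    freeLAnKe K n X :=
  match w with
  | WGen x => fgen K n x
  | WBr f => fbr [ffun i => wval K (f i)]
  end.

Fixpoint wocc (n : nat) (X : eqType) (x : X) (w : bword n X) : nat :=
  match w with
  | WGen y => y == x
  | WBr f => \sum_(i < n) wocc x (f i)
  end.

Fixpoint wrelabel (n : nat) (X Y : Type) (s : X -> Y) (w : bword n X) :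
    bword n Y :=
  match w with
  | WGen x => WGen n (s x)
  | WBr f => WBr [ffun i => wrelabel s (f i)]
  end.

Definition multilinear_word (n m : nat) (w : bword n 'I_m) : Prop :=
  forall x : 'I_m, wocc x w = 1%N.

(* The subspace Lie_n(m) of the free algebra on [m]. *)
Definition Lie_comp (K : fieldType) (n m : nat) (x : freeLAnKe K n 'I_m) :
    Prop :=
  exists (N : nat) (a : 'I_N -> K) (w : 'I_N -> bword n 'I_m),
    (forall i, multilinear_word (w i)) /\
    x = \sum_(i < N) a i *: wval K (w i).

(* [rho] is a matrix form of the action of 'S_m on Lie_n(m), in the
   coordinates given by [phi].  Matrices act on row vectors from the right;
   since (s * t) x = t (s x) in 'S_m, this matches the left action by
   relabelling. *)
Definition affords_Lie (K : fieldType) (n m d : nat)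
    (rho : mx_representation K [set: 'S_m] d) : Prop :=
  exists phi : {linear 'rV[K]_d -> freeLAnKe K n 'I_m},
    [/\ injective phi,
        forall x, Lie_comp x <-> exists v, phi v = x
      & forall (s : 'S_m) (w : bword n 'I_m) (v : 'rV[K]_d),
          multilinear_word w -> phi v = wval K w ->
          phi (v *m rho s) = wval K (wrelabel s w)].

(* [r] of the summands in some decomposition of [rV] into a direct sum of
   irreducible submodules are isomorphic to [rS]. *)
Definition is_multiplicity (F : fieldType) (gT : finGroupType) (G : {group gT})
    (dS dV : nat) (rS : mx_representation F G dS)
    (rV : mx_representation F G dV) (r : nat) : Prop :=
  exists (t : nat) (W : 'I_t -> 'M[F]_dV)
         (Wmod : forall i, mxmodule rV (W i)) (A : {set 'I_t}),
    [/\ forall i, mxsimple rV (W i),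
        mxdirect (\sum_i W i),
        (\sum_i W i :=: 1%:M)%MS,
        forall i, i \in A <-> mx_rsim (submod_repr (Wmod i)) rS
      & #|A| = r].

Definition is_partn (m : nat) (nu : seq nat) : bool :=
  [&& sorted geq nu, 0%N \notin nu & sumn nu == m].

(* The cells (row, column) of the Young diagram, numbered from 0. *)
Definition cell (nu : seq nat) : finType :=
  {c : 'I_(size nu) * 'I_(head 0%N nu) | c.2 < nth 0%N nu c.1}%N.

Definition crow (nu : seq nat) (c : cell nu) : 'I_(size nu) := (val c).1.
Definition ccol (nu : seq nat) (c : cell nu) : 'I_(head 0%N nu) := (val c).2.

Section Specht.
Variables (K : fieldType) (m : nat) (nu : seq nat).

(* A tabloid is given by the function sending each letter to its row.  All
   functions are allowed here, so this is a direct sum of the tabloid modules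
   of the contents with [size nu] parts; polytabloids of shape nu only involve
   tabloids of shape nu. *)
Definition tabloid : finType := {ffun 'I_m -> 'I_(size nu)}.

Definition tabloid_act (f : tabloid) (s : 'S_m) : tabloid :=
  [ffun x => f ((s^-1)%g x)].

Definition tabloid_mx (s : 'S_m) : 'M[K]_#|tabloid| :=
  \matrix_(i, j) (tabloid_act (enum_val i) s == enum_val j)%:R.

Lemma tabloid_mx_repr : mx_repr [set: 'S_m] tabloid_mx.
Proof.
split=> [|s t _ _]; apply/matrixP => i j; rewrite !mxE.
  rewrite (_ : tabloid_act _ _ = enum_val i); last first.
    by apply/ffunP => x; rewrite ffunE invg1 perm1.
  by rewrite (inj_eq enum_val_inj).
rewrite (bigD1 (enum_rank (tabloid_act (enum_val i) s))) //= big1 ?addr0.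
  rewrite !mxE enum_rankK eqxx mul1r; congr ((_ == _)%:R).
  by apply/ffunP => x; rewrite !ffunE invMg permM.
move=> l hl; rewrite !mxE; case: eqP => [e|_]; last by rewrite mul0r.
by rewrite e enum_valK eqxx in hl.
Qed.

Definition tabloid_repr : mx_representation K [set: 'S_m] #|tabloid| :=
  MxRepresentation tabloid_mx_repr.

Definition tabloid_vec (f : tabloid) : 'rV[K]_#|tabloid| :=
  delta_mx 0 (enum_rank f).

(* A tableau is recorded by the position of each letter; it is a bijection
   onto the cells when it is injective and nu is a partition of m. *)
Definition tableau_tabloid (t : {ffun 'I_m -> cell nu}) : tabloid :=
  [ffun x => crow (t x)].

Definition col_stab (t : {ffun 'I_m -> cell nu}) (q : 'S_m) : bool :=
  [forall x, ccol (t (q x)) == ccol (t x)].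

Definition polytabloid (t : {ffun 'I_m -> cell nu}) : 'rV[K]_#|tabloid| :=
  \sum_(q : 'S_m | col_stab t q)
    (-1) ^+ q *: tabloid_vec (tabloid_act (tableau_tabloid t) q).

Definition specht_mx : 'M[K]_#|tabloid| :=
  (\sum_(t : {ffun 'I_m -> cell nu} | injectiveb t)
     cyclic_mx tabloid_repr (polytabloid t))%MS.

Lemma specht_mx_module : mxmodule tabloid_repr specht_mx.
Proof. by apply: sumsmx_module => t _; exact: cyclic_mx_module. Qed.

Definition specht_repr : mx_representation K [set: 'S_m] (\rank specht_mx) :=
  submod_repr specht_mx_module.

End Specht.

Definition is_ssyt (N : nat) (la : seq nat) (T : {ffun cell la -> 'I_N}) :
    bool :=
  [forall c, forall d,
    ((crow c == crow d) && (ccol c < ccol d)%N ==> (T c <= T d)%N) &&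
    ((ccol c == ccol d) && (crow c < crow d)%N ==> (T c < T d)%N)].

Definition schur (N : nat) (la : seq nat) : {mpoly int[N]} :=
  \sum_(T : {ffun cell la -> 'I_N} | is_ssyt T) \prod_(c : cell la) 'X_(T c).

(* With N = |mu| + |nu| variables the Schur polynomials of the partitions of N
   are linearly independent, so the expansion of the product is the expansion
   of the corresponding product of Schur functions. *)
Definition is_LR_coef (la mu nu : seq nat) (c : int) : Prop :=
  let N := (sumn mu + sumn nu)%N in
  exists (ps : seq (seq nat)) (f : seq nat -> int),
    [/\ uniq ps,
        forall p, (p \in ps) = is_partn N p,
        schur N mu * schur N nu = \sum_(p <- ps) f p *: schur N p,
        forall p, p \notin ps -> f p = 0
      & f la = c].

Definition LAnKe_la (n k : nat) : seq nat :=
  nseq n.-1 k ++ rev (iota 1 k.-1).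

Definition LAnKe_mu (k : nat) : seq nat := rev (iota 2 (k - 2)).

(* Main.v *)
From HB Require Import structures.
From mathcomp Require Import all_boot all_order all_algebra all_fingroup.
From mathcomp Require Import all_character.
From mathcomp Require Import boolp mpoly zify ring.
Require Import Defs.

Set Implicit Arguments.
Unset Strict Implicit.
Unset Printing Implicit Defensive.

Import GRing.Theory.
Local Open Scope ring_scope.

(** Put q = n - 1, so that m = q k + 1, and let la' and mu' be the partitions
    conjugate to la and mu; then mu' = (k-2, k-2, k-3, ..., 1) and
    la' - mu' = (q+1, q, ..., q) with k entries.

    The coefficient c^la_(mu,nu) counts the chains of partitions from mu to la
    in which each step adds a vertical strip, the sizes of the strips are the
    columns of nu, and the rows of the strips satisfy a lattice condition.  A
    chain is recorded by a 0-1 matrix, whose entry (j, c) says whether the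
    step c adds a box in row j; the matrices of such chains are [LRmat], and
    [LR_coefE] is this form of the Littlewood-Richardson rule.  It is proved
    by three sign-reversing involutions, all instances of [cancel_bad].

    On the other side, Lie_n(m) is spanned by the left combs
    v_s = [..[[s_0, s_1, .., s_q], s_(q+1), ..], ..] attached to the
    permutations s ([Lie_comp_combperm]), so that a copy of S^nu in rho_(n,k)
    gives a homomorphism h to S^nu that is determined by the vectors h(v_s).
    Pair them with the polytabloid of a fixed tableau t of shape nu and set
    u(s) = sgn(s) <h(v_s), e_t>; as S^nu is simple, u determines h
    ([wordfun_hom_eq0]).  By antisymmetry of the bracket u(s) depends only on
    the bracket in which each letter is put, hence u is a function on the
    words g of length m in the letters 0, ..., k-1 that have content
    la' - mu'.  The operators which replace one letter a by a letter b, in all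
    possible ways, make the functions on words into a representation of gl_k.
    The Filippov identity applied to two consecutive brackets says that the
    operator for b = a + 1 kills u for a = 0, and that its square kills u for
    a > 0 ([wfun_raise1], [wfun_raise2]).  The exponents are
    mu'_a - mu'_(a+1) + 1, so that these are the equations which cut out the
    vectors of weight la' - mu' in a representation of gl_k that produce
    highest weight vectors of weight la' after tensoring with the irreducible
    representation of highest weight mu'.

    The column relations of e_t make u symmetric in the letters of each column
    of t, and its Garnir relations hold for u as well.  A leading term
    argument then finishes the proof: the least word of the support of u, in
    an order which gives more weight to the columns of t further left, is
    row-strict by the Garnir relations ([leading_strict]) and satisfies a
    lattice condition by the raising equations ([leading_lattice]).  Hence u
    is determined by its values on these words ([lrfun_eq0]), up to
    permutations inside the columns of t.  The latter classes of words inject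
    into the matrices counted by c^la_(mu,nu) ([wmat_LRmat], [wmat_inj]):
    the letters i in column c of t become boxes which the step c adds to the
    column i of the Young diagram.  So at most c^la_(mu,nu) of the functions
    u, and hence of the homomorphisms h, are linearly independent, while r
    summands isomorphic to S^nu give r independent ones
    ([multiplicity_homs]). *)

(** * Sign-reversing cancellation and determinants *)

(** An object s carries, for each time t, a composition [n s t], which is a
    partition at time 0. The summand f s is cancelled against that of the
    object in which everything after the first violation of dominance is
    reflected; the times up to the violation are unchanged, so the reflected
    object has the same first violation. *)
Section Cancellation.
Variables (S : finType) (V : zmodType) (f : S -> V) (A : pred S).
Variables (T l : nat) (n : S -> nat -> nat -> nat) (th : nat -> nat -> S -> S).
Hypothesis V2 : forall v : V, v = - v -> v = 0.

Definition descent s t c := (n s t c < n s t c.+1)%N.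
Definition dominant s t := ~~ has (descent s t) (iota 0 l.-1).
Definition always_dominant s := all (dominant s) (iota 0 T.+1).

Lemma dominantP s t :
  reflect (forall c, (c.+1 < l)%N -> (n s t c.+1 <= n s t c)%N) (dominant s t).
Proof.
apply: (iffP hasPn) => h c hc.
  by rewrite leqNgt; apply: h; rewrite mem_iota; lia.
by rewrite -leqNgt; apply: h; move: hc; rewrite mem_iota; lia.
Qed.

Lemma always_dominantP s :
  reflect (forall t c, (t <= T)%N -> (c.+1 < l)%N -> (n s t c.+1 <= n s t c)%N)
    (always_dominant s).
Proof.
apply: (iffP allP) => [h t c ht|h t].
  by move: c; apply/dominantP; apply: h; rewrite mem_iota.
rewrite mem_iota => ht; apply/dominantP => c; apply: h; lia.
Qed.

Hypothesis n0 : forall s, A s -> dominant s 0.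
Hypothesis thP : forall s t c, A s -> (t < T)%N -> (c.+1 < l)%N ->
  dominant s t -> descent s t.+1 c ->
  [/\ A (th t.+1 c s),
      forall t' c', (t' <= t.+1)%N -> n (th t.+1 c s) t' c' = n s t' c',
      th t.+1 c (th t.+1 c s) = s & f (th t.+1 c s) = - f s].

Let fst_time s := find (predC (dominant s)) (iota 0 T.+1).
Let fst_desc s := find (descent s (fst_time s)) (iota 0 l.-1).
Let refl s := th (fst_time s) (fst_desc s) s.

Let bad s := A s && ~~ always_dominant s.

Lemma badP s : bad s -> exists t c,
  [/\ A s, (t < T)%N, (c.+1 < l)%N, fst_time s = t.+1
    & [/\ fst_desc s = c, dominant s t & descent s t.+1 c]].
Proof.
move=> /andP [As nd].
have hh : has (predC (dominant s)) (iota 0 T.+1).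
  by move: nd; rewrite /always_dominant -has_predC.
have hlt : (fst_time s < T.+1)%N by move: hh; rewrite has_find size_iota.
have := nth_find 0%N hh; rewrite -/(fst_time s) nth_iota //= add0n negbK => hd.
have hc : (fst_desc s < l.-1)%N by move: (hd); rewrite has_find size_iota.
have := nth_find 0%N hd; rewrite -/(fst_desc s) nth_iota //= add0n => hdc.
case et : (fst_time s) => [|t].
  by move: hd; rewrite et; move: (n0 As); rewrite /dominant => /negP.
exists t, (fst_desc s); split; [by []|lia|lia|by []|split; [by []| |by rewrite -et]].
have ht : (t < fst_time s)%N by rewrite et.
have := before_find 0%N ht; rewrite nth_iota ?add0n /=; last lia.
by move/negbFE.
Qed.

Lemma refl_bad s : bad s -> [/\ bad (refl s), refl (refl s) = s & f (refl s) = - f s].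
Proof.
move=> bs; have [t [c [As ht hc et [ec hd hdc]]]] := badP bs.
have [A' n' K' f'] := thP As ht hc hd hdc.
have dn t' : (t' <= t.+1)%N -> descent (refl s) t' =1 descent s t'.
  by move=> h c'; rewrite /refl et ec /descent !n'.
have dd t' : (t' <= t.+1)%N -> dominant (refl s) t' = dominant s t'.
  by move=> h; rewrite /dominant (eq_has (dn _ h)).
have et' : fst_time (refl s) = t.+1.
  rewrite -et /fst_time.
  have -> : iota 0 T.+1 = iota 0 t.+2 ++ iota t.+2 (T.+1 - t.+2).
    by rewrite -iotaD; congr iota; lia.
  rewrite !find_cat.
  have -> : has (predC (dominant (refl s))) (iota 0 t.+2) =
            has (predC (dominant s)) (iota 0 t.+2).
    by apply: eq_in_has => x; rewrite mem_iota => hx /=; rewrite dd //; lia.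
  have hs : has (predC (dominant s)) (iota 0 t.+2).
    apply/hasP; exists t.+1; first by rewrite mem_iota; lia.
    rewrite /= /dominant negbK; apply/hasP; exists c => //.
    by rewrite mem_iota; lia.
  rewrite hs; apply: eq_in_find => x; rewrite mem_iota => hx /=.
  by rewrite dd //; lia.
have ec' : fst_desc (refl s) = c.
  by rewrite -ec /fst_desc et et'; apply: eq_find => x; rewrite dn.
split; last by rewrite /refl et ec.
  rewrite /bad /refl et ec A' /= -has_predC; apply/hasP; exists t.+1.
    by rewrite mem_iota; lia.
  rewrite /= -et -ec -/(refl s) et dd // /dominant negbK.
  by apply/hasP; exists c => //; rewrite mem_iota; lia.
by rewrite {1}/refl et' ec' /refl et ec.
Qed.

Lemma cancel_bad :
  \sum_(s | A s) f s = \sum_(s | A s && always_dominant s) f s.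
Proof.
rewrite (bigID always_dominant) /= [X in _ + X](_ : _ = 0) ?addr0 //.
apply: V2; rewrite -sumrN.
rewrite (reindex_onto refl refl) /=; last first.
  by move=> s hs; have [_ ->] := refl_bad hs.
apply: eq_big => [s|s].
  apply/andP/idP => [[hb /eqP e]|hs].
    by have [] := refl_bad hb; rewrite e.
  by have [h -> _] := refl_bad hs; rewrite eqxx; split.
move=> /andP [hb /eqP e].
by have [_ _ h] := refl_bad hb; rewrite -{2}e h opprK.
Qed.

End Cancellation.

Lemma staircase_decr (x : nat -> nat) n :
  (forall c, (c.+1 < n)%N -> (x c.+1 <= x c)%N) ->
  forall i j, (i < j < n)%N -> (x j + (n - j) < x i + (n - i))%N.
Proof.
move=> hx i j /andP [hij hj]; elim: j hij hj => // j IH hij hj.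
have := hx j hj; case: (ltngtP i j) => h; [|lia|by subst i; lia].
by have := IH h (ltnW hj); lia.
Qed.

Section Determinants.
Variable R : comNzRingType.

(** The entries of the column j depend on j only through B j, so that gdet
    is alternating in the sequence B; both the alternants of polynomials and
    the determinants of indicator functions have this form. *)
Definition gdet l (G : 'I_l -> nat -> R) (B : nat -> nat) : R :=
  \det (\matrix_(i < l, j < l) G i (B j)).

Lemma eq_gdet l (G : 'I_l -> nat -> R) B B' :
  (forall j, (j < l)%N -> B j = B' j) -> gdet G B = gdet G B'.
Proof. by move=> h; congr (\det _); apply/matrixP => i j; rewrite !mxE h. Qed.

Lemma gdet_swap l (G : 'I_l -> nat -> R) (B B' : nat -> nat) c :
  (c.+1 < l)%N -> B' c = B c.+1 -> B' c.+1 = B c ->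
  (forall j, (j < l)%N -> j != c -> j != c.+1 -> B' j = B j) ->
  gdet G B' = - gdet G B.
Proof.
move=> hc e1 e2 e3.
pose i1 := Ordinal (ltnW hc); pose i2 := Ordinal hc.
have -> : gdet G B' = \det (xcol i1 i2 (\matrix_(i < l, j < l) G i (B j))).
  congr (\det _); apply/matrixP => i j; rewrite !mxE; congr (G i _).
  case: tpermP => [->|->|/eqP n1 /eqP n2] //.
  by apply: e3.
rewrite xcolE det_mulmx det_perm odd_tperm.
have -> : i1 != i2 by apply/eqP => /(congr1 val) /=; lia.
by rewrite expr1 mulrN1.
Qed.

(** For decreasing sequences only the identity permutation can contribute:
    if the sequences differ, some value y i is missing from x and its row is
    zero. *)
Lemma gdet_indic l (x y : nat -> nat) :
  (forall i j, (i < j < l)%N -> (x j < x i)%N) ->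
  (forall i j, (i < j < l)%N -> (y j < y i)%N) ->
  gdet (fun i : 'I_l => fun b => (b == y i)%:R) x =
  [forall i : 'I_l, x i == y i]%:R.
Proof.
move=> hx hy; have hxy i j : (i < l)%N -> (j < l)%N -> x i = x j -> i = j.
  by move=> hi hj e; move: (hx i j) (hx j i); lia.
case: (boolP [forall i : 'I_l, x i == y i]) => [/forallP h|nh].
  rewrite /gdet (_ : \matrix_(i, j) _ = 1%:M) ?det1 //.
  apply/matrixP => i j; rewrite !mxE -(eqP (h i)); congr (_%:R); congr nat_of_bool.
  rewrite eq_sym; apply/eqP/eqP => [e|-> //]; by apply: val_inj; apply: hxy; rewrite ?ltn_ord.
have [i hi] : exists i : 'I_l, y i \notin map x (iota 0 l).
  apply/existsP; rewrite -negb_forall; apply: contra nh => /forallP h.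
  have sx : sorted gtn (map x (iota 0 l)).
    rewrite sorted_map; apply/(sortedP 0%N) => a; rewrite size_iota => ha.
    by rewrite !nth_iota //=; [apply: hx|]; lia.
  have sy : sorted gtn (map y (iota 0 l)).
    rewrite sorted_map; apply/(sortedP 0%N) => a; rewrite size_iota => ha.
    by rewrite !nth_iota //=; [apply: hy|]; lia.
  have tr : transitive gtn by move=> a b c /= h1 h2; lia.
  have ir : irreflexive gtn by move=> a /=; lia.
  have e : map x (iota 0 l) = map y (iota 0 l).
    apply/esym/(sorted_eq tr) => //; first by move=> a b /=; lia.
    apply: uniq_perm; [exact: (sorted_uniq tr ir)|exact: (sorted_uniq tr ir)|].
    have sub : {subset map y (iota 0 l) <= map x (iota 0 l)}.
      move=> z /mapP [a]; rewrite mem_iota add0n => /= ha ->.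
      exact: (h (Ordinal ha)).
    have [] // := uniq_min_size (sorted_uniq tr ir sy) sub.
    by rewrite !size_map.
  apply/forallP => i; apply/eqP.
  have := congr1 (nth 0%N ^~ i) e.
  by rewrite !(nth_map 0%N) ?size_iota // nth_iota.
rewrite /gdet (expand_det_row _ i) big1 // => j _; rewrite mxE.
rewrite (_ : (_ == _) = false) ?mul0r //.
apply/negP => /eqP e; move/negP: hi; apply.
by rewrite -e; apply: map_f; rewrite mem_iota /=.
Qed.

End Determinants.

(** * 0-1 matrices and alternants *)

Section Bmat.
Variables N l : nat.

Definition bmat : finType := {ffun 'I_N * 'I_l -> bool}.

(** Entries are total functions of natural numbers, zero outside the matrix,
    so that sums over ranges of rows or columns need no bound proofs. *)
Definition ent (M : bmat) (j c : nat) : bool :=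
  if (insub j, insub c) is (Some j', Some c') then M (j', c') else false.

Definition mkb (g : nat -> nat -> bool) : bmat := [ffun x : 'I_N * 'I_l => g x.1 x.2].

Lemma ent_ord (M : bmat) (j : 'I_N) (c : 'I_l) : ent M j c = M (j, c).
Proof. by rewrite /ent !valK. Qed.

Lemma ent_mk g j c : ent (mkb g) j c = [&& (j < N)%N, (c < l)%N & g j c].
Proof.
rewrite /ent; case: insubP => [j' _ <-|/negbTE -> //].
by case: insubP => [c' _ <-|/negbTE ->]; rewrite ?andbF ?ltn_ord // ffunE.
Qed.

Lemma ent_out M j c : ~~ ((j < N) && (c < l))%N -> ent M j c = false.
Proof.
by rewrite /ent; case: insubP => [j' hj _|_] //; case: insubP => [c' hc _|_]; rewrite ?hj ?hc.
Qed.

Lemma ent_ext M M' :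
  (forall j c, (j < N)%N -> (c < l)%N -> ent M j c = ent M' j c) -> M = M'.
Proof. by move=> h; apply/ffunP => -[j c]; rewrite -!ent_ord h. Qed.

Definition rowsum M j := (\sum_(0 <= c < l) ent M j c)%N.
Definition colsum M c := (\sum_(0 <= j < N) ent M j c)%N.

End Bmat.

Arguments mkb {N l} g.

Definition swapn c i := if i == c then c.+1 else if i == c.+1 then c else i.

Lemma swapnK c : involutive (swapn c).
Proof.
by move=> i; rewrite /swapn; do ![case: eqP => //=]; lia.
Qed.

Section Expansions.
Variables (R : comNzRingType) (R2 : forall v : R, v = - v -> v = 0).
Variables (N l : nat) (X : 'I_N -> R) (mu th : nat -> nat).
Hypothesis mudec : forall j, (mu j.+1 <= mu j)%N.
Hypothesis thdec : forall j, (th j.+1 <= th j)%N.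

(** The alternant of B + (N, N-1, ..., 1); the staircase ends with 1 instead
    of 0, which multiplies all alternants by the same monomial. *)
Definition Alt (B : nat -> nat) : R :=
  gdet (fun i b => X i ^+ b) (fun j => (B j + (N - j))%N).
(** The sign of the permutation that takes t + (l, ..., 1) to th + (l, ...,
    1), and 0 when there is none. Weighting the matrices by [alt (colsum M)]
    gives the expansion of the Schur polynomial with column lengths th as a
    determinant of elementary symmetric polynomials ([sum_prefix_dominant]). *)
Definition alt (t : nat -> nat) : R :=
  gdet (fun i : 'I_l => fun b => (b == (th i + (l - i))%N)%:R)
       (fun j => (t j + (l - j))%N).
Definition mon (M : bmat N l) : R := \prod_(j < N) X j ^+ rowsum M j.

Definition rowperm (s : 'S_N) (M : bmat N l) : bmat N l :=
  [ffun x => M (s x.1, x.2)].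

Lemma rowsum_perm s M (j : 'I_N) : rowsum (rowperm s M) j = rowsum M (s j).
Proof. by rewrite /rowsum !big_mkord; apply: eq_bigr => c _; rewrite !ent_ord ffunE. Qed.

Lemma colsum_perm s M (c : nat) : colsum (rowperm s M) c = colsum M c.
Proof.
rewrite /colsum !big_mkord [RHS](reindex_inj (@perm_inj _ s)) /=.
apply: eq_bigr => j _; case: (ltnP c l) => hc; last by rewrite !ent_out //; lia.
by rewrite -[c]/(val (Ordinal hc)) !ent_ord ffunE.
Qed.

(** The sum is a symmetric polynomial: permuting the rows of the matrices
    matches its monomials with those of each term of the alternant. *)
Lemma Alt_mul_sum (B : nat -> nat) (a : bmat N l -> R) :
  (forall s M, a (rowperm s M) = a M) ->
  Alt B * (\sum_M a M * mon M) =
  \sum_M a M * Alt (fun j => (B j + rowsum M j)%N).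
Proof.
move=> ha; rewrite /Alt /gdet /determinant mulr_suml.
under [RHS]eq_bigr do rewrite mulr_sumr.
rewrite exchange_big /=; apply: eq_bigr => s _.
rewrite (reindex_inj (h := rowperm s)) /=; last first.
  move=> M M' /ffunP e; apply/ffunP => -[j c].
  by move: (e ((s^-1)%g j, c)); rewrite !ffunE /= permKV.
rewrite mulr_sumr; apply: eq_bigr => M _; rewrite ha mulrCA; congr (_ * _).
rewrite -mulrA; congr (_ * _); rewrite /mon -big_split /=.
apply: eq_bigr => i _; rewrite !mxE rowsum_perm -exprD; congr (_ ^+ _); lia.
Qed.

Definition psum (M : bmat N l) t j := (mu j + \sum_(0 <= c < t) ent M j c)%N.

Lemma psumS (M : bmat N l) t j : psum M t.+1 j = (psum M t j + ent M j t)%N.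
Proof. by rewrite /psum big_nat_recr //= addnA. Qed.

Lemma eq_psum (M M' : bmat N l) t j :
  (forall c, (c < t)%N -> ent M j c = ent M' j c) -> psum M t j = psum M' t j.
Proof.
by move=> h; congr addn; rewrite !big_nat; apply: eq_bigr => c /andP [_ hc]; rewrite h.
Qed.

Lemma psum_all (M : bmat N l) j : psum M l j = (mu j + rowsum M j)%N. Proof. by []. Qed.

Definition colsteps := always_dominant (S := bmat N l) l N psum.

(** If a partial sum mu + (columns < t) stops being a partition at the rows
    j and j+1, these two rows agree after adding the staircase; exchanging
    them in all later columns changes the sign of the alternant and
    preserves all column sums. *)
Lemma Alt_sum_colsteps :
  \sum_(M : bmat N l) alt (colsum M) * Alt (fun j => (mu j + rowsum M j)%N) =
  \sum_(M : bmat N l | colsteps M) alt (colsum M) * Alt (fun j => (mu j + rowsum M j)%N).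
Proof.
pose rfl t j (M : bmat N l) : bmat N l :=
  mkb (fun r c => if (c < t)%N then ent M r c else ent M (swapn j r) c).
apply: (cancel_bad (th := rfl)) => //.
  by move=> M _; apply/dominantP => c _; rewrite /psum !big_geq // !addn0.
move=> M t j _ ht hj dom; rewrite /descent => des.
have swlt r : (r < N)%N -> (swapn j r < N)%N by rewrite /swapn; do 2?[case: ifP => _]; lia.
have step : psum M t.+1 j.+1 = (psum M t.+1 j).+1.
  have := dominantP _ _ _ _ dom j hj; move: des; rewrite !psumS.
  by case: (ent M j t); case: (ent M j.+1 t) => /=; lia.
have P' t' r : (t' <= t.+1)%N -> (r < N)%N -> psum (rfl t.+1 j M) t' r = psum M t' r.
  move=> h hr; apply: eq_psum => c hc; rewrite ent_mk hr /=.
  have -> : (c < l)%N by lia. have -> // : (c < t.+1)%N by lia.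
split=> //.
- move=> t' r h; case: (ltnP r N) => hr; first exact: P'.
  by apply: eq_psum => c _; rewrite !ent_out //; lia.
- apply: ent_ext => r c hr hc; rewrite ent_mk hr hc /= !ent_mk swlt // hr hc /=.
  by rewrite swapnK; case: (_ < t.+1)%N.
rewrite -mulrN; congr (_ * _).
  apply: eq_gdet => c hc; congr (_ + _)%N; rewrite /colsum.
  case: (ltnP c t.+1) => hct.
    by rewrite !big_nat; apply: eq_bigr => r /andP [_ hr]; rewrite ent_mk hr hc hct.
  rewrite !big_mkord [LHS](reindex_inj (@perm_inj _ (tperm (Ordinal (ltnW hj)) (Ordinal hj)))) /=.
  apply: eq_bigr => r _; rewrite ent_mk ltn_ord hc ltnNge hct /=.
  congr (nat_of_bool (ent M _ _)); rewrite /swapn.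
  by case: tpermP => [->|->|/eqP n1 /eqP n2] /=;
    rewrite ?eqxx ?(negbTE n1) ?(negbTE n2) ?ifN //; lia.
have tot M' r : (mu r + rowsum M' r)%N =
    (psum M' t.+1 r + \sum_(t.+1 <= c < l) ent M' r c)%N.
  by rewrite -psum_all /psum -addnA -big_cat_nat //=; lia.
have tail r : (r < N)%N -> (\sum_(t.+1 <= c < l) ent (rfl t.+1 j M) r c =
    \sum_(t.+1 <= c < l) ent M (swapn j r) c)%N.
  move=> hr; rewrite !big_nat; apply: eq_bigr => c /andP [h1 h2].
  by rewrite ent_mk hr h2 ltnNge h1.
apply: (@gdet_swap _ _ _ _ _ j) => //.
- by rewrite !tot P' ?tail ?(ltnW hj) // /swapn eqxx step; lia.
- rewrite !tot P' ?tail // /swapn eqxx ifN ?step; lia.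
move=> r hr n1 n2; rewrite !tot P' // tail //.
by rewrite /swapn (negbTE n1) (negbTE n2).
Qed.

Definition prefix (M : bmat N l) t c := (\sum_(0 <= j < t) ent M j c)%N.
Definition suffix (M : bmat N l) t c := (\sum_(N - t <= j < N) ent M j c)%N.

Lemma alt_swap t t' c : (c.+1 < l)%N ->
  (t' c).+1 = t c.+1 -> t' c.+1 = (t c).+1 ->
  (forall j, (j < l)%N -> j != c -> j != c.+1 -> t' j = t j) ->
  alt t' = - alt t.
Proof.
move=> hc e1 e2 e3; apply: (@gdet_swap _ _ _ _ _ c) => //=; [lia|lia|].
by move=> j h1 h2 h3; rewrite e3.
Qed.

Lemma alt_dec t : (forall c, (c.+1 < l)%N -> (t c.+1 <= t c)%N) ->
  alt t = [forall c : 'I_l, t c == th c]%:R.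
Proof.
move=> ht; rewrite /alt.
rewrite (@gdet_indic _ l (fun j => t j + (l - j))%N (fun i => th i + (l - i))%N).
- by congr (nat_of_bool _)%:R; apply: eq_forallb => i; rewrite eqn_add2r.
- exact: staircase_decr.
exact: (staircase_decr (x := th)).
Qed.

(** If the column sums of the top t rows stop being decreasing at the
    columns c and c+1, exchanging these columns in all later rows changes
    the sign of [alt] and preserves the row sums. The matrices that survive
    are those of semistandard tableaux, the entry (j, c) saying that j
    occurs in column c. *)
Lemma sum_prefix_dominant :
  \sum_(M : bmat N l) alt (colsum M) * mon M =
  \sum_(M : bmat N l | always_dominant N l prefix M && [forall c : 'I_l, colsum M c == th c]) mon M.
Proof.
pose rfl t c (M : bmat N l) : bmat N l :=
  mkb (fun r c' => if (r < t)%N then ent M r c' else ent M r (swapn c c')).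
rewrite (cancel_bad (A := xpredT) (T := N) (l := l) (n := prefix) (th := rfl)) //.
- rewrite [RHS]big_mkcondr /=; apply: eq_bigr => M /always_dominantP h.
  rewrite alt_dec; last by move=> c hc; exact: h.
  by case: ifP; rewrite ?mul1r ?mul0r.
- by move=> M _; apply/dominantP => c _; rewrite /prefix !big_geq.
move=> M t c _ ht hc dom; rewrite /descent => des.
have swlt r : (r < l)%N -> (swapn c r < l)%N by rewrite /swapn; do 2?[case: ifP => _]; lia.
have step : prefix M t.+1 c.+1 = (prefix M t.+1 c).+1.
  have := dominantP _ _ _ _ dom c hc; move: des.
  rewrite /prefix !(big_nat_recr t) //=.
  by case: (ent M t c); case: (ent M t c.+1) => /=; lia.
have P' t' r : (t' <= t.+1)%N -> prefix (rfl t.+1 c M) t' r = prefix M t' r.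
  move=> h; rewrite /prefix !big_nat; apply: eq_bigr => j /andP [_ hj].
  rewrite ent_mk; have -> : (j < N)%N by lia. have -> : (j < t.+1)%N by lia.
  by case: (ltnP r l) => //= hr; rewrite ent_out //; lia.
split=> //.
- apply: ent_ext => r r' hr hc'; rewrite ent_mk hr hc' /= !ent_mk swlt // hr hc' /=.
  by rewrite swapnK; case: (_ < t.+1)%N.
rewrite -mulNr; congr (_ * _).
  have tot M' r : colsum M' r = (prefix M' t.+1 r + \sum_(t.+1 <= j < N) ent M' j r)%N.
    by rewrite /colsum /prefix -big_cat_nat //=; lia.
  have tail r : (r < l)%N -> (\sum_(t.+1 <= j < N) ent (rfl t.+1 c M) j r =
      \sum_(t.+1 <= j < N) ent M j (swapn c r))%N.
    move=> hr; rewrite !big_nat; apply: eq_bigr => j /andP [h1 h2].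
    by rewrite ent_mk hr h2 ltnNge h1.
  apply: (@alt_swap _ _ c) => //.
  - by rewrite !tot P' ?tail ?(ltnW hc) // /swapn eqxx step; lia.
  - by rewrite !tot P' ?tail // /swapn eqxx ifN ?step; lia.
  move=> r hr n1 n2; rewrite !tot P' // tail //.
  by rewrite /swapn (negbTE n1) (negbTE n2).
apply: eq_bigr => r _; congr (_ ^+ _); rewrite /rowsum.
case: (ltnP r t.+1) => hrt.
  by rewrite !big_nat; apply: eq_bigr => j /andP [_ hj]; rewrite ent_mk ltn_ord hj hrt.
rewrite !big_mkord [LHS](reindex_inj (@perm_inj _ (tperm (Ordinal (ltnW hc)) (Ordinal hc)))) /=.
apply: eq_bigr => j _; rewrite ent_mk ltn_ord ltn_ord ltnNge hrt /=.
congr (nat_of_bool (ent M _ _)); rewrite /swapn.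
by case: tpermP => [->|->|/eqP n1 /eqP n2] /=;
  rewrite ?eqxx ?(negbTE n1) ?(negbTE n2) ?ifN //; lia.
Qed.

End Expansions.

(** * A Bender-Knuth involution *)

(** The classes of a key with convex fibres are intervals; [star] reverses
    each of them. *)
Section Star.
Variables (K : eqType) (key : nat -> K) (q : nat).
Hypothesis convex : forall x y z, (x <= y <= z)%N -> (z < q)%N ->
  key x = key z -> key y = key x.

Definition class_lo r := find (fun x => key x == key r) (iota 0 q).
Definition class_hi r :=
  (class_lo r + find (fun x => key x != key r) (iota (class_lo r) (q - class_lo r)))%N.
Definition star r := (class_lo r + class_hi r - r.+1)%N.

Lemma class_itv r x : (r < q)%N -> (x < q)%N ->
  (key x == key r) = (class_lo r <= x < class_hi r)%N.
Proof.
move=> hr hx; have hlo : has (fun x => key x == key r) (iota 0 q).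
  by apply/hasP; exists r; rewrite ?mem_iota.
have lo_q : (class_lo r < q)%N by move: hlo; rewrite has_find size_iota.
have := nth_find 0%N hlo; rewrite -/(class_lo r) nth_iota // add0n => /eqP klo.
have hi_q : (class_hi r <= q)%N.
  have := find_size (fun x => key x != key r) (iota (class_lo r) (q - class_lo r)).
  by rewrite size_iota /class_hi; lia.
apply/eqP/idP => [kx|/andP [h1 h2]].
  have h1 : (class_lo r <= x)%N.
    rewrite leqNgt; apply/negP => h; have := before_find 0%N h.
    by rewrite nth_iota // add0n kx eqxx.
  rewrite h1 /= ltnNge; apply/negP => h.
  have hh : has (fun x => key x != key r) (iota (class_lo r) (q - class_lo r)).
    by rewrite has_find size_iota; move: h; rewrite /class_hi; lia.
  have := nth_find 0%N hh; rewrite nth_iota; last by move: h; rewrite /class_hi; lia.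
  rewrite -/(class_hi r) => /eqP; apply.
  rewrite (@convex (class_lo r) (class_hi r) x) // ?klo ?kx //.
  by rewrite h andbT /class_hi leq_addr.
have h3 : (x - class_lo r < find (fun x => key x != key r) (iota (class_lo r) (q - class_lo r)))%N.
  by move: h2; rewrite /class_hi; lia.
have := before_find 0%N h3; rewrite nth_iota ?subnKC //; last by lia.
by move/negbFE/eqP.
Qed.

Lemma class_hi_le r : (r < q)%N -> (class_hi r <= q)%N.
Proof.
move=> hr; have := find_size (fun x => key x != key r) (iota (class_lo r) (q - class_lo r)).
have : (class_lo r <= q)%N.
  by rewrite /class_lo -[X in (_ <= X)%N](size_iota 0 q) find_size.
by rewrite size_iota /class_hi; lia.
Qed.

Lemma eq_class r x : key x = key r -> class_lo x = class_lo r /\ class_hi x = class_hi r.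
Proof. by move=> e; rewrite /class_hi /class_lo e. Qed.

Lemma star_lt r : (r < q)%N -> (star r < q)%N.
Proof.
move=> hr; have := class_itv hr hr; rewrite eqxx => /esym.
have := class_hi_le hr; rewrite /star; lia.
Qed.

Lemma key_star r : (r < q)%N -> key (star r) = key r.
Proof.
move=> hr; apply/eqP; rewrite class_itv ?star_lt //.
have := class_itv hr hr; rewrite eqxx => /esym; rewrite /star; lia.
Qed.

Lemma starK r : (r < q)%N -> star (star r) = r.
Proof.
move=> hr; rewrite {1}/star; have [-> ->] := eq_class (key_star hr).
have := class_itv hr hr; rewrite eqxx => /esym; rewrite /star; lia.
Qed.

Lemma star_next r : (r.+1 < q)%N -> key r.+1 = key r -> star r = (star r.+1).+1.
Proof.
move=> hr e; rewrite {2}/star; have [-> ->] := eq_class e.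
have := class_itv hr hr; have := eq_class e; rewrite eqxx => -[-> ->] /esym.
rewrite /star; lia.
Qed.

Lemma sum_star (F : nat -> nat) :
  (\sum_(0 <= r < q) F (star r) = \sum_(0 <= r < q) F r)%N.
Proof.
rewrite !big_mkord.
pose s (r : 'I_q) : 'I_q := Ordinal (star_lt (ltn_ord r)).
rewrite [RHS](reindex_inj (h := s)) //.
by apply: (can_inj (g := s)) => r; apply: val_inj; rewrite /= starK.
Qed.

End Star.

Lemma eq_star (K : eqType) (key key' : nat -> K) q r :
  key =1 key' -> star key q r = star key' q r.
Proof. by move=> /funext ->. Qed.

(** Exchange the columns c and c+1 in the rows above the first violation of
    the suffix condition. The two strips added by these columns must remain
    vertical strips between the partial sums p at c and p'' at c+2, which
    are kept: inside a block of consecutive rows with equal p and equal p'',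
    the rows are also reversed, since p' must again be decreasing there. *)
Section BenderKnuth.
Variables (R : comNzRingType) (R2 : forall v : R, v = - v -> v = 0).
Variables (N l : nat) (X : 'I_N -> R) (mu th : nat -> nat).
Hypothesis mudec : forall j, (mu j.+1 <= mu j)%N.
Hypothesis thdec : forall j, (th j.+1 <= th j)%N.

Definition bkkey (M : bmat N l) c r := (psum mu M c r, psum mu M c.+2 r).

Definition bk t c (M : bmat N l) : bmat N l :=
  mkb (fun r c' => if (N - t <= r)%N then ent M r c' else
    if (c' == c) || (c' == c.+1) then
      ent M (star (bkkey M c) (N - t) r) (swapn c c') else ent M r c').

Section Step.
Variables (M : bmat N l) (t c : nat).
Hypothesis (HM : colsteps mu M) (ht : (t < N)%N) (hc : (c.+1 < l)%N).
Hypothesis dom : dominant l (@suffix N l) M t.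
Hypothesis des : descent (@suffix N l) M t.+1 c.

Let q := (N - t.+1)%N.
Let M' := bk t.+1 c M.
Let st := star (bkkey M c) q.

Let psum_dec c' j : (c' <= l)%N -> (j.+1 < N)%N -> (psum mu M c' j.+1 <= psum mu M c' j)%N.
Proof. exact: (always_dominantP _ _ _ _ HM). Qed.

Let psum_dec2 c' i j : (c' <= l)%N -> (i <= j)%N -> (j < N)%N ->
  (psum mu M c' j <= psum mu M c' i)%N.
Proof.
move=> h1; elim: j => [|j IH]; first by rewrite leqn0 => /eqP ->.
rewrite leq_eqVlt => /orP [/eqP -> //|hij] hj.
exact: leq_trans (psum_dec h1 hj) (IH hij (ltnW hj)).
Qed.

Let suffixE t' c' : (t' < N)%N ->
  suffix M t'.+1 c' = (ent M (N - t'.+1) c' + suffix M t' c')%N.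
Proof.
move=> h; rewrite /suffix big_ltn; last by lia.
by congr (_ + bigop.body _ _ _)%N; congr index_iota; lia.
Qed.

(** The violation occurs in the row q of the matrix, which lies just below
    the rows that are exchanged. *)
Let desc_row : [/\ ent M q c = false, ent M q c.+1 = true
  & suffix M t.+1 c.+1 = (suffix M t.+1 c).+1].
Proof.
have := dominantP _ _ _ _ dom c hc; move: des; rewrite /descent !suffixE // -/q.
by case: (ent M q c); case: (ent M q c.+1) => /=; split=> //; lia.
Qed.

Let conv : forall x y z, (x <= y <= z)%N -> (z < q)%N ->
  bkkey M c x = bkkey M c z -> bkkey M c y = bkkey M c x.
Proof.
move=> x y z /andP [h1 h2] hz [e1 e2]; rewrite /bkkey.
have zN : (z < N)%N by rewrite /q in hz; lia.
congr pair.
  have := psum_dec2 (c' := c) ltac:(lia) h1 ltac:(lia).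
  by have := psum_dec2 (c' := c) ltac:(lia) h2 ltac:(lia); rewrite -e1; lia.
have := psum_dec2 (c' := c.+2) ltac:(lia) h1 ltac:(lia).
by have := psum_dec2 (c' := c.+2) ltac:(lia) h2 ltac:(lia); rewrite -e2; lia.
Qed.

Let ent_hi r c' : (q <= r)%N -> ent M' r c' = ent M r c'.
Proof.
move=> h; rewrite ent_mk -/q h; case: (ltnP r N) => hr; case: (ltnP c' l) => hc' //=;
  by rewrite ent_out //; lia.
Qed.

Let ent_other r c' : c' != c -> c' != c.+1 -> ent M' r c' = ent M r c'.
Proof.
move=> h1 h2; rewrite ent_mk (negbTE h1) (negbTE h2) /= if_same.
by case: (ltnP r N) => hr; case: (ltnP c' l) => hc' //=; rewrite ent_out //; lia.
Qed.

Let ent_c r : (r < q)%N -> ent M' r c = ent M (st r) c.+1.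
Proof.
move=> h; rewrite ent_mk -/q (_ : (q <= r)%N = false) ?eqxx; last lia.
rewrite /= /swapn eqxx.
have -> : (r < N)%N by rewrite /q in h; lia.
by rewrite (ltnW hc).
Qed.

Let ent_c1 r : (r < q)%N -> ent M' r c.+1 = ent M (st r) c.
Proof.
move=> h; rewrite ent_mk -/q (_ : (q <= r)%N = false) ?eqxx; last lia.
rewrite orbT /= /swapn eqxx ifN ?hc; last by lia.
by have -> : (r < N)%N by rewrite /q in h; lia.
Qed.

Let qN : (q < N)%N. Proof. rewrite /q; lia. Qed.

Let psum_le_c c' r : (c' <= c)%N -> psum mu M' c' r = psum mu M c' r.
Proof. by move=> h; apply: eq_psum => x hx; rewrite ent_other //; lia. Qed.

Let psum_c2 r : psum mu M' c.+2 r = psum mu M c.+2 r.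
Proof.
rewrite !psumS psum_le_c //; case: (ltnP r q) => hr; last by rewrite !ent_hi.
have := key_star conv hr; rewrite -/st => -[e1]; rewrite !psumS e1 => e2.
by rewrite ent_c // ent_c1 //; lia.
Qed.

Let psum_ge_c c' r : (c.+2 <= c')%N -> psum mu M' c' r = psum mu M c' r.
Proof.
move=> h; rewrite -(subnKC h); elim: (c' - c.+2)%N => [|x IH].
  by rewrite addn0 psum_c2.
by rewrite addnS [LHS]psumS [RHS]psumS IH ent_other //; lia.
Qed.

Let psum_c1_hi r : (q <= r)%N -> psum mu M' c.+1 r = psum mu M c.+1 r.
Proof. by move=> h; rewrite !psumS psum_le_c // ent_hi. Qed.

Let bk_colsteps : colsteps mu M'.
Proof.
apply/always_dominantP => c' j h hj.
case: (ltngtP c' c.+1) => hcc.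
- by rewrite !psum_le_c //; apply: psum_dec.
- by rewrite !psum_ge_c //; apply: psum_dec.
subst c'; case: (leqP q j) => hq; first by rewrite !psum_c1_hi ?psum_dec //; lia.
have d0 := psum_dec (c' := c) ltac:(lia) hj.
have d2 := psum_dec (c' := c.+2) ltac:(lia) hj.
case: (ltnP j.+1 q) => hq1; last first.
  have ej : j.+1 = q by lia.
  rewrite psum_c1_hi; last lia.
  rewrite !psumS psum_le_c // ej; have [-> _ _] := desc_row.
  by rewrite -ej; lia.
have x1 j' := psumS mu M' c j'; have x2 j' := psumS mu M' c.+1 j'.
move: (x1 j) (x1 j.+1) (x2 j) (x2 j.+1).
rewrite !psum_c2 ![psum mu M' c _]psum_le_c //.
(* Between two blocks p or p'' drops by one at least, which leaves room for
   the new strip; inside a block the reversal turns the old inequality into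
   the new one. *)
case: (altP (bkkey M c j.+1 =P bkkey M c j)) => hk; last first.
  have : (psum mu M c j.+1 < psum mu M c j)%N || (psum mu M c.+2 j.+1 < psum mu M c.+2 j)%N.
    by move: hk; rewrite /bkkey xpair_eqE; lia.
  have := leq_b1 (ent M' j.+1 c); have := leq_b1 (ent M' j c.+1); clear -d0 d2 ; lia.
move=> -> -> _ _; rewrite !ent_c; [|lia|lia]; apply: leq_add; first exact: d0.
have e := star_next conv hq1 hk; rewrite -/st in e; rewrite e.
set s := st j.+1 in e *.
have hs : (s.+1 < q)%N by rewrite -e /st star_lt.
have ks : bkkey M c s.+1 = bkkey M c s by rewrite -e /s /st !key_star.
have [_ k2] := ks.
have := psum_dec (c' := c.+1) ltac:(lia) (ltn_trans hs qN).
move: k2; rewrite [psum mu M c.+2 _]psumS [psum mu M c.+2 s]psumS.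
by case: (ent M s c.+1); case: (ent M s.+1 c.+1) => //=; lia.
Qed.

Let bk_suffix t' c' : (t' <= t.+1)%N -> suffix M' t' c' = suffix M t' c'.
Proof.
by move=> h; rewrite /suffix !big_nat; apply: eq_bigr => r hr; rewrite ent_hi // /q; lia.
Qed.

Let bkK : bk t.+1 c M' = M.
Proof.
apply: ent_ext => r c' hr hc'; rewrite ent_mk hr hc' /= -/q.
case: (leqP q r) => hq; first exact: ent_hi.
case: ifP => [hcc|/negbT]; last by rewrite negb_or => /andP [h1 h2]; exact: ent_other.
have -> : star (bkkey M' c) q r = st r.
  by apply: eq_star => x; rewrite /bkkey psum_c2 psum_le_c.
have hst : (st r < q)%N by apply: star_lt.
case/orP: hcc => /eqP ->.
  by rewrite /swapn eqxx ent_c1 // /st starK.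
by rewrite /swapn eqxx ifN ?ent_c /st ?starK //; lia.
Qed.

Let colE (P : bmat N l) c' :
  colsum P c' = (\sum_(0 <= r < q) ent P r c' + suffix P t.+1 c')%N.
Proof. by rewrite /colsum /suffix -big_cat_nat //=; rewrite /q; lia. Qed.

Let bk_weight :
  alt R l th (colsum M') * Alt X (fun j => (mu j + rowsum M' j)%N) =
  - (alt R l th (colsum M) * Alt X (fun j => (mu j + rowsum M j)%N)) :> R.
Proof.
have [_ _ e] := desc_row.
rewrite -mulNr; congr (_ * _); last first.
  by apply: eq_gdet => j hj; rewrite -!psum_all psum_ge_c.
have s1 : (\sum_(0 <= r < q) ent M' r c = \sum_(0 <= r < q) ent M r c.+1)%N.
  rewrite -[RHS](sum_star conv) !big_nat; apply: eq_bigr => r hr; rewrite ent_c //; lia.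
have s2 : (\sum_(0 <= r < q) ent M' r c.+1 = \sum_(0 <= r < q) ent M r c)%N.
  rewrite -[RHS](sum_star conv) !big_nat; apply: eq_bigr => r hr; rewrite ent_c1 //; lia.
apply: (@alt_swap R l th _ _ c) => //.
- by rewrite !colE s1 bk_suffix // e; lia.
- by rewrite !colE s2 bk_suffix // e; lia.
move=> j hj h1 h2; rewrite /colsum; apply: eq_bigr => r _; rewrite ent_other //.
Qed.

Lemma bkP :
  [/\ colsteps mu (bk t.+1 c M),
      forall t' c', (t' <= t.+1)%N -> suffix (bk t.+1 c M) t' c' = suffix M t' c',
      bk t.+1 c (bk t.+1 c M) = M &
      alt R l th (colsum M') * Alt X (fun j => (mu j + rowsum M' j)%N) =
      - (alt R l th (colsum M) * Alt X (fun j => (mu j + rowsum M j)%N)) :> R].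
Proof.
by split; [exact: bk_colsteps|exact: bk_suffix|exact: bkK|exact: bk_weight].
Qed.

End Step.

(** The partial sums of mu and the columns of M form a chain of partitions
    with vertical strips as steps; the condition on suffixes is the lattice
    condition for the rows of the boxes, read from the bottom row upwards. *)
Definition LRmat (M : bmat N l) :=
  [&& colsteps mu M, always_dominant N l (@suffix N l) M
    & [forall c : 'I_l, colsum M c == th c]].

Lemma sum_LRmat :
  \sum_(M : bmat N l) alt R l th (colsum M) * Alt X (fun j => (mu j + rowsum M j)%N) =
  \sum_(M | LRmat M) Alt X (fun j => (mu j + rowsum M j)%N) :> R.
Proof.
rewrite Alt_sum_colsteps //.
rewrite (cancel_bad (T := N) (l := l) (n := @suffix N l) (th := bk)) //.
- rewrite [RHS](eq_bigl (fun M => (colsteps mu M && always_dominant N l (@suffix N l) M)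
    && [forall c : 'I_l, colsum M c == th c])); last by move=> M; rewrite -andbA.
  rewrite [RHS]big_mkcondr /=; apply: eq_bigr => M /andP [_ /always_dominantP h].
  rewrite alt_dec //; last first.
    by move=> c hc; have := h N c (leqnn _) hc; rewrite /suffix subnn.
  by case: ifP; rewrite ?mul1r ?mul0r.
- by move=> M _; apply/dominantP => c _; rewrite /suffix subn0 !big_geq.
exact: bkP.
Qed.

End BenderKnuth.

(** * Tableaux as 0-1 matrices *)

Definition conjp (p : seq nat) (c : nat) : nat := count (fun x => c < x)%N p.

Lemma conjp_dec p c : (conjp p c.+1 <= conjp p c)%N.
Proof. by apply: sub_count => x /= h; lia. Qed.

Lemma conjpP p r c : sorted geq p -> (r < conjp p c)%N = (c < nth 0%N p r)%N.
Proof.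
elim: p r => [|x p IH] r hp; first by rewrite nth_nil.
have hp' := path_sorted hp; rewrite /conjp /=.
have all_le : all (leq^~ x) p.
  have := order_path_min (leT := geq) _ hp.
  by apply=> a b d /= h1 h2; exact: leq_trans h2 h1.
case: (ltnP c x) => hc.
  by case: r => [|r] //=; rewrite add1n ltnS -IH.
have -> : count (fun y => c < y)%N p = 0%N.
  apply/eqP; rewrite -leqn0 leqNgt -has_count; apply/hasPn => y hy /=.
  by have := allP all_le y hy; lia.
case: r => [|r] //=; first by lia.
case: (ltnP r (size p)) => hr; last by rewrite nth_default.
by have := allP all_le _ (mem_nth 0%N hr); rewrite /=; lia.
Qed.

Lemma conjp_le p c : 0%N \notin p -> (conjp p c <= sumn p)%N.
Proof.
move=> h; apply: (@leq_trans (size p)); first exact: count_size.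
elim: p h => //= x p IH; rewrite inE negb_or => /andP [h1 h2].
by have := IH h2; lia.
Qed.

Lemma nth_le_head p r : sorted geq p -> (nth 0%N p r <= head 0%N p)%N.
Proof.
move=> hp; rewrite -nth0; case: r => // r.
case: (ltnP r.+1 (size p)) => hr; last by rewrite nth_default.
apply: (sorted_ltn_nth (leT := geq)) => //; rewrite ?inE //; last by lia.
by move=> a b d /= h1 h2; exact: leq_trans h2 h1.
Qed.

Section SchurBmat.
Variables (N : nat) (la : seq nat).
Hypothesis las : sorted geq la.
Let l := head 0%N la.
Notation bm := (bmat N l).

Lemma cell_ex r c : (c < nth 0%N la r)%N ->
  exists cl : cell la, crow cl = r :> nat /\ ccol cl = c :> nat.
Proof.
move=> h; have hr : (r < size la)%N by rewrite ltnNge; apply/negP => h'; rewrite nth_default in h.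
have hc : (c < head 0 la)%N by have := nth_le_head r las; lia.
by exists (exist _ (Ordinal hr, Ordinal hc) h).
Qed.

Lemma cellP (cl : cell la) : (ccol cl < nth 0%N la (crow cl))%N.
Proof. exact: (valP cl). Qed.

Lemma cell_inj (c d : cell la) :
  crow c = crow d :> nat -> ccol c = ccol d :> nat -> c = d.
Proof.
move=> h1 h2; apply: val_inj; move: h1 h2; rewrite /crow /ccol.
by case: (val c) (val d) => [a b] [a' b'] /= /val_inj -> /val_inj ->.
Qed.

Lemma ssytP (T : {ffun cell la -> 'I_N}) : reflect
  ((forall c d : cell la, crow c = crow d :> nat -> (ccol c < ccol d)%N -> (T c <= T d)%N) /\
   (forall c d : cell la, ccol c = ccol d :> nat -> (crow c < crow d)%N -> (T c < T d)%N))
  (is_ssyt T).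
Proof.
apply: (iffP forallP) => [h|[h1 h2] c].
  split=> c d e lt; have /forallP /(_ d) /andP [] := h c.
    by move=> /implyP h1 _; apply: h1; rewrite lt andbT; apply/eqP/val_inj.
  by move=> _ /implyP h1; apply: h1; rewrite lt andbT; apply/eqP/val_inj.
apply/forallP => d; apply/andP; split; apply/implyP => /andP [/eqP e lt].
  by apply: h1 => //; rewrite e.
by apply: h2 => //; rewrite e.
Qed.

Lemma sum_col (F : nat -> nat) (c : 'I_l) :
  (\sum_(cl : cell la | ccol cl == c) F (crow cl) = \sum_(r < conjp la c) F r)%N.
Proof.
pose P (x : 'I_(size la) * 'I_l) := (x.2 < nth 0%N la x.1)%N.
transitivity (\sum_(x : 'I_(size la) * 'I_l | P x && (x.2 == c)) F x.1)%N.
  rewrite [RHS](reindex_omap (val : cell la -> _) insub) /=.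
    by apply: eq_bigl => cl; rewrite valK eqxx andbT [P _](valP cl).
  by move=> x /andP [hx _]; rewrite insubT.
transitivity (\sum_(r < size la | (c < nth 0%N la r)%N) F r)%N.
  rewrite [RHS](reindex_onto (fst : 'I_(size la) * 'I_l -> _) (fun r => (r, c))) //=.
  apply: eq_bigl => -[r c'] /=; rewrite /P /= xpair_eqE eqxx /= eq_sym.
  by case: eqP => [->|]; rewrite ?andbF.
rewrite (big_ord_widen (size la) F); last exact: count_size.
by apply: eq_bigl => r; rewrite conjpP.
Qed.

Lemma prefixS (M : bm) t c : prefix M t.+1 c = (prefix M t c + ent M t c)%N.
Proof. by rewrite /prefix big_nat_recr. Qed.

Lemma prefix_le (M : bm) t t' c : (t <= t')%N -> (prefix M t c <= prefix M t' c)%N.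
Proof. by move=> h; rewrite -(subnKC h); elim: (t' - t)%N => [|x IH]; rewrite ?addn0 // addnS prefixS; lia. Qed.

(** Columns of a semistandard tableau are strictly increasing, so they are
    determined by the sets of their entries. *)
Definition bm_of (T : {ffun cell la -> 'I_N}) : bm :=
  [ffun x : 'I_N * 'I_l => [exists cl : cell la, (ccol cl == x.2) && (T cl == x.1)]].

Section OfSsyt.
Variable T : {ffun cell la -> 'I_N}.
Hypothesis HT : is_ssyt T.

Let Tcol (c d : cell la) : ccol c = ccol d -> (T c < T d)%N = (crow c < crow d)%N.
Proof.
have [_ h] := ssytP _ HT; move=> e.
case: (ltngtP (crow c) (crow d)) => hr.
- by apply: h => //; rewrite e.
- by apply/negbTE; rewrite -leqNgt ltnW // h // e.
by rewrite (cell_inj hr) ?ltnn // e.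
Qed.

Let Tinj (c d : cell la) : ccol c = ccol d -> T c = T d -> c = d.
Proof.
move=> e eT; apply: cell_inj; last by rewrite e.
by have := Tcol e; have := Tcol (esym e); rewrite eT ltnn; lia.
Qed.

Lemma ent_bm_of (j : 'I_N) (c : 'I_l) :
  ent (bm_of T) j c = (\sum_(cl : cell la | ccol cl == c) (T cl == j))%N :> nat.
Proof.
rewrite ent_ord ffunE /=; case: existsP => [[cl /andP [/eqP e /eqP e']]|h].
  rewrite (bigD1 cl) ?e //= e' eqxx big1 // => d /andP [/eqP ed nd].
  case: eqP => // eT; by case/eqP: nd; exact: Tinj (etrans ed (esym e)) (etrans eT (esym e')).
rewrite big1 // => cl e; case: eqP => // eT; case: h; exists cl.
by rewrite e; apply/eqP.
Qed.

Lemma prefix_bm_of t (c : 'I_l) : (t <= N)%N ->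
  prefix (bm_of T) t c = (\sum_(cl : cell la | ccol cl == c) (T cl < t))%N.
Proof.
move=> ht; rewrite /prefix big_mkord.
pose f := widen_ord ht.
rewrite (eq_bigr _ (fun i _ => ent_bm_of (f i) c)).
rewrite exchange_big /=; apply: eq_bigr => cl _.
case: (ltnP (T cl) t) => h.
  rewrite (bigD1 (Ordinal h)) //= big1; last first.
    move=> i ni; case: eqP => // e; case/eqP: ni; apply: val_inj => /=.
    by rewrite e.
  by rewrite (_ : _ == _) //; apply/eqP/val_inj.
rewrite big1 // => i _; case: eqP => // e.
by move: h; rewrite e /= leqNgt ltn_ord.
Qed.

(** The cells above c0 in its column are those with smaller entries. *)
Lemma prefix_row (c0 : cell la) : prefix (bm_of T) (T c0) (ccol c0) = crow c0.
Proof.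
rewrite prefix_bm_of; last exact: ltnW.
rewrite (eq_bigr (fun cl => nat_of_bool (crow cl < crow c0)%N)); last first.
  by move=> cl /eqP e; rewrite Tcol.
rewrite (sum_col (fun r => nat_of_bool (r < crow c0)%N)).
have h : (crow c0 <= conjp la (ccol c0))%N by rewrite ltnW // conjpP //; exact: cellP.
by rewrite -big_mkcond /= (big_ord_narrow h) /= sum1_card card_ord.
Qed.

Lemma colsum_bm_of (c : 'I_l) : colsum (bm_of T) c = conjp la c.
Proof.
rewrite -[LHS]/(prefix (bm_of T) N c) prefix_bm_of //.
rewrite (eq_bigr (fun=> 1%N)); last by move=> cl _; rewrite ltn_ord.
by rewrite (sum_col (fun=> 1%N)) sum1_card card_ord.
Qed.

Lemma ent_bm_cell (c0 : cell la) : ent (bm_of T) (T c0) (ccol c0).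
Proof. by rewrite ent_ord ffunE /=; apply/existsP; exists c0; rewrite !eqxx. Qed.

Lemma lt_prefix (c0 : cell la) t :
  (T c0 < t)%N = (crow c0 < prefix (bm_of T) t (ccol c0))%N.
Proof.
rewrite -prefix_row; case: (ltnP (T c0) t) => h.
  by have := prefix_le (bm_of T) (ccol c0) h; rewrite prefixS ent_bm_cell; lia.
by have := prefix_le (bm_of T) (ccol c0) h; lia.
Qed.

Lemma prefix_dom_bm_of : always_dominant N l (@prefix N l) (bm_of T).
Proof.
apply/always_dominantP => t c ht hc.
case e: (prefix (bm_of T) t c.+1) => [|k] //.
have hk : (k < conjp la c.+1)%N.
  rewrite -[c.+1]/(val (Ordinal hc)) -colsum_bm_of.
  have := prefix_le (bm_of T) c.+1 ht; rewrite e /=; apply.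
have [|d [d1 d2]] := @cell_ex k c.+1; first by rewrite -conjpP.
have [|d' [d1' d2']] := @cell_ex k c; first by rewrite -conjpP //; have := conjp_dec la c; lia.
have Td : (T d < t)%N by rewrite lt_prefix d1 d2 e.
have [h _] := ssytP _ HT.
have Td' : (T d' < t)%N by apply: leq_ltn_trans Td; apply: h; rewrite ?d1 ?d2 ?d1' ?d2'.
by move: Td'; rewrite lt_prefix d1' d2'.
Qed.

Lemma mon_bm_of (R : comNzRingType) (X : 'I_N -> R) :
  \prod_(cl : cell la) X (T cl) = mon X (bm_of T).
Proof.
rewrite (partition_big (fun cl => T cl) xpredT) //=; apply: eq_bigr => j _.
rewrite (eq_bigr (fun=> X j)); last by move=> cl /eqP ->.
rewrite prodr_const; congr (_ ^+ _).
rewrite /rowsum big_mkord (eq_bigr _ (fun c _ => ent_bm_of j c)).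
rewrite -sum1_card (partition_big (fun cl => ccol cl) xpredT) //=.
rewrite /l; apply: eq_bigr => c _; rewrite [RHS]big_mkcond [LHS]big_mkcond /=.
by apply: eq_bigr => cl _; rewrite unfold_in /= andbC -[eqn _ _]/(T cl == j); case: eqP; case: eqP.
Qed.

End OfSsyt.

Definition ssytm (M : bm) :=
  always_dominant N l (@prefix N l) M && [forall c : 'I_l, colsum M c == conjp la c].

Lemma bm_of_ssytm T : is_ssyt T -> ssytm (bm_of T).
Proof.
move=> HT; apply/andP; split; first exact: prefix_dom_bm_of.
by apply/forallP => c; rewrite colsum_bm_of.
Qed.

Lemma ent_prefix_inj (M : bm) j j' c : ent M j c -> ent M j' c ->
  prefix M j c = prefix M j' c -> j = j'.
Proof.
move=> e e' h; case: (ltngtP j j') => // lt.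
  by have := prefix_le M c lt; rewrite prefixS e; lia.
by have := prefix_le M c lt; rewrite prefixS e'; lia.
Qed.

Lemma bm_of_inj : {in [pred T | is_ssyt T] &, injective bm_of}.
Proof.
move=> T T' HT HT' e; apply/ffunP => cl; apply: val_inj.
apply: (@ent_prefix_inj (bm_of T) _ _ (ccol cl)).
- exact: ent_bm_cell.
- by rewrite e; exact: ent_bm_cell.
by rewrite prefix_row // e prefix_row.
Qed.

Lemma bm_of_surj M : ssytm M -> exists2 T, is_ssyt T & bm_of T = M.
Proof.
move=> /andP [/always_dominantP dom /forallP col].
have colE (c : 'I_l) : prefix M N c = conjp la c by apply/eqP; exact: col.
have dom2 t (c c' : nat) : (t <= N)%N -> (c <= c')%N -> (c' < l)%N -> (prefix M t c' <= prefix M t c)%N.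
  move=> ht; elim: c' => [|c' IH]; first by rewrite leqn0 => /eqP ->.
  rewrite leq_eqVlt => /orP [/eqP -> //|h1] h2.
  by apply: leq_trans (IH h1 (ltnW h2)); apply: dom.
have hT (cl : cell la) : exists j : 'I_N,
    (prefix M j (ccol cl) <= crow cl)%N && (crow cl < prefix M j.+1 (ccol cl))%N.
  have h : (crow cl < prefix M N (ccol cl))%N by rewrite colE conjpP //; exact: cellP.
  have hex : exists t, (crow cl < prefix M t (ccol cl))%N by exists N.
  case: (ex_minnP hex) => -[|t]; first by rewrite /prefix big_geq.
  move=> ht tmin; have tN : (t < N)%N by apply: tmin.
  by exists (Ordinal tN); rewrite /= ht andbT leqNgt; apply/negP => /tmin; lia.
have [g hg] := fin_all_exists hT.
have pg cl : prefix M (g cl) (ccol cl) = crow cl /\ ent M (g cl) (ccol cl).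
  by have /andP := hg cl; rewrite prefixS; case: (ent _ _ _) => /=; lia.
pose T : {ffun cell la -> 'I_N} := [ffun cl => g cl].
have Tssyt : is_ssyt T.
  apply/ssytP; split=> c d e lt; rewrite !ffunE.
    have [p1 e1] := pg c; have [p2 e2] := pg d.
    rewrite -ltnS ltnNge; apply/negP => h.
    have := prefix_le M (ccol c) h.
    have := @dom2 (g d).+1 _ _ (ltn_ord _) (ltnW lt) (ltn_ord _).
    by rewrite prefixS e2 p1 p2 e; lia.
  have [p1 e1] := pg c; have [p2 e2] := pg d.
  rewrite ltnNge; apply/negP => h; have := prefix_le M (ccol c) h.
  by rewrite p1 e p2; lia.
exists T => //; apply: ent_ext => j c hj hc.
have -> : ent (bm_of T) j c = [exists cl : cell la, (ccol cl == c :> nat) && (T cl == j :> nat)].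
  rewrite -[j]/(val (Ordinal hj)) -[c]/(val (Ordinal hc)) ent_ord ffunE /=.
  by apply: eq_existsb => cl; rewrite -!(inj_eq val_inj).
apply/existsP/idP => [[cl /andP [/eqP <- /eqP <-]]|h].
  by rewrite ffunE; have [] := pg cl.
have hr : (prefix M j c < conjp la c)%N.
  rewrite -[c]/(val (Ordinal hc)) -colE; have := prefix_le M c hj; rewrite prefixS h /=; lia.
have [|cl [e1 e2]] := @cell_ex (prefix M j c) c; first by rewrite -conjpP.
exists cl; rewrite e2 eqxx /= ffunE; apply/eqP.
have [p1 p2] := pg cl; apply: (@ent_prefix_inj M _ _ c) => //; first by rewrite -e2.
by rewrite -e2 p1 e1 e2.
Qed.

Lemma sum_ssyt (R : comNzRingType) (X : 'I_N -> R) :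
  \sum_(T : {ffun cell la -> 'I_N} | is_ssyt T) \prod_(cl : cell la) X (T cl) =
  \sum_(M | ssytm M) mon X M.
Proof.
rewrite (eq_bigr (fun T => mon X (bm_of T))); last by move=> T HT; rewrite mon_bm_of.
rewrite -(big_imset (mon X) (h := bm_of) (A := [pred T | is_ssyt T])) /=; last exact: bm_of_inj.
apply: eq_bigl => M; apply/imsetP/idP => [[T HT ->]|/bm_of_surj [T HT <-]].
  exact: bm_of_ssytm.
by exists T.
Qed.

End SchurBmat.

(** * Littlewood-Richardson coefficients count 0-1 matrices *)

Section Schur.
Variable N : nat.
Notation R := {mpoly int[N]}.
Let X (i : 'I_N) : R := 'X_i.

Lemma mpoly_int2 (v : R) : v = - v -> v = 0.
Proof.
move=> e; apply/mpolyP => m; rewrite mcoeff0.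
by have := congr1 (mcoeff m) e; rewrite mcoeffN; lia.
Qed.

Lemma schurE la : sorted geq la ->
  schur N la = \sum_(M : bmat N (head 0%N la) | ssytm M) mon X M.
Proof. by move=> h; rewrite -sum_ssyt. Qed.

Lemma nth_dec (la : seq nat) j : sorted geq la -> (nth 0%N la j.+1 <= nth 0%N la j)%N.
Proof.
move=> h; have := nth_le_head j.+1 h.
case: (ltnP j.+1 (size la)) => hj; last by rewrite nth_default.
move=> _; apply: (sorted_ltn_nth (leT := geq)) => //; rewrite ?inE //; last by lia.
by move=> a b d /= h1 h2; exact: leq_trans h2 h1.
Qed.

(** Expand the Schur polynomial over all matrices with the signs [alt],
    multiply by the alternant, and cancel twice, first by the rows and then
    by the columns. *)
Lemma Alt_mul_schur (mu : nat -> nat) (nu : seq nat) :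
  (forall j, (mu j.+1 <= mu j)%N) -> sorted geq nu ->
  Alt X mu * schur N nu =
  \sum_(M : bmat N (head 0%N nu) | LRmat mu (conjp nu) M)
     Alt X (fun j => (mu j + rowsum M j)%N).
Proof.
move=> hmu hnu; rewrite schurE //.
rewrite -(sum_prefix_dominant mpoly_int2 _ X (conjp_dec nu)).
rewrite Alt_mul_sum; last by move=> s M; apply: eq_gdet => j _; rewrite colsum_perm.
apply: sum_LRmat => //; [exact: mpoly_int2|exact: conjp_dec].
Qed.

(** The matrix of the tableau of shape p whose row j is filled with j. *)
Definition stdm p : bmat N (head 0%N p) := mkb (fun j c => j < conjp p c)%N.

Lemma rowsum_stdm p j : sorted geq p -> (j < N)%N -> rowsum (stdm p) j = nth 0%N p j.
Proof.
move=> hp hj; have hle := nth_le_head j hp.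
rewrite /rowsum big_mkord (eq_bigr (fun c => nat_of_bool (val c < nth 0 p j)%N)).
  by rewrite -big_mkcond /= (big_ord_narrow hle) sum1_card card_ord.
by move=> c _; rewrite ent_mk hj ltn_ord /= conjpP.
Qed.

Lemma sum_ltn n k : (k <= n)%N -> (\sum_(0 <= j < n) (j < k) = k)%N.
Proof.
move=> h; rewrite big_mkord -big_mkcond /= (big_ord_narrow h).
by rewrite sum1_card card_ord.
Qed.

(** For mu = 0 the first column of M is a vertical strip over the empty
    diagram, hence an initial segment of the rows. By induction every column
    is one: the suffix condition excludes boxes below the end of the
    previous column, and above it the previous columns are full, so that the
    chain condition makes the column decreasing. *)
Lemma LRmat0 p : sorted geq p -> 0%N \notin p -> (sumn p <= N)%N ->
  forall M, LRmat (fun=> 0%N) (conjp p) M = (M == stdm p).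
Proof.
move=> hp h0 hs M; have cN c : (conjp p c <= N)%N by apply: leq_trans (conjp_le _ h0) hs.
apply/idP/eqP => [|->].
  move=> /and3P [/always_dominantP cs /always_dominantP sf /forallP col].
  apply: ent_ext => j c hj hc; rewrite ent_mk hj hc /=.
  elim/ltn_ind: c hc j hj => c IH hc j hj.
  (* column c is a decreasing 0/1 vector inside the rows where c-1 is full *)
  have ps j' c' : (c' <= c)%N -> (j' < N)%N -> psum (fun=> 0%N) M c' j' = (\sum_(0 <= i < c') (j' < conjp p i))%N.
    move=> hcc hj'; rewrite /psum add0n !big_nat; apply: eq_bigr => i hi.
    by rewrite IH //; lia.
  have zero j' : (0 < c)%N -> (j' < N)%N -> (conjp p c.-1 <= j')%N -> ent M j' c = false.
    case: c IH hc ps => // c IH hc ps _ hj' hle.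
    have := sf (N - conjp p c)%N c (leq_subr _ _) hc; rewrite /suffix subKn //.
    have -> : (\sum_(conjp p c <= i < N) ent M i c = 0)%N.
      by rewrite big_nat big1 // => i hi; rewrite IH //; lia.
    rewrite leqn0 sum_nat_seq_eq0 => /allP /(_ j').
    by rewrite mem_index_iota hle hj' /= => /(_ isT); case: (ent _ _ _).
  have dec j' : (j'.+1 < N)%N -> ent M j'.+1 c -> ent M j' c.
    move=> hj' e; case: c IH hc ps zero e => [|c] IH hc ps zero e.
      have := cs 1%N j' hc hj'; rewrite !psumS e /psum !big_geq //.
      by case: (ent M j' 0).
    have := cs c.+2 j' hc hj'; rewrite [psum _ M c.+2 j'.+1]psumS.
    rewrite [psum _ M c.+2 j']psumS e !ps //; last lia.
    have lt : (j'.+1 < conjp p c)%N.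
      by rewrite ltnNge; apply/negP => h; move: e; rewrite zero.
    have full j1 : (j1 <= j'.+1)%N -> (\sum_(0 <= i < c.+1) (j1 < conjp p i) = c.+1)%N.
      move=> hj1; rewrite (eq_big_nat _ _ (F2 := fun=> 1%N)) ?sum_nat_const_nat ?subn0 ?muln1 // => i hi.
      suff : (conjp p c <= conjp p i)%N by move=> h; rewrite (_ : (_ < _)%N); lia.
      by rewrite /conjp; apply: sub_count => x /=; lia.
    rewrite !full //.
    by case: (ent M j' c.+1) => //; lia.
  have dec2 i j' : (i <= j')%N -> (j' < N)%N -> ent M j' c -> ent M i c.
    elim: j' => [|j' IHj]; first by rewrite leqn0 => /eqP ->.
    rewrite leq_eqVlt => /orP [/eqP -> //|h1] h2 e; apply: IHj => //; first lia.
    exact: dec.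
  have /eqP := col (Ordinal hc); rewrite /colsum /= => hcol.
  case: (boolP (ent M j c)) => e.
    apply/esym/negbNE; rewrite -leqNgt; apply/negP => hle.
    have : (j.+1 <= conjp p c)%N; last by lia.
    rewrite -hcol (@big_cat_nat _ _ _ j.+1) //= (eq_big_nat _ _ (F2 := fun=> 1%N)).
      by rewrite sum_nat_const_nat subn0 muln1 leq_addr.
    by move=> i hi; rewrite (dec2 i j) //; lia.
  apply/esym/negbTE; rewrite -leqNgt -hcol (@big_cat_nat _ _ _ j) //=; last lia.
  rewrite [X in (_ + X)%N]big_nat [X in (_ + X)%N]big1 ?addn0; last first.
    move=> i hi; case: (boolP (ent M i c)) => // ei.
    by move: e; rewrite (dec2 j i) //; lia.
  rewrite -[X in (_ <= X)%N]subn0 -[X in (_ <= X)%N]muln1 -sum_nat_const_nat.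
  by apply: leq_sum => i _; exact: leq_b1.
apply/and3P; split.
- apply/always_dominantP => c j hc hj; rewrite /psum !add0n !big_nat.
  apply: leq_sum => i hi; rewrite !ent_mk hj (ltnW hj); case: (i < _)%N => //=; lia.
- apply/always_dominantP => t c ht hc; rewrite /suffix !big_nat.
  apply: leq_sum => i hi; rewrite !ent_mk hc (ltnW hc).
  by case: (i < N)%N => //=; have := conjp_dec p c; lia.
apply/forallP => c; apply/eqP.
rewrite /colsum -[RHS](@sum_ltn N) //= !big_nat; apply: eq_bigr => j hj.
by rewrite ent_mk ltn_ord; have -> : (j < N)%N by lia.
Qed.

(** The bialternant formula. *)
Lemma Alt0_mul_schur p : sorted geq p -> 0%N \notin p -> (sumn p <= N)%N ->
  Alt X (fun=> 0%N) * schur N p = Alt X (nth 0%N p).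
Proof.
move=> hp h0 hs; rewrite Alt_mul_schur // (big_pred1 (stdm p)); last exact: LRmat0.
by apply: eq_gdet => j hj; rewrite add0n rowsum_stdm.
Qed.

(** Alternants of distinct partitions have no common monomial, so the
    coefficient of the leading monomial of one of them detects it. *)
Lemma mcoeff_Alt (B : nat -> nat) (p : seq nat) : sorted geq p ->
  (forall j, (j.+1 < N)%N -> (B j.+1 <= B j)%N) ->
  (Alt X B)@_[multinom (nth 0%N p i + (N - i))%N | i < N] =
  [forall i : 'I_N, B i == nth 0%N p i]%:R.
Proof.
move=> hp hB.
have key (a b : 'I_N -> nat) :
    (\prod_(i < N) X i ^+ b i)@_[multinom a i | i < N] = \prod_(i < N) (b i == a i)%:R.
  rewrite (_ : \prod_(i < N) _ = 'X_[[multinom b i | i < N]]); last first.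
    by rewrite [RHS]mpolyXE_id; apply: eq_bigr => i _; rewrite mnmE.
  rewrite mcoeffX; case: (boolP [forall i, b i == a i]) => [/forallP h|].
    rewrite big1 => [|i _]; last by rewrite h.
    by case: eqP => // -[]; apply/mnmP => i; rewrite !mnmE; apply/eqP.
  rewrite negb_forall => /existsP [i hi]; rewrite (bigD1 i) //= (negbTE hi) mul0r.
  by case: eqP => // /mnmP /(_ i); rewrite !mnmE => e; rewrite e eqxx in hi.
transitivity (gdet (fun i : 'I_N => fun b => (b == nth 0%N p i + (N - i))%N%:R : int)
   (fun j => (B j + (N - j))%N)).
  rewrite /Alt /gdet /determinant raddf_sum /=; apply: eq_bigr => s _.
  rewrite !mulr_sign (fun_if (mcoeff _)) mcoeffN.
  by under eq_bigr do rewrite mxE; under [in RHS]eq_bigr do rewrite mxE; rewrite key.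
rewrite (@gdet_indic _ N (fun j => B j + (N - j))%N (fun i => nth 0 p i + (N - i))%N).
- by congr (nat_of_bool _)%:R; apply: eq_forallb => i; rewrite eqn_add2r.
- exact: staircase_decr.
by apply: (staircase_decr (x := nth 0%N p)) => c _; exact: nth_dec.
Qed.

End Schur.

(** Multiply the expansion of s_mu s_nu by the alternant of 0 and compare
    the coefficients of the leading monomial of the alternant of la: on the
    one side only the summand of la contributes, on the other side each
    matrix contributes 0 or 1. *)
Theorem LR_coefE (la mu nu : seq nat) (c : int) :
  let N := (sumn mu + sumn nu)%N in
  sorted geq mu -> 0%N \notin mu -> sorted geq nu -> is_partn N la ->
  is_LR_coef la mu nu c ->
  c = #|[set M : bmat N (head 0%N nu) | LRmat (nth 0%N mu) (conjp nu) M &&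
        [forall j : 'I_N, (nth 0 mu j + rowsum M j == nth 0 la j)%N]]|%:Z.
Proof.
move=> N hmu hmu0 hnu hla [ps [f [ups hps hprod _ hc]]]; rewrite -/N in hps hprod.
pose X (i : 'I_N) : {mpoly int[N]} := 'X_i.
have [las la0 /eqP lasum] : [/\ sorted geq la, 0%N \notin la & sumn la == N].
  by apply/and3P.
have := congr1 ( *%R (Alt X (fun=> 0%N))) hprod.
have hmuN : Alt X (fun=> 0%N) * schur N mu = Alt X (nth 0%N mu).
  by apply: Alt0_mul_schur => //; rewrite leq_addr.
rewrite mulrA hmuN Alt_mul_schur //; last by move=> j; exact: nth_dec.
rewrite mulr_sumr.
rewrite (eq_big_seq (fun p => f p *: Alt X (nth 0%N p))); last first.
  move=> p; rewrite hps => /and3P [h1 h2 /eqP h3].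
  by rewrite -scalerAr Alt0_mul_schur // h3.
move=> /(congr1 (mcoeff [multinom (nth 0%N la i + (N - i))%N | i < N])).
rewrite !raddf_sum /= => e.
have sz p : 0%N \notin p -> (size p <= sumn p)%N.
  elim: p => //= x p IH; rewrite inE negb_or => /andP [h1 h2].
  by have := IH h2; lia.
rewrite -hc.
transitivity (\sum_(p <- ps) f p * (p == la)%:R : int).
  rewrite (bigD1_seq la) //=; last by rewrite hps.
  rewrite eqxx mulr1 big1 ?addr0 // => p /negbTE ->.
  by rewrite mulr0.
transitivity (\sum_(p <- ps) (f p *: Alt X (nth 0%N p))@_[multinom (nth 0%N la i + (N - i))%N | i < N]).
  apply: eq_big_seq => p; rewrite hps => /and3P [h1 h2 /eqP h3].
  rewrite mcoeffZ mcoeff_Alt //; last by move=> j _; exact: nth_dec.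
  congr (_ * (nat_of_bool _)%:R); apply/eqP/forallP => [-> //|h].
  have pn q : 0%N \notin q -> forall j, (0 < nth 0 q j)%N = (j < size q)%N.
    move=> hq j; case: (ltnP j (size q)) => hj; last by rewrite nth_default.
    by rewrite lt0n; apply: contra hq => /eqP <-; exact: mem_nth.
  have eqn j : nth 0%N p j = nth 0%N la j.
    case: (ltnP j N) => hj; first by exact/eqP/(h (Ordinal hj)).
    rewrite !nth_default //; [apply: leq_trans (sz _ la0) _|apply: leq_trans (sz _ h2) _]; lia.
  apply: (@eq_from_nth _ 0%N) => //.
  case: (ltngtP (size p) (size la)) => // hlt.
    by have := pn _ la0 (size p); rewrite -eqn nth_default // hlt.
  by have := pn _ h2 (size la); rewrite eqn nth_default // hlt.
rewrite -e (eq_bigr (fun M =>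
  [forall j : 'I_N, (nth 0 mu j + rowsum M j == nth 0 la j)%N]%:R)); last first.
  move=> M /and3P [/always_dominantP h _ _].
  by apply: mcoeff_Alt => // j hj; exact: h.
rewrite -sum1_card -natz raddf_sum /= big_mkcond [RHS]big_mkcond /=.
by apply: eq_bigr => M _; rewrite inE; case: (LRmat _ _ _) => //=; case: [forall _, _].
Qed.

(** * Functions on words and their leading terms *)

Section Raising.
Variables (K : fieldType) (m k : nat).
Notation word := {ffun 'I_m -> 'I_k}.
Implicit Types (R : {set 'I_m}) (a b : 'I_k) (u v : word -> K) (g : word).

(** The matrix unit that moves the letter a to b, acting at the positions in
    R only; removing positions from R one at a time is what makes the
    leading term argument work. *)
Definition raise R a b u : word -> K :=
  fun g => \sum_(x in R | g x == a) u (upd g x b).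

Lemma updE g x b y : upd g x b y = if y == x then b else g y.
Proof. by rewrite ffunE. Qed.

Lemma upd_same g x : upd g x (g x) = g.
Proof. by apply/ffunP => y; rewrite updE; case: eqP => [->|]. Qed.

Lemma upd_upd g x b b' : upd (upd g x b) x b' = upd g x b'.
Proof. by apply/ffunP => y; rewrite !updE; case: eqP. Qed.

Lemma upd_comm g x y b b' : x != y -> upd (upd g x b) y b' = upd (upd g y b') x b.
Proof.
move=> nxy; apply/ffunP => z; rewrite !updE.
by case: (z =P y) => [zy|_] //; case: (z =P x) => // zx; rewrite -zx -zy eqxx in nxy.
Qed.

Lemma raise_setU1 R a b u g x : x \notin R ->
  raise (x |: R) a b u g =
  (if g x == a then u (upd g x b) else 0) + raise R a b u g.
Proof.
move=> nx; by rewrite /raise !big_mkcondr /= big_setU1.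
Qed.

Lemma eq_raise R a b u v : u =1 v -> raise R a b u =1 raise R a b v.
Proof. by move=> h g; apply: eq_bigr => x _; rewrite h. Qed.

Lemma iter_raise_off R a b u x s g : a != b -> x \notin R -> g x != a ->
  iter s (raise (x |: R) a b) u g = iter s (raise R a b) u g.
Proof.
move=> nab nx; elim: s g => // s IH g gx /=.
rewrite raise_setU1 // (negbTE gx) add0r; apply: eq_bigr => y /andP [yR _].
by rewrite IH // updE ifN //; apply: contra nx => /eqP ->.
Qed.

(** The operator is the sum of those of the single position x and of R,
    which commute, and the square of the first one is zero. *)
Lemma iter_raise_on R a b u x s g : a != b -> x \notin R -> g x = a ->
  iter s (raise (x |: R) a b) u g =
  iter s (raise R a b) u g + s%:R * iter s.-1 (raise R a b) u (upd g x b).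
Proof.
move=> nab nx; elim: s g => [|s IH] g gx /=; first by rewrite mul0r addr0.
rewrite raise_setU1 // gx eqxx iter_raise_off //; last by rewrite updE eqxx eq_sym.
transitivity (iter s (raise R a b) u (upd g x b) +
   (raise R a b (iter s (raise R a b) u) g +
    s%:R * raise R a b (iter s.-1 (raise R a b) u) (upd g x b))).
  congr (_ + _); rewrite /raise mulr_sumr.
  rewrite [X in _ = _ + X](eq_bigl (fun y => (y \in R) && (g y == a))); last first.
    move=> y; case yR: (y \in R) => //=; rewrite updE ifN //.
    by apply: contraNneq nx => <-.
  rewrite -big_split /=; apply: eq_bigr => y /andP [yR _].
  have nyx : y != x by apply: contraNneq nx => <-.
  by rewrite IH ?updE 1?eq_sym ?(negbTE nyx) // upd_comm.
case: s {IH} => [|s] /=; first by rewrite mul0r addr0 mul1r addrC.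
by rewrite addrCA -[in RHS]natr1 mulrDl mul1r [X in _ + X]addrC.
Qed.

End Raising.

Lemma card_colS (X : finType) (col : X -> nat) (P : pred X) c :
  (#|[set x | (col x < c.+1)%N && P x]| =
   #|[set x | (col x < c)%N && P x]| + #|[set x | (col x == c) && P x]|)%N.
Proof.
rewrite -cardsUI [X in (_ = _ + X)%N](_ : _ = 0%N) ?addn0.
  by apply: eq_card => x; rewrite !inE ltnS leq_eqVlt orbC andb_orl.
apply/eqP; rewrite cards_eq0; apply/eqP/setP => x; rewrite !inE.
by case: ltngtP => //=; rewrite ?andbF.
Qed.

Section Leading.
Variables (K : fieldType).
Hypothesis charK : [pchar K] =i pred0.
Variables (m k : nat) (col : 'I_m -> nat) (lo al : nat -> nat).
Notation word := {ffun 'I_m -> 'I_k}.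

Lemma natr0 n (x : K) : (0 < n)%N -> n%:R * x = 0 -> x = 0.
Proof.
move=> hn /eqP; rewrite mulf_eq0 => /orP [|/eqP //].
by have /pcharf0P -> := charK; move/eqP => h; rewrite h in hn.
Qed.

Definition permw (g : word) (s : 'S_m) : word := [ffun x => g (s x)].
Definition wcount (g : word) (c : nat) (a : 'I_k) : nat :=
  #|[set x | (col x == c) && (g x == a)]|.

(** [col] gives the column of each position in a tableau, [al] is the
    content, and [lo a] is the difference of two consecutive parts of the
    highest weight mu'. *)
Record lrfun (u : word -> K) : Prop := LRfun {
  lrfun_content : forall g (a : 'I_k), u g != 0 -> #|[set x | g x == a]| = al a;
  lrfun_raise : forall a b : 'I_k, b = a.+1 :> nat ->
    forall g, iter (lo a).+1 (raise setT a b) u g = 0;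
  lrfun_sym : forall (s : 'S_m) g, (forall x, col (s x) = col x) ->
    u (permw g s) = u g;
  lrfun_garnir : forall c (Y : {set 'I_m}) g,
    (forall x, x \in Y -> col x = c \/ col x = c.+1) ->
    (#|[set x | col x == c]| < #|Y|)%N ->
    \sum_(s : 'S_m | perm_on Y s) u (permw g s) = 0 }.

Variable u : word -> K.
Hypothesis uP : lrfun u.

Lemma eq_wcount_perm g g' : (forall c a, wcount g c a = wcount g' c a) ->
  exists2 s : 'S_m, (forall x, col (s x) = col x) & g' = permw g s.
Proof.
move=> h; pose F (g : word) x := (col x, g x).
pose t := [tuple F g x | x < m]; pose t' := [tuple F g' x | x < m].
have pe : perm_eq t' t.
  apply/allP => -[c a] _ /=; apply/eqP; rewrite !count_map.
  have cnt (g0 : word) : count (preim (F g0) (pred1 (c, a))) (enum 'I_m) = wcount g0 c a.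
    rewrite /wcount -sum1dep_card -sum1_count big_enum_cond /=.
    by apply: eq_bigl => x; rewrite /F xpair_eqE.
  by rewrite -!enumT; exact: etrans (cnt g') (etrans (esym (h c a)) (esym (cnt g))).
have /tuple_permP [s hs] := pe.
have e x : F g' x = F g (s x).
  have := congr1 (fun w => tnth w x) (val_inj hs : t' = _).
  by rewrite !tnth_mktuple.
exists s; first by move=> x; case: (e x).
by apply/ffunP => x; rewrite ffunE; case: (e x).
Qed.

Lemma lrfun_wcount g g' : (forall c a, wcount g c a = wcount g' c a) -> u g' = u g.
Proof. by move=> /eq_wcount_perm [s hs ->]; apply: lrfun_sym. Qed.

(** Columns further left weigh more. The base m + 1 exceeds the number of
    positions, so that increasing the letters in later columns by at most 1
    cannot outweigh a drop in an earlier column. *)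
Definition wkey (g : word) : nat :=
  \sum_x (m.+1 ^ (\max_y col y - col x) * g x)%N.

Lemma sum_two_cols (F : 'I_k -> nat) c (Y : {set 'I_m}) (s : 'S_m) (g : word) :
  (forall x, x \in Y -> col x = c \/ col x = c.+1) -> perm_on Y s ->
  (\sum_(x | col x == c) F (permw g s x) + \sum_(x | col x == c.+1) F (permw g s x) =
   \sum_(x | col x == c) F (g x) + \sum_(x | col x == c.+1) F (g x))%N.
Proof.
move=> hY ps; have split2 (h : word) : (\sum_(x | (col x == c) || (col x == c.+1)) F (h x) =
    \sum_(x | col x == c) F (h x) + \sum_(x | col x == c.+1) F (h x))%N.
  by rewrite (bigID (fun x => col x == c)) /=; congr (_ + _)%N; apply: eq_bigl => x; lia.
rewrite -!split2 [RHS](reindex_inj (@perm_inj _ s)) /=.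
apply: eq_big => [x|x _]; last by rewrite ffunE.
case: (boolP (x \in Y)) => hx; last by rewrite (out_perm ps).
have hsx : s x \in Y by rewrite (perm_closed _ ps).
by case: (hY _ hx) => ->; case: (hY _ hsx) => ->; rewrite !eqxx ?orbT.
Qed.

(** What the column c loses is gained by the column c+1, where it weighs
    less. *)
Lemma wkey_perm_split (c : nat) (Y : {set 'I_m}) (s : 'S_m) (g : word) :
  (forall x, x \in Y -> col x = c \/ col x = c.+1) -> perm_on Y s ->
  (exists x, x \in Y /\ col x = c.+1) ->
  (\sum_(x | col x == c) permw g s x < \sum_(x | col x == c) g x)%N ->
  (wkey (permw g s) < wkey g)%N.
Proof.
move=> hY ps [y0 [y0Y cy0]] lt; rewrite /wkey.
set L := \max_y col y; have colL x : (col x <= L)%N by exact: leq_bigmax.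
have fixs x : col x != c -> col x != c.+1 -> s x = x.
  move=> n1 n2; apply: (out_perm ps); apply: contra n1 => /hY [-> //|e].
  by rewrite e eqxx in n2.
have split3 (h : word) : (\sum_x m.+1 ^ (L - col x) * h x =
    m.+1 ^ (L - c) * (\sum_(x | col x == c) h x) + (m.+1 ^ (L - c.+1) * (\sum_(x | col x == c.+1) h x)
    + \sum_(x | (col x != c) && (col x != c.+1)) m.+1 ^ (L - col x) * h x))%N.
  rewrite (bigID (fun x => col x == c)) /=; congr (_ + _)%N.
    by rewrite big_distrr /=; apply: eq_bigr => x /eqP ->.
  rewrite (bigID (fun x => col x == c.+1)) /=; congr (_ + _)%N.
  rewrite big_distrr /=; apply: eq_big => [x|x /andP [_ /eqP ->] //].
  lia.
rewrite !split3.
have -> : (\sum_(x | (col x != c) && (col x != c.+1)) m.+1 ^ (L - col x) * permw g s x =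
  \sum_(x | (col x != c) && (col x != c.+1)) m.+1 ^ (L - col x) * g x)%N.
  by apply: eq_bigr => x /andP [n1 n2]; rewrite ffunE fixs.
have tot := sum_two_cols (fun a => a) g hY ps.
have powlt : (m.+1 ^ (L - c.+1) < m.+1 ^ (L - c))%N.
  rewrite ltn_exp2l; last by have := ltn_ord y0; lia.
  by have := colL y0; lia.
move: tot lt powlt; set P := (m.+1 ^ (L - c))%N; set Q := (m.+1 ^ (L - c.+1))%N.
set A := (\sum_(x | col x == c) permw g s x)%N; set B := (\sum_(x | col x == c.+1) permw g s x)%N.
set A' := (\sum_(x | col x == c) g x)%N; set B' := (\sum_(x | col x == c.+1) g x)%N.
move=> tot lt powlt; rewrite addnA addnA ltn_add2r.
have -> : B = (B' + (A' - A))%N by lia.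
by rewrite mulnDr -{2}(subnKC (ltnW lt)) mulnDr; nia.
Qed.

Variable g0 : word.
Hypothesis g0u : u g0 != 0.
Hypothesis g0min : forall g, (wkey g < wkey g0)%N -> u g = 0.

Section Letters.
Variables a b : 'I_k.
Hypothesis ab : b = a.+1 :> nat.

Let nab : a != b.
Proof. by apply/eqP => e; move: ab; rewrite e; lia. Qed.

(** The words obtained from g0 by turning some letters a into b and some
    letters b into a; the raising equation only relates such words. *)
Definition near (g : word) := [forall x, (g x == g0 x) ||
  (((g x == a) || (g x == b)) && ((g0 x == a) || (g0 x == b)))].

Lemma near0 : near g0. Proof. by apply/forallP => x; rewrite eqxx. Qed.

Lemma near_upd g x c d : near g -> g x = c -> (c == a) || (c == b) ->
  (d == a) || (d == b) -> near (upd g x d).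
Proof.
move=> /forallP h gx hc hd; apply/forallP => y; rewrite updE.
case: (y =P x) => [->|_]; last exact: h.
rewrite hd /=; have := h x; rewrite gx; case: (c =P g0 x) => [<- _|_] /=; first by rewrite hc orbT.
by rewrite hc /= => ->; rewrite orbT.
Qed.

(** Positions outside R are frozen at their letters in g0. The exponent s
    measures how far v restricted to R is from being a highest weight
    vector. *)
Definition killed (v : word -> K) (R : {set 'I_m}) s := forall g, near g ->
  (forall x, x \notin R -> g x = g0 x) -> iter s (raise R a b) v g = 0.

Lemma killed_other v (R : {set 'I_m}) x s : x \notin R -> g0 x != a -> g0 x != b ->
  killed v (x |: R) s -> killed v R s.
Proof.
move=> nx na nb h g ng hg; rewrite -(iter_raise_off _ _ nab nx) ?hg //.
by apply: h => // y; rewrite !inE negb_or => /andP [_]; exact: hg.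
Qed.

(** Freezing a position with the letter a: the operator of R is the
    difference of those of x |: R and of x, which commute, and the latter
    has square zero. So its power s + 1 is divisible by the s-th power of
    the operator of x |: R. *)
Lemma killed_lower v (R : {set 'I_m}) x s : x \notin R -> g0 x = a ->
  killed v (x |: R) s -> killed v R s.+1.
Proof.
move=> nx ga h g ng hg; have gx : g x = a by rewrite hg.
have sub g' : near g' -> (forall y, y \notin x |: R -> g' y = g y) ->
    iter s (raise (x |: R) a b) v g' = 0.
  move=> ng' hg'; apply: h => // y hy; rewrite hg' //; apply: hg.
  by move: hy; rewrite !inE negb_or => /andP [].
have h1 : iter s.+1 (raise (x |: R) a b) v g = 0.
  rewrite /= /raise big1 // => y /andP [hy /eqP gy]; apply: sub.
    by apply: (near_upd ng gy); rewrite eqxx ?orbT.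
  by move=> z hz; rewrite updE ifN //; apply: contraNneq hz => ->.
move: h1; rewrite iter_raise_on //= => h1.
have h2 : iter s (raise R a b) v (upd g x b) = 0.
  rewrite -(iter_raise_off _ _ nab nx) ?updE ?eqxx 1?eq_sym //; apply: sub.
    by apply: (near_upd ng gx); rewrite eqxx ?orbT.
  by move=> z; rewrite !inE negb_or updE => /andP [/negbTE ->].
by rewrite h2 mulr0 addr0 in h1.
Qed.

(** Freezing a position with the letter b, when v vanishes as soon as this b
    is replaced by a: applied at the word with a in x, only the term in
    which x is raised survives, with a nonzero coefficient, and it uses up
    one power. *)
Lemma killed_upper v (R : {set 'I_m}) x s : x \notin R -> g0 x = b ->
  (forall g, near g -> (forall y, y \notin x |: R -> g y = g0 y) -> g x = a -> v g = 0) ->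
  killed v (x |: R) s.+1 -> killed v R s.
Proof.
move=> nx gb van h g ng hg; have gx : g x = b by rewrite hg.
have ng1 : near (upd g x a) by apply: (near_upd ng gx); rewrite eqxx ?orbT.
have off1 y : y \notin x |: R -> upd g x a y = g0 y.
  by rewrite !inE negb_or updE => /andP [/negbTE -> /hg].
have van' t g1 : near g1 -> (forall y, y \notin x |: R -> g1 y = g0 y) -> g1 x = a ->
    iter t (raise R a b) v g1 = 0.
  elim: t g1 => [|t IH] g1 n1 o1 e1; first exact: van.
  rewrite /= /raise big1 // => y /andP [yR /eqP gy].
  have nyx : y != x by apply: contraNneq nx => <-.
  apply: IH; last by rewrite updE eq_sym (negbTE nyx).
    by apply: (near_upd n1 gy); rewrite eqxx ?orbT.
  by move=> z hz; rewrite updE ifN ?o1 //; apply: contraNneq hz => ->; rewrite !inE yR orbT.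
have gx1 : upd g x a x = a by rewrite updE eqxx.
have := h _ ng1 off1; rewrite iter_raise_on // van' // add0r upd_upd.
by rewrite -gx upd_same /= => /(natr0 (ltn0Sn s)).
Qed.

Lemma killed_lowers v (R : {set 'I_m}) s (xs : seq 'I_m) : uniq xs ->
  (forall x, x \in xs -> x \notin R) -> (forall x, x \in xs -> g0 x != b) ->
  killed v ([set x in xs] :|: R) s ->
  killed v R (s + count (fun x => g0 x == a) xs).
Proof.
elim: xs R s => [|x xs IH] R s /=.
  by move=> _ _ _; rewrite addn0 (_ : [set x in [::]] = set0) ?set0U //; apply/setP => y; rewrite !inE.
move=> /andP [nx ux] nR nb h.
have hx : x \notin [set y in xs] :|: R by rewrite !inE negb_or nx nR ?inE ?eqxx.
have e : [set y in x :: xs] :|: R = x |: ([set y in xs] :|: R).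
  by apply/setP => y; rewrite !inE orbA.
rewrite e in h; rewrite addnCA addnA.
apply: IH => //; [by move=> y hy; apply: nR; rewrite inE hy orbT
  |by move=> y hy; apply: nb; rewrite inE hy orbT|].
case: (altP (g0 x =P a)) => ga; first by rewrite add1n; exact: killed_lower h.
by rewrite add0n; apply: (killed_other hx ga) => //; apply: nb; rewrite inE eqxx.
Qed.

Lemma killed_uppers v (R : {set 'I_m}) s (xs : seq 'I_m) : uniq xs ->
  (forall x, x \in xs -> x \notin R) -> (forall x, x \in xs -> g0 x = b) ->
  (forall g, near g -> (forall y, y \notin [set x in xs] :|: R -> g y = g0 y) ->
     has (fun x => g x == a) xs -> v g = 0) ->
  killed v ([set x in xs] :|: R) (s + size xs) -> killed v R s.
Proof.
elim: xs R s => [|x xs IH] R s /=.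
  by move=> _ _ _ _; rewrite addn0 (_ : [set x in [::]] = set0) ?set0U //; apply/setP => y; rewrite !inE.
move=> /andP [nx ux] nR nb van h.
have hx : x \notin [set y in xs] :|: R by rewrite !inE negb_or nx nR ?inE ?eqxx.
have e : [set y in x :: xs] :|: R = x |: ([set y in xs] :|: R).
  by apply/setP => y; rewrite !inE orbA.
rewrite e in h van.
apply: IH => //.
- by move=> y hy; apply: nR; rewrite inE hy orbT.
- by move=> y hy; apply: nb; rewrite inE hy orbT.
- move=> g ng off hg; apply: van => //; last by rewrite hg orbT.
  by move=> y; rewrite inE negb_or => /andP [_]; exact: off.
apply: (killed_upper hx); last by rewrite addnS in h.
  by apply: nb; rewrite inE eqxx.
by move=> g ng off gx; apply: van; rewrite ?gx ?eqxx.
Qed.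

Definition blockb (g : word) c : nat := #|[set x | (col x == c) && (g x == b)]|.
Definition tail c : {set 'I_m} := [set x | (c <= col x)%N].

(** Such a word is smaller than g0: the sum of the letters of column c drops,
    and in the later columns each letter increases by at most 1. *)
Lemma wkey_block c g : near g -> (forall x, x \notin tail c -> g x = g0 x) ->
  (blockb g c < blockb g0 c)%N -> u g = 0.
Proof.
move=> ng off lt; apply: g0min; rewrite /wkey.
set L := \max_y col y; have colL x : (col x <= L)%N by exact: leq_bigmax.
have val_near x : (g x + (g0 x == b) = g0 x + (g x == b))%N \/ g x = g0 x.
  have /forallP /(_ x) /orP [/eqP ->|] := ng; first by right.
  move=> /andP [/orP [] /eqP -> /orP [] /eqP ->]; rewrite ?eqxx; try by right.
    by rewrite (negbTE nab); left; lia.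
  by rewrite (negbTE nab); left; lia.
have near1 x : (g x <= g0 x + 1)%N.
  case: (val_near x) => [|->]; last by rewrite leq_addr.
  by case: (g0 x == b); case: (g x == b); rewrite ?addn0 ?addn1; lia.
rewrite (bigID (fun x => col x == c)) [X in (_ < X)%N](bigID (fun x => col x == c)) /=.
have [x0 hx0] : exists x, col x = c.
  have : (0 < blockb g0 c)%N by lia.
  by rewrite card_gt0 => /set0Pn [x]; rewrite inE => /andP [/eqP h _]; exists x.
set A := (\sum_(x | col x == c) _)%N; set B := (\sum_(x | col x != c) _)%N.
set A0 := (\sum_(x | col x == c) _)%N; set B0 := (\sum_(x | col x != c) _)%N.
have hA : (A + m.+1 ^ (L - c) <= A0)%N.
  have bE (h : word) : blockb h c = (\sum_(x | col x == c) (h x == b))%N.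
    by rewrite -big_mkcondr /= sum1dep_card.
  have e : (\sum_(x | col x == c) g x + blockb g0 c =
            \sum_(x | col x == c) g0 x + blockb g c)%N.
    rewrite !bE -!big_split /=.
    by apply: eq_bigr => x _; case: (val_near x) => [//|gx]; rewrite gx.
  have AE (h : word) : (\sum_(x | col x == c) m.+1 ^ (L - col x) * h x =
      m.+1 ^ (L - c) * \sum_(x | col x == c) h x)%N.
    by rewrite big_distrr /=; apply: eq_bigr => x /eqP ->.
  rewrite /A /A0 !AE -[X in (_ + X)%N]muln1 -mulnDr leq_mul2l; apply/orP; right; lia.
have hB : (B < B0 + m.+1 ^ (L - c))%N.
  apply: (@leq_ltn_trans (\sum_(x | col x != c) (m.+1 ^ (L - col x) * g0 x + (c < col x) * m.+1 ^ (L - c).-1))%N).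
    apply: leq_sum => x hx; case: (ltngtP c (col x)) hx => // hx _.
      rewrite mul1n; apply: (@leq_trans (m.+1 ^ (L - col x) * (g0 x + 1))%N).
        by rewrite leq_mul2l near1 orbT.
      rewrite mulnDr muln1 leq_add2l leq_exp2l; last by have := ltn_ord x; lia.
      by have := colL x; lia.
    by rewrite mul0n addn0 off // inE -ltnNge.
  rewrite big_split /= ltn_add2l -big_distrl /=.
  case: (leqP L c) => hLc.
    rewrite big1 ?mul0n ?expn_gt0 // => x _.
    by rewrite (_ : (c < col x)%N = false) //; have := colL x; lia.
  rewrite -[in X in (_ < X)%N](prednK (n := L - c)) ?subn_gt0 // expnS.
  rewrite ltn_mul2r expn_gt0 /= ltnS.
  apply: (@leq_trans (\sum_(x | col x != c) 1)); first by apply: leq_sum => x _; exact: leq_b1.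
  by rewrite sum1_card; apply: leq_trans (max_card _) _; rewrite card_ord.
by have := leq_add hA hB; lia.
Qed.

Lemma blockb_upd (g : word) c x : col x = c -> g x = a -> blockb (upd g x b) c = (blockb g c).+1.
Proof.
move=> cx gx; rewrite /blockb (cardsD1 x) !inE cx eqxx updE eqxx eqxx add1n /=; congr _.+1.
apply: eq_card => y; rewrite !inE updE; case: (y =P x) => [->|_] //=.
by rewrite gx (negbTE nab) andbF.
Qed.

Lemma blockb_upd_other (g : word) c x d : col x != c -> blockb (upd g x d) c = blockb g c.
Proof.
move=> cx; apply: eq_card => y; rewrite !inE updE; case: (y =P x) => [->|_] //=.
by rewrite (negbTE cx).
Qed.

Definition blocksym (v : word -> K) c := forall x y g, col x = c -> col y = c ->
  v (permw g (tperm x y)) = v g.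

Lemma raise_blocksym v c : blocksym v c -> blocksym (raise (tail c) a b v) c.
Proof.
move=> h x y g cx cy; rewrite /raise (reindex_inj (@perm_inj _ (tperm x y))) /=.
apply: eq_big => [z|z _].
  by rewrite ffunE tpermK !inE; case: tpermP => [->|->|//]; rewrite cx cy.
rewrite -[RHS](h x y) //; congr v; apply/ffunP => w; rewrite !ffunE.
by rewrite -(inj_eq (@perm_inj _ (tperm x y))) tpermK.
Qed.

(** A function that is symmetric in the positions of the column c and
    vanishes when there are fewer than j letters b in it: raising a word
    with j-1 letters b gives a positive multiple of the value of v at a word
    with j of them. The raised function has the same properties for j-1.
    Hence s raisings, for s at most j, give a positive multiple of that
    value, which is therefore zero if they kill v. *)
Lemma killed_block v s j c : blocksym v c ->
  (forall g, near g -> (forall x, x \notin tail c -> g x = g0 x) -> (blockb g c < j)%N -> v g = 0) ->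
  killed v (tail c) s -> (s <= j)%N ->
  forall g, near g -> (forall x, x \notin tail c -> g x = g0 x) -> blockb g c = j -> v g = 0.
Proof.
elim: s v j => [|s IH] v j sy small kl hj g ng off gj; first exact: kl.
case: j hj small gj => // j hj small gj.
pose v1 := raise (tail c) a b v.
have v1z g1 : near g1 -> (forall x, x \notin tail c -> g1 x = g0 x) -> blockb g1 c = j -> v1 g1 = 0.
  apply: (IH v1 j) => //; first exact: raise_blocksym.
    move=> g2 n2 o2 lt; rewrite /v1 /raise big1 // => x /andP [xt /eqP gx].
    apply: small; first by apply: (near_upd n2 gx); rewrite eqxx ?orbT.
      by move=> y hy; rewrite updE ifN ?o2 //; apply: contraNneq hy => ->.
    case: (altP (col x =P c)) => cx; first by rewrite blockb_upd.
    by rewrite blockb_upd_other //; lia.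
  by move=> g2 n2 o2; rewrite -iterSr; apply: kl.
have /set0Pn [x0] : [set x | (col x == c) && (g x == b)] != set0.
  by rewrite -card_gt0 -/(blockb g c) gj.
rewrite inE => /andP [/eqP cx0 /eqP gx0].
have x0t : x0 \in tail c by rewrite inE cx0.
pose g' := upd g x0 a.
have ng' : near g' by apply: (near_upd ng gx0); rewrite eqxx ?orbT.
have og' x : x \notin tail c -> g' x = g0 x.
  by move=> hx; rewrite updE ifN ?off //; apply: contraNneq hx => ->.
have g'x0 : g' x0 = a by rewrite updE eqxx.
have gg' : upd g' x0 b = g by rewrite upd_upd -gx0 upd_same.
have bg' : blockb g' c = j.
  by apply: succn_inj; rewrite -(blockb_upd cx0 g'x0) gg'.
have := v1z g' ng' og' bg'; rewrite /v1 /raise (bigID (fun x => col x == c)) /=.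
rewrite [X in _ + X]big1 ?addr0; last first.
  move=> y /andP [/andP [yt /eqP gy] cy]; apply: small.
  - by apply: (near_upd ng' gy); rewrite eqxx ?orbT.
  - by move=> z hz; rewrite updE ifN ?og' //; apply: contraNneq hz => ->.
  by rewrite blockb_upd_other // bg'.
rewrite (eq_bigr (fun=> v g)); last first.
  move=> y /andP [/andP [yt /eqP gy] /eqP cy].
  rewrite -(sy x0 y g) //; congr v; apply/ffunP => z; rewrite !ffunE.
  case: (altP (y =P x0)) => [->|nyx]; first by rewrite tperm1 perm1; case: (z =P x0) => [->|].
  move: gy; rewrite updE (negbTE nyx) => gy.
  case: tpermP => [->|->|/eqP n1 /eqP n2].
  - by rewrite eq_sym (negbTE nyx) eqxx gy.
  - by rewrite eqxx gx0.
  by rewrite (negbTE n1) (negbTE n2).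
rewrite sumr_const -mulr_natl => /natr0; apply.
by apply/card_gt0P; exists x0; rewrite unfold_in /= x0t g'x0 cx0 !eqxx.
Qed.

Definition blocka c : nat := #|[set x | (col x == c) && (g0 x == a)]|.

(** Freezing the column c of the tableau. The letters a of g0 in the column
    increase the exponent, its letters b decrease it; the latter are fewer
    than s, as otherwise u would vanish at g0. *)
Lemma killed_step s c : killed u (tail c) s ->
  (blockb g0 c < s)%N /\ killed u (tail c.+1) (s + blocka c - blockb g0 c).
Proof.
move=> kl; have hlt : (blockb g0 c < s)%N.
  rewrite ltnNge; apply/negP => hs; case/eqP: g0u.
  apply: (killed_block _ _ kl hs) => //; [|exact: wkey_block|exact: near0].
  move=> x y g cx cy; apply: lrfun_sym => // z.
  by case: tpermP => [->|->|//]; rewrite cx cy.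
split=> //.
pose xs1 := enum [set x | (col x == c) && (g0 x == b)].
pose xs2 := enum [set x | (col x == c) && (g0 x != b)].
have e : tail c = [set x in xs2] :|: ([set x in xs1] :|: tail c.+1).
  apply/setP => x; rewrite !inE !mem_enum !inE leq_eqVlt eq_sym.
  by case: eqP => //=; case: (g0 x == b).
rewrite e in kl.
have kl1 : killed u ([set x in xs1] :|: tail c.+1) (s + blocka c).
  have -> : blocka c = count (fun x => g0 x == a) xs2.
    rewrite -sum1_count big_enum_cond /= /blocka -sum1dep_card; apply: eq_bigl => x.
    rewrite !inE; case: (g0 x =P a) => [->|]; rewrite ?andbF // !andbT.
    by rewrite nab andbT.
  apply: killed_lowers => //; first exact: enum_uniq.
    move=> x; rewrite mem_enum !inE !mem_enum !inE => /andP [/eqP -> /negbTE ->].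
    by rewrite andbF ltnn.
  by move=> x; rewrite mem_enum inE => /andP [].
have szx : size xs1 = blockb g0 c by rewrite -cardE.
apply: (killed_uppers (xs := xs1)); first exact: enum_uniq.
- by move=> x; rewrite mem_enum !inE => /andP [/eqP -> _]; rewrite ltnn.
- by move=> x; rewrite mem_enum inE => /andP [_ /eqP].
- move=> g ng off /hasP [x xin /eqP gx]; apply: (@wkey_block c) => //.
    move=> y hy; apply: off; apply: contra hy; rewrite !inE mem_enum inE.
    by case/orP => [/andP [/eqP ->]|/ltnW].
  apply: proper_card; apply/properP; split.
    apply/subsetP => y; rewrite !inE => /andP [/eqP cy /eqP gy]; rewrite cy eqxx /=.
    apply/negPn/negP => hy; have := off y; rewrite !inE mem_enum inE cy eqxx (negbTE hy) ltnn gy.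
    by move/(_ isT) => e2; rewrite -e2 eqxx in hy.
  exists x; first by move: xin; rewrite mem_enum.
  by rewrite inE gx (negbTE nab) andbF.
by rewrite szx subnK //; lia.
Qed.

(** Freeze the columns 0, ..., c-1 in turn. The exponent starts at [lo a +
    1], increases by the letters a and decreases by the letters b of g0 in
    these columns, and it must exceed the number of letters b in the column
    c. *)
Lemma leading_lattice c :
  (#|[set x | (col x <= c)%N && (g0 x == b)]| <=
   lo a + #|[set x | (col x < c)%N && (g0 x == a)]|)%N.
Proof.
pose s c := ((lo a).+1 + #|[set x | (col x < c)%N && (g0 x == a)]|
  - #|[set x | (col x < c)%N && (g0 x == b)]|)%N.
have cardS e c' := card_colS col (fun x => g0 x == e) c'.
have key c' : killed u (tail c') (s c') /\
   (#|[set x | (col x < c')%N && (g0 x == b)]| <= (lo a).+1 + #|[set x | (col x < c')%N && (g0 x == a)]|)%N.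
  elim: c' => [|c' [IH1 IH2]].
    split; last by rewrite (_ : #|_| = 0%N) //; apply: eq_card0 => x; rewrite !inE.
    have e0 e : #|[set x | (col x < 0)%N && (g0 x == e)]| = 0%N by apply: eq_card0 => x; rewrite !inE.
    move=> g _ _; rewrite /s !e0 addn0 subn0.
    have -> : tail 0 = setT by apply/setP => x; rewrite !inE.
    exact: lrfun_raise.
  have [h1 h2] := killed_step IH1.
  rewrite /s !cardS; rewrite /s in h1 h2.
  split; last by move: h1 IH2; rewrite /blockb /blocka; lia.
  rewrite (_ : _ - _ = ((lo a).+1 + #|[set x | (col x < c')%N && (g0 x == a)]|
    - #|[set x | (col x < c')%N && (g0 x == b)]| + blocka c' - blockb g0 c'))%N //.
  by rewrite /blocka /blockb; lia.
have [h1 h2] := key c; have [h3 h4] := killed_step h1.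
have -> : #|[set x | (col x <= c)%N && (g0 x == b)]| =
   (#|[set x | (col x < c)%N && (g0 x == b)]| + blockb g0 c)%N := cardS b c.
by move: h2 h3; rewrite /s; lia.
Qed.

End Letters.
(** Otherwise the positions Y of column c with letters at least i, and of
    column c+1 with letters at most i, are too many for one column. In the
    Garnir relation for Y each permuted word is either smaller than g0,
    where u vanishes, or has the same letters as g0 in each column, where u
    takes the value u g0; so a positive multiple of u g0 is zero. *)
Lemma leading_strict c (i : 'I_k) :
  (#|[set x | (col x == c.+1) && (g0 x <= i)%N]| <=
   #|[set x | (col x == c) && (g0 x < i)%N]|)%N.
Proof.
rewrite leqNgt; apply/negP => viol.
pose C := [set x | col x == c].
pose Y := [set x | (col x == c) && (i <= g0 x)%N] :|: [set x | (col x == c.+1) && (g0 x <= i)%N].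
have hY x : x \in Y -> col x = c \/ col x = c.+1.
  by rewrite !inE => /orP [] /andP [/eqP -> _]; [left|right].
have cardY : (#|C| < #|Y|)%N.
  rewrite cardsU (_ : _ :&: _ = set0) ?cards0 ?subn0.
    rewrite -(cardsID [set x | (i <= g0 x)%N] C).
    rewrite (_ : C :&: _ = [set x | (col x == c) && (i <= g0 x)%N]); last by apply/setP => x; rewrite !inE.
    rewrite ltn_add2l (_ : C :\: _ = [set x | (col x == c) && (g0 x < i)%N]) //.
    by apply/setP => x; rewrite !inE -ltnNge andbC.
  apply/setP => x; rewrite !inE; lia.
have [y1 [y1Y cy1]] : exists x, x \in Y /\ col x = c.+1.
  have : (0 < #|[set x | (col x == c.+1) && (g0 x <= i)%N]|)%N by lia.
  rewrite card_gt0 => /set0Pn [y hy]; exists y; split; first by rewrite in_setU hy orbT.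
  by move: hy; rewrite inE => /andP [/eqP].
(* A permutation of Y replaces letters at least i of the column c by letters
   at most i. If the sum over the column does not drop, all letters that
   move between the columns are equal to i. *)
have same s : perm_on Y s -> u (permw g0 s) != 0 -> u (permw g0 s) = u g0.
  move=> ps us.
  have hle : (\sum_(x | col x == c) g0 x <= \sum_(x | col x == c) permw g0 s x)%N.
    rewrite leqNgt; apply/negP => lt; case/eqP: us; apply: g0min.
    by apply: (wkey_perm_split hY ps) lt; exists y1.
  pose P := s @: C.
  have cardP : #|P| = #|C| by rewrite card_imset //; exact: perm_inj.
  have inCP z : z \in C :\: P -> (i <= g0 z)%N.
    rewrite inE => /andP [zP zC]; have : z \in Y.
      apply: contraNT zP => zY; apply/imsetP; exists z => //; by rewrite (out_perm ps).
    rewrite !inE => /orP [/andP [] //|/andP [/eqP e _]].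
    by move: zC; rewrite inE e => /eqP; lia.
  have inPC z : z \in P :\: C -> (g0 z <= i)%N.
    rewrite inE => /andP [zC /imsetP [x xC ex]]; have : z \in Y.
      rewrite ex (perm_closed _ ps); apply: contraNT zC => xY.
      by rewrite ex (out_perm ps).
    rewrite !inE => /orP [/andP [e _]|/andP [] //].
    by rewrite inE e in zC.
  have cardD : #|C :\: P| = #|P :\: C|.
    by have := cardsID P C; have := cardsID C P; rewrite cardP setIC; lia.
  have sumC (F : 'I_k -> nat) : (\sum_(x | col x == c) F (g0 x) =
      \sum_(x in C :&: P) F (g0 x) + \sum_(x in C :\: P) F (g0 x))%N.
    by rewrite -(big_setID P) /=; apply: eq_bigl => x; rewrite inE.
  have sumP (F : 'I_k -> nat) : (\sum_(x | col x == c) F (permw g0 s x) =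
      \sum_(x in C :&: P) F (g0 x) + \sum_(x in P :\: C) F (g0 x))%N.
    rewrite setIC -(big_setID C) /= /P big_imset /=; last by move=> x y _ _; exact: perm_inj.
    by apply: eq_big => x; rewrite ?inE // ffunE.
  have lo1 := leqif_sum (fun z hz => leqif_eq (inCP z hz)).
  have hi1 := leqif_sum (fun z hz => leqif_eq (inPC z hz)).
  rewrite (sumC (fun a => a)) (sumP (fun a => a)) leq_add2l in hle.
  rewrite sum_nat_const in lo1; rewrite sum_nat_const -cardD in hi1.
  have eqCP z : z \in C :\: P -> g0 z = i.
    have : (#|C :\: P| * i == \sum_(x in C :\: P) g0 x)%N.
      by rewrite eqn_leq lo1 (leq_trans hle hi1).
    by rewrite lo1 => /forall_inP h /h /eqP e; apply: val_inj.
  have eqPC z : z \in P :\: C -> g0 z = i.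
    have : (\sum_(x in P :\: C) g0 x == #|C :\: P| * i)%N.
      by rewrite eqn_leq hi1 (leq_trans lo1 hle).
    by rewrite hi1 => /forall_inP h /h /eqP e; apply: val_inj.
  apply: lrfun_wcount => c' e.
  have cnt (h : word) c2 : wcount h c2 e = (\sum_(x | col x == c2) (h x == e))%N.
    by rewrite /wcount -sum1dep_card -big_mkcondr.
  have cC : wcount (permw g0 s) c e = wcount g0 c e.
    rewrite !cnt (sumC (fun a => a == e)) (sumP (fun a => a == e)); congr (_ + _)%N.
    rewrite (eq_bigr (fun=> nat_of_bool (i == e))); last by move=> x /eqPC ->.
    rewrite [RHS](eq_bigr (fun=> nat_of_bool (i == e))); last by move=> x /eqCP ->.
    by rewrite !sum_nat_const cardD.
  case: (altP (c' =P c)) => [->|nc]; first exact/esym.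
  case: (altP (c' =P c.+1)) => [->|nc1]; last first.
    rewrite !cnt; apply: eq_bigr => x /eqP cx; rewrite ffunE (out_perm ps) //.
    by apply/negP => /hY [] e2; move: nc nc1; rewrite -cx e2 eqxx.
  have tot := sum_two_cols (fun a => a == e) g0 hY ps.
  rewrite -!cnt in tot.
  by move: tot; rewrite cC; lia.
have := lrfun_garnir uP g0 hY cardY.
rewrite (bigID (fun s => u (permw g0 s) != 0)) /= [X in _ + X]big1 ?addr0; last first.
  by move=> s /andP [_ /negbNE /eqP].
rewrite (eq_bigr (fun=> u g0)); last by move=> s /andP [ps us]; exact: same.
rewrite sumr_const -mulr_natl => /natr0 h; case/eqP: g0u; apply: h.
apply/card_gt0P; exists 1%g; rewrite unfold_in /= perm_on1.
by rewrite (_ : permw g0 1 = g0) //; apply/ffunP => x; rewrite ffunE perm1.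
Qed.

End Leading.

Section LRWords.
Variables (K : fieldType) (charK : [pchar K] =i pred0).
Variables (m k : nat) (col : 'I_m -> nat) (lo al : nat -> nat).
Notation word := {ffun 'I_m -> 'I_k}.

(** Transposed semistandard fillings (strict in the rows) which are lattice
    words when read column by column, up to an excess [lo a] of the letters
    a + 1 over the letters a; within a column the letters a + 1 are counted
    before the letters a. *)
Definition lrword (g : word) : Prop :=
  [/\ forall a : 'I_k, #|[set x | g x == a]| = al a,
      forall (a b : 'I_k) c, b = a.+1 :> nat ->
        (#|[set x | (col x <= c)%N && (g x == b)]| <=
         lo a + #|[set x | (col x < c)%N && (g x == a)]|)%N
    & forall c (i : 'I_k),
        (#|[set x | (col x == c.+1) && (g x <= i)%N]| <=
         #|[set x | (col x == c) && (g x < i)%N]|)%N].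

Theorem lrfun_eq0 (u : word -> K) : lrfun col lo al u ->
  (forall g, lrword g -> u g = 0) -> forall g, u g = 0.
Proof.
move=> uP h g; apply/eqP/negPn/negP => gu.
case: (@arg_minnP _ g (fun g => u g != 0) (wkey col) gu) => g0 g0u g0min.
have gm g1 : (wkey col g1 < wkey col g0)%N -> u g1 = 0.
  by move=> lt; apply/eqP/negPn/negP => /g0min; lia.
case/eqP: (g0u); apply: h; split.
- by move=> a; apply: (lrfun_content uP).
- move=> a b c ab; exact: (leading_lattice charK uP).
- move=> c i; exact: (leading_strict charK uP).
Qed.

End LRWords.

(** * The action of sl2 on functions of words *)

Section Sl2.
Variables (K : fieldType) (charK : [pchar K] =i pred0) (m k : nat).
Variables a b : 'I_k.
Hypothesis nab : a != b.
Notation word := {ffun 'I_m -> 'I_k}.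
Implicit Types (u v : word -> K) (g : word).

Definition cnt (c : 'I_k) g : nat := #|[set x | g x == c]|.
Notation e := (@raise K m k setT a b).
Notation f := (@raise K m k setT b a).

Lemma raiseE c d u g : raise setT c d u g = \sum_(x | g x == c) u (upd g x d).
Proof. by apply: eq_bigl => x; rewrite in_setT. Qed.

Lemma raise_neq0 c d v g : raise setT c d v g != 0 ->
  exists2 x, g x = c & v (upd g x d) != 0.
Proof.
rewrite raiseE => ne0; have /exists_inP [x /eqP] :
    [exists (x | g x == c), v (upd g x d) != 0]; last by exists x.
apply: contraNT ne0; rewrite negb_exists_in => /forall_inP h0.
by rewrite big1 // => x gx; apply/eqP/negbNE/h0.
Qed.

Lemma cnt_upd_new c d g x : c != d -> g x = c -> cnt d (upd g x d) = (cnt d g).+1.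
Proof.
move=> ncd gx; rewrite /cnt (cardsD1 x) !inE updE eqxx eqxx add1n; congr _.+1.
apply: eq_card => y; rewrite !inE updE; case: (y =P x) => [->|_] //=.
by rewrite gx (negbTE ncd).
Qed.

Lemma cnt_upd_old c d g x : c != d -> g x = c -> (cnt c (upd g x d)).+1 = cnt c g.
Proof.
move=> ncd gx; have ug : upd (upd g x d) x c = g by rewrite upd_upd -gx upd_same.
by rewrite -[in RHS]ug (@cnt_upd_new d c) ?updE ?eqxx // eq_sym.
Qed.

Lemma cnt_upd_other c d g x : c != g x -> c != d -> cnt c (upd g x d) = cnt c g.
Proof.
move=> nc nd; apply: eq_card => y; rewrite !inE updE; case: (y =P x) => [->|_] //.
by rewrite ![_ == c]eq_sym (negbTE nc) (negbTE nd).
Qed.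

Lemma raise_fe u g : f (e u) g = (cnt b g)%:R * u g +
  \sum_(x | g x == a) \sum_(y | g y == b) u (upd (upd g x b) y a).
Proof.
rewrite exchange_big /= raiseE /cnt -sum1dep_card natr_sum mulr_suml -big_split /=.
apply: eq_bigr => y /eqP gy; rewrite raiseE (bigD1 y) /=; last by rewrite updE eqxx.
rewrite upd_upd -{1}gy upd_same mul1r; congr (_ + _).
apply: eq_big => [x|x]; rewrite updE; case: (x =P y) => [->|/eqP nxy].
- by rewrite eqxx gy eq_sym (negbTE nab).
- by rewrite andbT.
- by rewrite eqxx andbF.
by move=> _; rewrite upd_comm // eq_sym.
Qed.

Lemma raise_comm u g :
  e (f u) g + (cnt b g)%:R * u g = f (e u) g + (cnt a g)%:R * u g.
Proof.
pose S := \sum_(x | g x == a) \sum_(y | g y == b) u (upd (upd g x b) y a).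
have ef : e (f u) g = (cnt a g)%:R * u g + S.
  rewrite raiseE /cnt -sum1dep_card natr_sum mulr_suml -big_split /=.
  apply: eq_bigr => x /eqP gx; rewrite raiseE (bigD1 x) /=; last by rewrite updE eqxx.
  rewrite upd_upd -gx upd_same mul1r; congr (_ + _); apply: eq_bigl => y.
  rewrite updE; case: (y =P x) => [->|_]; last by rewrite andbT.
  by rewrite eqxx gx (negbTE nab).
by rewrite ef raise_fe -/S addrAC [RHS]addrAC [_ * _ + _ * _]addrC.
Qed.

Lemma raiseZ R c d (z : K) u g : raise R c d (fun g => z * u g) g = z * raise R c d u g.
Proof. by rewrite /raise mulr_sumr. Qed.

(** The weight of v for the coroot of the pair a, b is h. *)
Definition weight (h : nat) v := forall g, v g != 0 -> cnt a g = (cnt b g + h)%N.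

Lemma weight_e h v : weight h v -> weight h.+2 (e v).
Proof.
move=> hv g /raise_neq0 [x gx vx].
have := hv _ vx; have := cnt_upd_old nab gx; have := cnt_upd_new nab gx.
lia.
Qed.

Lemma weight_f h v : weight h.+2 v -> weight h (f v).
Proof.
move=> hv g /raise_neq0 [x gx vx].
have nba : b != a by rewrite eq_sym.
have := hv _ vx; have := cnt_upd_old nba gx; have := cnt_upd_new nba gx.
lia.
Qed.

Lemma weight_comm h v g : weight h v -> e (f v) g = f (e v) g + h%:R * v g.
Proof.
move=> hv; have := raise_comm v g.
case: (v g =P 0) => [->|/eqP /hv ->]; first by rewrite !mulr0 !addr0.
move=> E; apply: (@addIr _ ((cnt b g)%:R * v g)).
by rewrite E natrD mulrDl -!addrA; congr (_ + _); exact: addrC.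
Qed.

Lemma iter_e_weight h v s : weight h v -> weight (h + s.*2) (iter s e v).
Proof.
move=> hv; elim: s => [|s IH]; first by rewrite addn0.
by rewrite doubleS !addnS; apply: weight_e.
Qed.

Lemma iter_e_big v s g : iter s e v g != 0 -> (cnt b g + s <= m)%N.
Proof.
elim: s g => [|s IH] g.
  by move=> _; rewrite addn0 -[X in (_ <= X)%N]card_ord max_card.
move=> /raise_neq0 [x gx vx].
by have := IH _ vx; rewrite (cnt_upd_new nab gx) addSnnS.
Qed.

Lemma f_iter_e h v s g : weight h v -> f v =1 (fun=> 0) -> (0 < h)%N ->
  f (iter s e v) g = - (s * (h + s.-1))%:R * iter s.-1 e v g.
Proof.
move=> hv fv h0; elim: s g => [|s IH] g /=; first by rewrite fv mul0n oppr0 mul0r.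
have E := weight_comm g (@iter_e_weight _ _ s hv).
rewrite (eq_raise _ _ _ IH) raiseZ in E.
apply: (@addIr _ ((h + s.*2)%:R * iter s e v g)); rewrite -E.
case: s {IH E} => [|s] /=.
  by rewrite !mul0n mul1n addn0 oppr0 mul0r mulNr addNr.
rewrite -mulrDl; congr (_ * _).
have -> : (s.+2 * (h + s.+1) = s.+1 * (h + s) + (h + s.+1.*2))%N by rewrite -muln2; nia.
by rewrite natrD opprD addrNK.
Qed.

(** A nonzero vector of positive weight killed by the lowering operator
    would generate an infinite string under the raising operator. *)
Lemma f_inj h v : weight h v -> (0 < h)%N -> f v =1 (fun=> 0) -> v =1 (fun=> 0).
Proof.
move=> hv h0 fv.
have top : iter m.+1 e v =1 (fun=> 0).
  by move=> g; apply/eqP/negPn/negP => /iter_e_big; lia.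
move: top; elim: m.+1 => // s IH top; apply: IH => g.
have := f_iter_e s.+1 g hv fv h0.
rewrite (eq_raise _ _ _ top) /raise big1 // => /esym /eqP.
rewrite mulNr oppr_eq0 => /eqP /(natr0 charK) /=; apply.
by rewrite muln_gt0 addn_gt0 h0.
Qed.

(** The Weyl group element exchanging the letters a and b; it conjugates e
    to f. *)
Definition swapw g : word := [ffun x => tperm a b (g x)].

Lemma swapwK : involutive swapw.
Proof. by move=> g; apply/ffunP => x; rewrite !ffunE tpermK. Qed.

Lemma swapw_upd g x c : swapw (upd g x c) = upd (swapw g) x (tperm a b c).
Proof. by apply/ffunP => y; rewrite !ffunE; case: (y == x). Qed.

Lemma cnt_swapw c g : cnt c (swapw g) = cnt (tperm a b c) g.
Proof.
apply: eq_card => x; rewrite !inE ffunE.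
by rewrite -(inj_eq (@perm_inj _ (tperm a b))) tpermK.
Qed.

Lemma f_swapw u g : f u (swapw g) = e (u \o swapw) g.
Proof.
rewrite !raiseE; apply: eq_big => [x|x _]; last by rewrite /= swapw_upd tpermR.
by rewrite ffunE -(inj_eq (@perm_inj _ (tperm a b))) tpermK tpermR.
Qed.

Lemma e_swapw u g : e u (swapw g) = f (u \o swapw) g.
Proof.
rewrite !raiseE; apply: eq_big => [x|x _]; last by rewrite /= swapw_upd tpermL.
by rewrite ffunE -(inj_eq (@perm_inj _ (tperm a b))) tpermK tpermL.
Qed.

Variables (eps : K) (eps2 : eps * eps = 1).

Lemma raiseD R c d u v g :
  raise R c d (fun g => u g + v g) g = raise R c d u g + raise R c d v g.
Proof. by rewrite /raise big_split. Qed.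

(** The hypothesis says that u = eps e(flip u), hence f u = eps flip u and e
    f u = u. As u has weight 1, f e u = e f u - u = 0, and f is injective on
    positive weights: u lies in the two-dimensional representations. *)
Lemma spin_half u : weight 1 u ->
  (forall g, u g = eps * \sum_(x | g x == a) u (swapw (upd g x b))) ->
  e u =1 (fun=> 0).
Proof.
move=> w1 h; have h' g : u g = eps * e (u \o swapw) g by rewrite {1}h raiseE.
have fu g : f u g = eps * u (swapw g).
  by rewrite h' -f_swapw swapwK mulrA eps2 mul1r.
have efu g : e (f u) g = u g.
  by rewrite (eq_raise _ _ _ fu) raiseZ -h'.
apply: (f_inj (weight_e w1)) => // g.
by have := weight_comm g w1; rewrite efu mul1r => /eqP; rewrite -subr_eq subrr eq_sym => /eqP.
Qed.

(** On the zero weight space f e commutes with the flip, so the hypothesis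
    gives f e f e u = 2 f e u. The operator f e acts there by the integers j
    (j + 1), so u lies in the sum of the representations with j at most 1,
    where the square of e kills the weight zero. *)
Lemma spin_one u : weight 0 u ->
  (forall g, f (e u) g = u g - eps * u (swapw g)) -> e (e u) =1 (fun=> 0).
Proof.
move=> w0 h.
have Csw g : f (e (u \o swapw)) g = f (e u) (swapw g).
  have -> : f (e u) (swapw g) = e (f u) (swapw g).
    by rewrite (weight_comm _ w0) mul0r addr0.
  rewrite e_swapw; apply: eq_bigr => x _.
  by rewrite /= f_swapw.
have CC g : f (e (f (e u))) g = 2%:R * f (e u) g.
  have h1 : f (e u) =1 fun g => u g + (- eps) * (u \o swapw) g.
    by move=> g'; rewrite h mulNr.
  rewrite (eq_raise _ _ _ (eq_raise _ _ _ h1)).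
  transitivity (f (fun g => e u g + (- eps) * e (u \o swapw) g) g).
    by apply: eq_raise => g'; rewrite raiseD raiseZ.
  by rewrite raiseD raiseZ Csw !h swapwK mulNr mulrBr mulrA eps2 mul1r; ring.
have w2 := weight_e w0; have w4 := weight_e w2.
have ffee : f (f (e (e u))) =1 (fun=> 0).
  move=> g; have := CC g.
  have h1 : e (f (e u)) =1 fun g => f (e (e u)) g + 2%:R * e u g.
    by move=> g'; rewrite (weight_comm _ w2).
  rewrite (eq_raise _ _ _ h1) raiseD raiseZ => /eqP.
  by rewrite -subr_eq0 addrK => /eqP.
apply: (f_inj w4) => // g.
exact: (f_inj (weight_f w4) _ ffee).
Qed.

End Sl2.

(** * Consequences of the Filippov identity *)

Lemma upd_at (n : nat) (T : Type) (x : {ffun 'I_n -> T}) i c j :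
  upd x i c j = if j == i then c else x j.
Proof. by rewrite ffunE. Qed.

Lemma upd_id (n : nat) (T : Type) (x : {ffun 'I_n -> T}) i : upd x i (x i) = x.
Proof. by apply/ffunP => j; rewrite ffunE; case: eqP => [->|]. Qed.

Section Adb.
Variables (K : fieldType) (q : nat) (L : lmodType K) (br : {ffun 'I_q.+1 -> L} -> L).
Hypothesis brP : is_LAnKe br.
Implicit Types (y z : {ffun 'I_q -> L}) (a b c : L).

Definition bvec a y : {ffun 'I_q.+1 -> L} :=
  [ffun i => if unlift ord0 i is Some j then y j else a].
(** The bracket [a, y_1, ..., y_q], with the first argument set apart. *)
Definition adb a y := br (bvec a y).

Lemma bvec0 a y : bvec a y ord0 = a.
Proof. by rewrite ffunE unlift_none. Qed.
Lemma bvecS a y t : bvec a y (lift ord0 t) = y t.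
Proof. by rewrite ffunE liftK. Qed.

Lemma upd_bvec0 a b y : upd (bvec a y) ord0 b = bvec b y.
Proof.
apply/ffunP => i; rewrite !ffunE; case: unliftP => [j ->|->]; rewrite ?eqxx //.
Qed.

Lemma upd_bvecS a b y t : upd (bvec a y) (lift ord0 t) b = bvec a (upd y t b).
Proof.
apply/ffunP => i; rewrite !ffunE; case: unliftP => [j ->|->].
  by rewrite (inj_eq lift_inj) ffunE.
by rewrite (negbTE (neq_lift _ _)).
Qed.

Lemma adbP (s : K) a b y : adb (s *: a + b) y = s *: adb a y + adb b y.
Proof. by have [h _ _] := brP; have := h (bvec 0 y) ord0 s a b; rewrite !upd_bvec0. Qed.

Lemma adb0 y : adb 0 y = 0.
Proof. by have := adbP (-1) 0 0 y; rewrite scaler0 add0r scaleN1r addNr. Qed.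
Lemma adbN a y : adb (- a) y = - adb a y.
Proof. by have := adbP (-1) a 0 y; rewrite !scaleN1r adb0 !addr0. Qed.

Lemma adbPr (s : K) a y t b c :
  adb a (upd y t (s *: b + c)) = s *: adb a (upd y t b) + adb a (upd y t c).
Proof.
by have [h _ _] := brP; have := h (bvec a y) (lift ord0 t) s b c; rewrite !upd_bvecS.
Qed.

Lemma adb_swap a y t b : adb a (upd y t b) = - adb b (upd y t a).
Proof.
have [_ h _] := brP; rewrite /adb (h (tperm ord0 (lift ord0 t))) odd_tperm neq_lift.
rewrite expr1 scaleN1r; congr (- br _); apply/ffunP => i; rewrite ffunE.
case: tpermP => [->|->|/eqP n1 /eqP n2].
- by rewrite bvecS bvec0 upd_at eqxx.
- by rewrite bvecS bvec0 upd_at eqxx.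
case: (unliftP ord0 i) n1 n2 => [j ->|->] //.
by rewrite (inj_eq lift_inj) !bvecS !upd_at => _ /negbTE ->.
Qed.

Lemma adb_tperm a y t t' : t != t' -> adb a [ffun i => y (tperm t t' i)] = - adb a y.
Proof.
move=> nt; have [_ h _] := brP.
rewrite [in RHS]/adb (h (tperm (lift ord0 t) (lift ord0 t'))) odd_tperm.
rewrite (inj_eq lift_inj) nt expr1 scaleN1r opprK; congr br; apply/ffunP => i.
rewrite [RHS]ffunE; case: (unliftP ord0 i) => [j ->|->].
  rewrite bvecS ffunE; case: tpermP => [->|->|/eqP n1 /eqP n2].
  - by rewrite tpermL bvecS.
  - by rewrite tpermR bvecS.
  rewrite tpermD ?bvecS // (inj_eq lift_inj) eq_sym //.
by rewrite tpermD ?bvec0 // eq_sym neq_lift.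
Qed.

(** The bracket with z_1, ..., z_q is a derivation. *)
Lemma filippov a y z :
  adb (adb a y) z = adb (adb a z) y + \sum_(t < q) adb a (upd y t (adb (y t) z)).
Proof.
have [_ _ h] := brP; have := h (bvec a y) (bvec 0 z) ord0 (erefl _).
rewrite upd_bvec0 big_ord_recl bvec0 !upd_bvec0 => h1; apply: (etrans h1); congr (_ + _).
by apply: eq_bigr => t _; rewrite upd_bvecS bvecS upd_bvec0.
Qed.

(** Brackets in the arguments y can be moved into the first argument: write
    the outer bracket as one whose first argument is [c, d_1, ..., d_q],
    apply the derivation rule, and permute back. *)
Lemma adb_nested a y t c d :
  adb a (upd y t (adb c d)) =
  adb (adb a (upd y t c)) d - \sum_(l < q) adb (adb a (upd y t (d l))) (upd d l c).
Proof.
rewrite adb_swap filippov (adb_swap c) adbN opprD opprK; congr (_ - _).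
apply: eq_bigr => l _; rewrite adb_swap (adb_swap (d l)) adbN opprK; congr (adb _ _).
Qed.

(** Opening the inner brackets of [filippov] by [adb_nested] gives a
    relation among left combs only. It says how two consecutive blocks of a
    left comb are exchanged. *)
Lemma adb_exchange a y z :
  adb (adb a y) z = adb (adb a z) y +
   (q%:R *: adb (adb a y) z
    - \sum_(t < q) \sum_(l < q) adb (adb a (upd y t (z l))) (upd z l (y t))).
Proof.
rewrite {1}filippov; congr (_ + _).
under eq_bigr do rewrite adb_nested upd_id.
rewrite sumrB; congr (_ - _).
by rewrite sumr_const card_ord scaler_nat.
Qed.

(** The same exchange for the innermost brackets, where the first argument a
    is a letter like the others and [adb_nested] is not needed: a single
    antisymmetry suffices. *)
Lemma adb_first a y z :
  adb (adb a y) z = adb (adb a z) y - \sum_(t < q) adb (adb (y t) z) (upd y t a).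
Proof.
rewrite filippov; congr (_ + _); rewrite -sumrN; apply: eq_bigr => t _.
by rewrite adb_swap.
Qed.

Implicit Types (w : nat -> L).

(** A left comb is given by its sequence of letters w: w 0 first, and then q
    letters for each further bracket, so that block i holds the letters i q
    + 1, ..., i q + q. *)
Definition blk (w : nat -> L) (i : nat) : {ffun 'I_q -> L} := [ffun t : 'I_q => w (i * q + t).+1].
Definition ads (w : nat -> L) a (s : seq nat) := foldl (fun a i => adb a (blk w i)) a s.
Definition comb (w : nat -> L) j := ads w (w 0%N) (iota 0 j).

Lemma ads_linear w s : linear (fun a => ads w a s).
Proof. by move=> r; elim: s => //= i s IH a b; rewrite adbP IH. Qed.

Lemma adsN w s a : ads w (- a) s = - ads w a s.
Proof. by elim: s a => //= i s IH a; rewrite adbN IH. Qed.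

Lemma eq_ads w w' a s : (forall i (t : 'I_q), i \in s -> w (i * q + t).+1 = w' (i * q + t).+1) ->
  ads w a s = ads w' a s.
Proof.
elim: s a => //= i s IH a h; have -> : blk w i = blk w' i.
  by apply/ffunP => t; rewrite !ffunE h // mem_head.
by apply: IH => i' t hi; apply: h; rewrite inE hi orbT.
Qed.

Lemma comb_split w j i : (i < j)%N ->
  comb w j = ads w (adb (comb w i) (blk w i)) (iota i.+1 (j - i.+1)).
Proof.
move=> h; rewrite /comb -{1}(subnKC h) iotaD /ads foldl_cat -addn1 iotaD foldl_cat /= add0n.
by rewrite addn1.
Qed.

Lemma comb_split2 w j i : (i.+1 < j)%N ->
  comb w j = ads w (adb (adb (comb w i) (blk w i)) (blk w i.+1)) (iota i.+2 (j - i.+2)).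
Proof.
move=> h; rewrite (@comb_split w j i.+1) //; congr (ads _ (adb _ _) _).
by rewrite /comb -addn1 iotaD /ads foldl_cat.
Qed.

End Adb.

(** * Multilinear left combs *)

Section Slots.
Variables (q k : nat).
Hypotheses (q0 : (0 < q)%N) (k0 : (0 < k)%N).
Notation m := (q * k).+1.

(** The bracket in which a slot of the comb occurs. The slot 0 goes with the
    first block, because the innermost bracket is antisymmetric in its q + 1
    letters: the predecessor of 0 is 0. *)
Definition sblk (p : 'I_m) : nat := (p.-1 %/ q)%N.
Definition slot (i : nat) (t : 'I_q) : 'I_m := inord (i * q + t).+1.

Lemma slot_val i t : (i < k)%N -> slot i t = (i * q + t).+1 :> nat.
Proof. by move=> hi; rewrite /slot inordK //; have := ltn_ord t; nia. Qed.

Lemma sblk_slot i t : (i < k)%N -> sblk (slot i t) = i.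
Proof.
by move=> hi; rewrite /sblk slot_val //= divnMDl // divn_small ?addn0.
Qed.

Lemma sblk0 : sblk ord0 = 0%N. Proof. by rewrite /sblk div0n. Qed.

Lemma sblk_lt p : (sblk p < k)%N.
Proof. by rewrite /sblk ltn_divLR //; have := ltn_ord p; nia. Qed.

Lemma slot_neq0 i t : (i < k)%N -> slot i t != ord0.
Proof. by move=> hi; apply/eqP => /(congr1 val) /=; rewrite slot_val. Qed.

Lemma slot_inj i t i' t' : (i < k)%N -> (i' < k)%N -> slot i t = slot i' t' -> i = i' /\ t = t'.
Proof.
move=> hi hi' e; have ei : i = i' by rewrite -(sblk_slot t hi) e sblk_slot.
split=> //; apply: val_inj => /=; have := congr1 (@nat_of_ord _) e.
by rewrite !slot_val // ei; lia.
Qed.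

Lemma slot_eq i t i' t' : (i < k)%N -> (i' < k)%N ->
  (slot i t == slot i' t') = (i == i') && (t == t').
Proof.
move=> hi hi'; apply/eqP/andP => [/(slot_inj hi hi') [-> ->]//|[/eqP -> /eqP ->] //].
Qed.

Lemma slot_neq i t i' t' : (i < k)%N -> (i' < k)%N -> i != i' -> slot i t != slot i' t'.
Proof. by move=> h h' n; rewrite slot_eq // negb_and n. Qed.

Lemma slot_neqt i t t' : (i < k)%N -> t != t' -> slot i t != slot i t'.
Proof. by move=> h n; rewrite slot_eq // eqxx. Qed.

Lemma slotP (p : 'I_m) : p != ord0 -> exists t, p = slot (sblk p) t.
Proof.
move=> np; have ht : (p.-1 %% q < q)%N by rewrite ltn_mod.
exists (Ordinal ht); apply: val_inj; rewrite /= slot_val ?sblk_lt //= /sblk.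
rewrite -divn_eq prednK // lt0n; apply: contra np => /eqP e; exact/eqP/val_inj.
Qed.

Lemma slot_index i t : (i < k)%N -> Ordinal (ltn_pmod (slot i t).-1 q0) = t.
Proof. by move=> hi; apply: val_inj; rewrite /= slot_val //= modnMDl modn_small. Qed.

Lemma big_slot (V : Type) (x0 : V) (op : Monoid.com_law x0) (F : 'I_m -> V) i :
  (0 < i < k)%N ->
  \big[op/x0]_(p | sblk p == i) F p = \big[op/x0]_(t < q) F (slot i t).
Proof.
move=> /andP [i0 ik].
pose g (p : 'I_m) : 'I_q := Ordinal (ltn_pmod p.-1 q0).
rewrite (reindex_onto (slot i) g) /=.
  by apply: eq_bigl => t; rewrite sblk_slot // eqxx /g slot_index // eqxx.
move=> p /eqP sp; have [|t e] := @slotP p.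
  by apply: contraTneq i0 => e; rewrite -sp e sblk0.
by rewrite e sp /g slot_index.
Qed.

Lemma big_slot0 (V : Type) (x0 : V) (op : Monoid.com_law x0) (F : 'I_m -> V) :
  \big[op/x0]_(p | sblk p == 0%N) F p = op (F ord0) (\big[op/x0]_(t < q) F (slot 0 t)).
Proof.
rewrite (bigD1 ord0) /=; last by rewrite sblk0.
congr (op _ _); pose g (p : 'I_m) : 'I_q := Ordinal (ltn_pmod p.-1 q0).
rewrite (reindex_onto (slot 0) g) /=.
  by apply: eq_bigl => t; rewrite sblk_slot // eqxx slot_neq0 // /g slot_index // eqxx.
move=> p /andP [/eqP sp np]; have [t e] := slotP np.
by rewrite e sp /g slot_index.
Qed.

Definition bswap_fun (i : nat) (p : 'I_m) : 'I_m :=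
  if p == ord0 then p else
  let t := Ordinal (ltn_pmod p.-1 q0) in
  if sblk p == i then slot i.+1 t else if sblk p == i.+1 then slot i t else p.

Lemma bswap_fun_slot i j t : (j < k)%N ->
  bswap_fun i (slot j t) = slot (if j == i then i.+1 else if j == i.+1 then i else j) t.
Proof.
move=> hj; rewrite /bswap_fun (negbTE (slot_neq0 _ hj)) sblk_slot //.
rewrite slot_index //; by case: ifP => // _; case: ifP.
Qed.

Lemma bswap_funK i : (i.+1 < k)%N -> involutive (bswap_fun i).
Proof.
move=> hi p; case: (altP (p =P ord0)) => [->|np]; first by rewrite /bswap_fun !eqxx.
have [t ->] := slotP np; have hp := sblk_lt p; rewrite !bswap_fun_slot //; last first.
  by case: ifP => // _; case: ifP => // _; lia.
congr slot; case: (sblk p =P i) => [->|n1]; first by rewrite eqxx ifN //; lia.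
case: (sblk p =P i.+1) => [->|n2]; first by rewrite eqxx.
by rewrite !ifN //; apply/eqP.
Qed.

(** The permutation of the slots that exchanges the blocks i and i+1 and
    fixes the slot 0. *)
Definition bswap i : 'S_m :=
  if insub i is Some j then perm (can_inj (bswap_funK (valP (j : {i | (i.+1 < k)%N})))) else 1%g.

Lemma bswap_slot i j t : (i.+1 < k)%N -> (j < k)%N ->
  bswap i (slot j t) = slot (if j == i then i.+1 else if j == i.+1 then i else j) t.
Proof.
by move=> hi hj; rewrite /bswap insubT permE /= bswap_fun_slot.
Qed.

Lemma bswap0 i : bswap i ord0 = ord0.
Proof. by rewrite /bswap; case: insubP => [j _ _|_]; rewrite ?perm1 ?permE /bswap_fun ?eqxx. Qed.

Lemma bswapV i : ((bswap i)^-1 = bswap i)%g.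
Proof.
apply: (mulIg (bswap i)); rewrite mulVg; apply/permP => p; rewrite perm1 permM.
rewrite /bswap; case: insubP => [j _ _|_]; last by rewrite !perm1.
by rewrite !permE bswap_funK // (valP j).
Qed.

Lemma sblk_bswap i p : (i.+1 < k)%N -> sblk (bswap i p) =
  if p == ord0 then 0%N else
  if sblk p == i then i.+1 else if sblk p == i.+1 then i else sblk p.
Proof.
move=> hi; case: (altP (p =P ord0)) => [->|np]; first by rewrite bswap0 sblk0.
have [t e] := slotP np; have hp := sblk_lt p.
rewrite {1}e bswap_slot // sblk_slot //.
by case: ifP => // _; case: ifP => // _; lia.
Qed.

Section Combs.
Variables (K : fieldType) (L : lmodType K) (br : {ffun 'I_q.+1 -> L} -> L).
Hypothesis brP : is_LAnKe br.
Implicit Types f : 'I_m -> L.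

Definition slotw f : nat -> L := fun p => f (inord p).
Definition T f : L := comb br (slotw f) k.

Lemma slotw0 f : slotw f 0 = f ord0.
Proof. by rewrite /slotw; congr f; apply: val_inj; rewrite /= inordK. Qed.

Lemma blk_slotw f i t : blk q (slotw f) i t = f (slot i t).
Proof. by rewrite ffunE. Qed.

Lemma eq_comb f f' j : f ord0 = f' ord0 ->
  (forall i t, (i < j)%N -> f (slot i t) = f' (slot i t)) ->
  comb br (slotw f) j = comb br (slotw f') j.
Proof.
move=> h0 h; rewrite /comb !slotw0 h0; apply: eq_ads => i t.
by rewrite mem_iota add0n => /= hi; exact: h.
Qed.

Lemma eq_ads_slot f f' a i j :
  (forall i' t, (i <= i' < i + j)%N -> f (slot i' t) = f' (slot i' t)) ->
  ads br (slotw f) a (iota i j) = ads br (slotw f') a (iota i j).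
Proof. by move=> h; apply: eq_ads => i' t; rewrite mem_iota; exact: h. Qed.

Lemma T_tperm f x y : x != y -> sblk x = sblk y -> T (fun p => f (tperm x y p)) = - T f.
Proof.
move=> nxy exy; wlog ny : x y nxy exy / y != ord0.
  move=> W; case: (altP (y =P ord0)) => [y0|]; last exact: W.
  have e : T (fun p => f (tperm x y p)) = T (fun p => f (tperm y x p)) by rewrite tpermC.
  by rewrite e; apply: W; [rewrite eq_sym|rewrite exy|rewrite -y0].
have [t et] := slotP ny; set j := sblk y in exy et; have hj : (j < k)%N := sblk_lt y.
rewrite /T !(@comb_split _ _ _ _ _ k j hj).
have tail (a : L) : ads br (slotw (fun p => f (tperm x y p))) a (iota j.+1 (k - j.+1)) =
    ads br (slotw f) a (iota j.+1 (k - j.+1)).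
  apply: eq_ads_slot => i t' hi; congr f; rewrite tpermD //.
    by apply/eqP => e; move: exy; rewrite e sblk_slot; lia.
  by rewrite et slot_eq; [|lia|lia]; rewrite negb_and; apply/orP; left; lia.
rewrite tail -adsN //; congr (ads _ _ _ _).
case: (altP (x =P ord0)) => [x0|nx].
  have j0 : j = 0%N by rewrite -exy x0 sblk0.
  rewrite j0 /comb /= !slotw0 x0 tpermL.
  rewrite -[in RHS](upd_id (blk q (slotw f) 0) t) -adb_swap // blk_slotw -j0 -et; congr (adb br _ _).
  apply/ffunP => t'; rewrite upd_at !blk_slotw j0; case: (altP (t' =P t)) => [->|nt].
    by rewrite -j0 -et tpermR.
  by rewrite et j0 tpermD ?slot_neq0 // ?[ord0 == _]eq_sym ?slot_neq0 // slot_eq // eqxx /= eq_sym.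
have [s es] := slotP nx; rewrite exy in es.
have nst : s != t by apply: contraNneq nxy => e; rewrite es et e.
rewrite -(adb_tperm brP _ _ nst).
have -> : comb br (slotw (fun p => f (tperm x y p))) j = comb br (slotw f) j.
  apply: eq_comb => [|i t' hi]; congr f; rewrite tpermD //.
  by rewrite es slot_eq //; [|lia]; rewrite negb_and; apply/orP; left; lia.
  by rewrite et slot_eq //; [|lia]; rewrite negb_and; apply/orP; left; lia.
congr (adb br _ _); apply/ffunP => t'; rewrite !ffunE; congr f.
rewrite -!/(slot _ _) es et; case: tpermP => [/(slot_inj hj hj) [_ ->]|/(slot_inj hj hj) [_ ->]|].
- by rewrite tpermL.
- by rewrite tpermR.
move=> /eqP n1 /eqP n2; rewrite tpermD //.
  by apply: contraNneq n1 => ->.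
by apply: contraNneq n2 => ->.
Qed.

Lemma eq_T f f' : f =1 f' -> T f = T f'.
Proof. by move=> h; apply: eq_comb => // i t _. Qed.

(** A permutation that preserves the blocks is a product of transpositions
    inside blocks. *)
Lemma T_perm f (s : 'S_m) : (forall p, sblk (s p) = sblk p) ->
  T (fun p => f (s p)) = (-1) ^+ s *: T f.
Proof.
move: {2}(#|[set p | s p != p]|) (leqnn #|[set p | s p != p]|) => n.
elim: n s f => [|n IH] s f hn hs.
  have -> : s = 1%g.
    apply/permP => p; rewrite perm1; apply/eqP/negPn/negP => np.
    by move: hn; rewrite leqn0 cards_eq0 => /eqP /setP /(_ p); rewrite !inE np.
  by rewrite odd_perm1 expr0 scale1r; apply: eq_T => p; rewrite perm1.
case: (boolP [exists p, s p != p]) => [/existsP [p np]|]; last first.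
  rewrite negb_exists => /forallP h; apply: IH => //.
  rewrite (_ : [set _ | _] = set0) ?cards0 //; apply/setP => p; rewrite !inE.
  by apply/negbTE; exact: h.
pose s1 := (s * tperm p (s p))%g.
have s1E r : s1 r = tperm p (s p) (s r) by rewrite permM.
have es : s = (s1 * tperm p (s p))%g by rewrite /s1 -mulgA tperm2 mulg1.
have hs1 r : sblk (s1 r) = sblk r.
  by rewrite s1E; case: tpermP => [e|/perm_inj ->|_ _]; rewrite ?hs // -e hs.
have := T_tperm f (x := p) (y := s p); rewrite eq_sym => /(_ np (esym (hs p))) hT.
transitivity (T (fun r => (fun r' => f (tperm p (s p) r')) (s1 r))).
  by apply: eq_T => r; rewrite {1}es permM.
rewrite (IH s1 (fun r' => f (tperm p (s p) r'))) //; last first.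
  rewrite -ltnS; apply: leq_trans hn; apply: proper_card; apply/properP; split.
    apply/subsetP => r; rewrite !inE; apply: contra => /eqP e.
    rewrite s1E e tpermD //; last first.
      apply: contraNneq np => h; have pr : p = r by apply: (@perm_inj _ s); rewrite h e.
      by rewrite h pr.
    by apply: contraNneq np => ->; rewrite e.
  by exists p; rewrite inE ?np // s1E tpermR eqxx.
rewrite hT scalerN -scaleNr; congr (_ *: _).
by rewrite [in RHS]es odd_permM odd_tperm eq_sym np signr_addb expr1 mulrN1.
Qed.

Lemma T_exchange f i : (0 < i)%N -> (i.+1 < k)%N ->
  T f = T (fun p => f (bswap i p)) + (q%:R *: T f -
    \sum_(x | sblk x == i) \sum_(y | sblk y == i.+1) T (fun p => f (tperm x y p))).
Proof.
move=> i0 hi; have ik : (i < k)%N by lia.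
pose A := comb br (slotw f) i.
pose tl : {linear L -> L} := HB.pack (fun a => ads br (slotw f) a (iota i.+2 (k - i.+2)))
  (GRing.isLinear.Build _ _ _ _ _ (ads_linear brP (slotw f) (iota i.+2 (k - i.+2)))).
have Tsplit f' : f' ord0 = f ord0 -> 
    (forall j t, (j < k)%N -> j != i -> j != i.+1 -> f' (slot j t) = f (slot j t)) ->
    T f' = tl (adb br (adb br A (blk q (slotw f') i)) (blk q (slotw f') i.+1)).
  move=> h0 h; rewrite /T (comb_split2 _ _ hi).
  rewrite /tl (eq_ads_slot (f' := f)); last by move=> j t hj; apply: h; lia.
  congr (ads _ _ (adb _ (adb _ _ _) _) _); apply: eq_comb => // j t hj; apply: h; lia.
rewrite {1}(Tsplit f) // adb_exchange // !linearD linearN linearZ -(Tsplit f) //; congr (_ + (_ - _)).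
  rewrite (Tsplit (fun p => f (bswap i p))) ?bswap0 //.
    congr (tl (adb _ (adb _ _ _) _)); apply/ffunP => t; rewrite !blk_slotw bswap_slot //; try lia.
      by rewrite eqxx.
    by rewrite eqxx ifN //; lia.
  by move=> j t hj n1 n2; rewrite bswap_slot // (negbTE n1) (negbTE n2).
rewrite big_slot; last lia.
rewrite linear_sum; apply: eq_bigr => t _; rewrite big_slot; last lia.
rewrite linear_sum; apply: eq_bigr => l _.
rewrite (Tsplit (fun p => f (tperm (slot i t) (slot i.+1 l) p))).
- congr (tl (adb _ (adb _ _ _) _)); apply/ffunP => t'; rewrite upd_at !blk_slotw.
    case: (altP (t' =P t)) => [->|nt]; first by rewrite tpermL.
    by rewrite tpermD //; [apply: slot_neqt; rewrite 1?eq_sym|apply: slot_neq; lia].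
  case: (altP (t' =P l)) => [->|nt]; first by rewrite tpermR.
  by rewrite tpermD //; [apply: slot_neq; lia|apply: slot_neqt; rewrite 1?eq_sym].
- by rewrite tpermD // slot_neq0.
by move=> j t' hj n1 n2; rewrite tpermD //; apply: slot_neq; rewrite // eq_sym.
Qed.

Lemma T_first f : (1 < k)%N ->
  T f = T (fun p => f (bswap 0 p)) -
    \sum_(t < q) T (fun p => f (tperm ord0 (slot 0 t) (bswap 0 p))).
Proof.
move=> k1; pose tl : {linear L -> L} := HB.pack (fun a => ads br (slotw f) a (iota 2 (k - 2)))
  (GRing.isLinear.Build _ _ _ _ _ (ads_linear brP (slotw f) (iota 2 (k - 2)))).
have Tsplit f' :
    (forall j t, (j < k)%N -> (1 < j)%N -> f' (slot j t) = f (slot j t)) ->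
    T f' = tl (adb br (adb br (f' ord0) (blk q (slotw f') 0)) (blk q (slotw f') 1)).
  move=> h; rewrite /T (@comb_split2 _ _ _ _ _ _ 0) //.
  rewrite /tl (eq_ads_slot (f' := f)); last by move=> j t hj; apply: h; lia.
  by rewrite /comb /= slotw0.
rewrite {1}(Tsplit f) // adb_first // linearD linearN linear_sum; congr (_ - _).
  rewrite Tsplit; last by move=> j t hj h1; rewrite bswap_slot // !ifN //; lia.
  rewrite bswap0; congr (tl (adb _ (adb _ _ _) _)); apply/ffunP => t;
    by rewrite !blk_slotw bswap_slot.
apply: eq_bigr => t _; rewrite Tsplit; last first.
  move=> j t' hj h1; rewrite bswap_slot // !ifN; try lia.
  by rewrite tpermD // ?[ord0 == _]eq_sym ?slot_neq0 // slot_eq //; rewrite negb_and; apply/orP; left; lia.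
rewrite bswap0 tpermL blk_slotw; congr (tl (adb _ (adb _ _ _) _)); apply/ffunP => t';
  rewrite ?upd_at !blk_slotw bswap_slot //=.
  by rewrite tpermD // ?[ord0 == _]eq_sym ?slot_neq0 // slot_eq.
case: (altP (t' =P t)) => [->|nt]; first by rewrite tpermR.
by rewrite tpermD // ?[ord0 == _]eq_sym ?slot_neq0 // slot_eq // eq_sym.
Qed.

End Combs.
End Slots.

(** * From functions of permutations to functions of words *)

Section WordFun.
Variables (q k : nat).
Hypotheses (q0 : (0 < q)%N) (k0 : (0 < k)%N).
Notation m := (q * k).+1.
Variables (K : fieldType) (charK : [pchar K] =i pred0).

(** The a-th entry of la' - mu'. *)
Definition colsize (a : nat) : nat := ((a == 0%N) + q)%N.

Section U.
Variable U : 'S_m -> K.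
Let eps i : K := (-1) ^+ (@bswap q k q0 k0 i : 'S_m).
Hypothesis U_perm : forall s t : 'S_m, (forall p, sblk (s p) = sblk p) -> U (s * t)%g = U t.
Hypothesis U_exchange : forall i (t : 'S_m), (0 < i)%N -> (i.+1 < k)%N ->
  U t = eps i * U (bswap q0 k0 i * t)%g + (q%:R * U t +
    \sum_(x | sblk x == i) \sum_(y | sblk y == i.+1) U (tperm x y * t)%g).
Hypothesis U_first : forall t : 'S_m, (1 < k)%N ->
  U t = eps 0 * \sum_(x | sblk x == 0%N) U (bswap q0 k0 0 * (tperm ord0 x * t))%g.

Notation word := {ffun 'I_m -> 'I_k}.
Definition blko (p : 'I_m) : 'I_k := Ordinal (sblk_lt q0 k0 p).
Definition wordof (s : 'S_m) : word := [ffun x => blko ((s^-1)%g x)].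
Definition wfun (g : word) : K := if [pick s | wordof s == g] is Some s then U s else 0.

Lemma wfun_wordof s : wfun (wordof s) = U s.
Proof.
rewrite /wfun; case: pickP => [t /eqP e|/(_ s)]; last by rewrite eqxx.
have -> : t = ((t * s^-1) * s)%g by rewrite mulgKV.
apply: U_perm => p; rewrite permM.
have := congr1 (fun g : word => val (g (t p))) e.
by rewrite !ffunE /= permK.
Qed.

Lemma cnt_wordof (a : 'I_k) s : cnt a (wordof s) = colsize a.
Proof.
rewrite /cnt -sum1dep_card (reindex_inj (@perm_inj _ s)) /=.
under eq_bigl => p do rewrite ffunE permK -(inj_eq val_inj) /=.
have one : (\sum_(t < q) 1 = q)%N by rewrite sum1_card card_ord.
case: (posnP a) => a0.
  by rewrite a0 big_slot0 //= one.
by rewrite big_slot ?a0 ?ltn_ord //= one /colsize gtn_eqF.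
Qed.

Lemma wordofP g : (forall a, cnt a g = colsize a) -> exists s, wordof s = g.
Proof.
move=> h; have [|s _ e] := @eq_wcount_perm _ _ (fun=> 0%N) (wordof 1) g.
  move=> c a; case: c => [|c]; last by rewrite /wcount !eq_card0 // => x; rewrite !inE.
  rewrite -[wcount _ _ _ _]/(cnt a (wordof 1)) -[RHS]/(cnt a g).
  by rewrite cnt_wordof h.
exists (s^-1)%g; rewrite e; apply/ffunP => x; rewrite !ffunE invgK invg1 perm1 //.
Qed.

Lemma wfun_content g a : wfun g != 0 -> cnt a g = colsize a.
Proof.
by rewrite /wfun; case: pickP => [s /eqP <- _|_]; rewrite ?eqxx // cnt_wordof.
Qed.

Lemma wfun_eq0 (g : word) : ~~ [forall c, cnt c g == colsize c] -> forall h,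
  ((forall c, cnt c h = colsize c) -> forall c, cnt c g = colsize c) -> wfun h = 0.
Proof.
move=> nh h hh; apply/eqP/negPn/negP => hn; case/negP: nh; apply/forallP => c.
by rewrite (hh _ c) // => d; rewrite wfun_content.
Qed.

Lemma wfun_tperm (a b : 'I_k) s x y : a != b -> wordof s x = a -> wordof s y = b ->
  upd (upd (wordof s) x b) y a = wordof (tperm ((s^-1)%g x) ((s^-1)%g y) * s)%g.
Proof.
move=> nab hx hy; apply/ffunP => z; rewrite !upd_at [RHS]ffunE invMg permM tpermV.
case: (altP (z =P y)) => [->|ny]; first by rewrite tpermR -hx ffunE.
case: (altP (z =P x)) => [->|nx]; first by rewrite tpermL -hy ffunE.
by rewrite tpermD ?ffunE // (inj_eq perm_inj) eq_sym.
Qed.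

(** Read through words, the exchange relation of two blocks of size q says
    that lowering after raising is the identity minus a signed flip of the
    letters a and b. *)
Lemma wfun_raise2 (a b : 'I_k) g : b = a.+1 :> nat -> (0 < a)%N ->
  raise setT a b (raise setT a b wfun) g = 0.
Proof.
move=> ab a0; have nab : a != b by apply/eqP => e; move: ab; rewrite e; lia.
have ak : (a.+1 < k)%N by rewrite -ab.
have csz : colsize a = q /\ colsize b = q by rewrite /colsize ab; split; case: (val a) a0.
have w0 : weight a b 0 wfun.
  by move=> h hn; rewrite !(wfun_content _ hn) addn0; case: csz => -> ->.
have e2 : eps a * eps a = 1 by rewrite -expr2 sqrr_sign.
apply: (@spin_one K charK _ _ a b nab (eps a) e2 wfun w0) => {}g.
rewrite raise_fe //.
case: (boolP [forall c, cnt c g == colsize c]) => [/forallP h|nh]; last first.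
  have z := wfun_eq0 nh; rewrite (z g) // z ?big1 ?mulr0 ?subrr ?addr0 //.
    move=> x /eqP gx; rewrite big1 // => y /eqP gy; apply: z => H c; rewrite -H.
    have nyx : y != x by apply: contraNneq nab => e; rewrite -gx -e gy.
    have -> : upd (upd g x b) y a = permw g (tperm x y).
      apply/ffunP => w; rewrite !upd_at ffunE.
      case: (altP (w =P y)) => [->|ny]; first by rewrite tpermR.
      case: (altP (w =P x)) => [->|nx]; first by rewrite tpermL.
      by rewrite tpermD // eq_sym.
    rewrite /cnt -!sum1dep_card (reindex_inj (@perm_inj _ (tperm x y))) /=.
    by apply: eq_bigl => w; rewrite ffunE.
  move=> H c; have := H (tperm a b c); rewrite cnt_swapw tpermK => ->.
  by case: csz => ca cb; case: tpermP => [->|->|//]; rewrite ca cb.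
have [s es] := wordofP (fun c => eqP (h c)).
have hU := U_exchange s a0 ak.
rewrite -es wfun_wordof.
have -> : swapw a b (wordof s) = wordof (bswap q0 k0 a * s)%g.
  apply/ffunP => x; rewrite !ffunE invMg permM bswapV; apply: val_inj.
  rewrite /= sblk_bswap //; set p := (s^-1)%g x.
  case: (altP (p =P ord0)) => [->|np].
    rewrite tpermD /= ?sblk0 //; apply/eqP => /(congr1 val) /=; rewrite sblk0; lia.
  rewrite -ab; case: tpermP => [/(congr1 val) /= ->|/(congr1 val) /= ->|n1 n2] /=.
  - by rewrite eqxx.
  - by rewrite eqxx ifN //; lia.
  by rewrite !ifN //; apply/eqP => e; [apply: n2|apply: n1]; apply: val_inj.
rewrite wfun_wordof {2}hU [eps a * _ + _]addrC addrK.
rewrite cnt_wordof csz.2; congr (_ + _).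
rewrite (reindex_inj (@perm_inj _ s)) /=; apply: eq_big => [p|p].
  by rewrite ffunE permK -(inj_eq val_inj).
move=> /eqP hp; rewrite (reindex_inj (@perm_inj _ s)) /=; apply: eq_big => [r|r /eqP hr].
  by rewrite ffunE permK -(inj_eq val_inj) /= ab.
by rewrite wfun_tperm // !permK wfun_wordof.
Qed.

(** Read through words, the relation of the first two blocks says that u is,
    up to a sign, the raising of its own flip. *)
Lemma wfun_raise1 (a b : 'I_k) g : a = 0%N :> nat -> b = 1%N :> nat ->
  raise setT a b wfun g = 0.
Proof.
move=> a0 b1; have nab : a != b by apply/eqP => e; move: a0; rewrite e b1.
have k1 : (1 < k)%N by rewrite -b1.
have csz : colsize a = q.+1 /\ colsize b = q by rewrite /colsize a0 b1.
have w1 : weight a b 1 wfun.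
  by move=> h hn; rewrite !(wfun_content _ hn); case: csz => -> ->; rewrite addn1.
have e2 : eps 0 * eps 0 = 1 by rewrite -expr2 sqrr_sign.
apply: (@spin_half K charK _ _ a b nab (eps 0) e2 wfun w1) => {}g.
case: (boolP [forall c, cnt c g == colsize c]) => [/forallP h|nh]; last first.
  have z := wfun_eq0 nh; rewrite (z g) // big1 ?mulr0 // => x /eqP gx; apply: z => H c.
  have H' d : cnt d (upd g x b) = colsize (tperm a b d).
    by have := H (tperm a b d); rewrite cnt_swapw tpermK.
  case: csz => ca cb.
  case: (altP (c =P a)) => [->|na].
    by rewrite -(cnt_upd_old nab gx) H' tpermL ca cb.
  case: (altP (c =P b)) => [->|nb].
    by apply: succn_inj; rewrite -(cnt_upd_new nab gx) H' tpermR ca cb.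
  by rewrite -(@cnt_upd_other _ _ c b g x) ?gx // H' tpermD // eq_sym.
have [s es] := wordofP (fun c => eqP (h c)).
rewrite -es wfun_wordof U_first //; congr (_ * _).
rewrite [RHS](reindex_inj (@perm_inj _ s)) /=; apply: eq_big => [p|p /eqP hp].
  by rewrite ffunE permK -(inj_eq val_inj) /= a0.
rewrite -wfun_wordof; congr wfun; apply/ffunP => x.
rewrite !ffunE !invMg !permM bswapV tpermV -{2}[x](permKV s).
set r := (s^-1)%g x; apply: val_inj; rewrite /= sblk_bswap // (inj_eq perm_inj).
case: (altP (r =P p)) => [->|nrp].
  by rewrite tpermR tpermR eqxx a0.
case: (altP (tperm ord0 p r =P ord0)) => [e|ne].
  by case/eqP: nrp; rewrite -[r](tpermK ord0 p) e tpermL.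
have -> : sblk (tperm ord0 p r) = sblk r.
  by case: tpermP => [->|e|//]; [rewrite sblk0 hp|rewrite e eqxx in nrp].
case: tpermP => [/(congr1 val) /= ->|/(congr1 val) /= ->|n1 n2] /=.
- by rewrite a0 eqxx.
- by rewrite b1 /= a0.
rewrite !ifN //; apply/eqP => e; [apply: n2|apply: n1]; apply: val_inj => /=; rewrite ?a0 ?b1 //.
Qed.

End U.
End WordFun.

(** * Left combs span the multilinear component *)

Section Generation.
Variables (K : fieldType) (q : nat) (X : eqType).
Notation F := (freeLAnKe K q.+1 X).
Notation brk := (@fbr K q.+1 X).
Let brP : is_LAnKe brk := @fbr_is_LAnKe K q.+1 X.
Notation ad := (adb brk).

(** A left comb in the free algebra: its sequence of letters and its number
    of brackets. *)
Definition cdata : Type := (nat -> X) * nat.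
Definition cval (D : cdata) : F := comb brk (fun p => fgen K q.+1 (D.1 p)) D.2.
Definition cocc (D : cdata) (x : X) : nat := (\sum_(p < (q * D.2).+1) (D.1 p == x))%N.

Inductive cspan (o : X -> nat) : F -> Prop :=
| cspan0 : cspan o 0
| cspanD (a : K) D v : cocc D =1 o -> cspan o v -> cspan o (a *: cval D + v).

Lemma cspan_add o u v : cspan o u -> cspan o v -> cspan o (u + v).
Proof.
by move=> hu hv; elim: hu => [|a D w hD _ IH]; rewrite ?add0r // -addrA; apply: cspanD.
Qed.

Lemma cspan_scale o (a : K) u : cspan o u -> cspan o (a *: u).
Proof.
elim=> [|b D w hD _ IH]; first by rewrite scaler0; exact: cspan0.
by rewrite scalerDr scalerA; apply: cspanD.
Qed.

Lemma cspan_opp o u : cspan o u -> cspan o (- u).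
Proof. by rewrite -scaleN1r; exact: cspan_scale. Qed.

Lemma cspan_sum o (I : finType) (G : I -> F) : (forall i, cspan o (G i)) -> cspan o (\sum_i G i).
Proof. by move=> h; apply: big_ind => [|u v|i _]; [exact: cspan0|exact: cspan_add|exact: h]. Qed.

Lemma cspan_cval D o : cocc D =1 o -> cspan o (cval D).
Proof.
by move=> h; rewrite -[cval D]scale1r -[X in cspan _ X]addr0; apply: cspanD => //; exact: cspan0.
Qed.

Lemma cspan_ext o o' u : o =1 o' -> cspan o u -> cspan o' u.
Proof.
move=> e; elim=> [|a D w hD _ IH]; first exact: cspan0.
by apply: cspanD => // x; rewrite hD e.
Qed.

Definition cgen (x : X) : cdata := (fun=> x, 0%N).

Lemma cval_gen x : cval (cgen x) = fgen K q.+1 x. Proof. by []. Qed.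
Lemma cocc_gen x y : cocc (cgen x) y = (x == y).
Proof.
rewrite /cocc /= (eq_bigr (fun=> nat_of_bool (x == y))) // sum_nat_const card_ord.
by rewrite muln0 mul1n.
Qed.

Lemma cvalS z j : cval (z, j.+1) =
  ad (cval (z, j)) [ffun l : 'I_q => cval (cgen (z (j * q + l).+1))].
Proof.
by rewrite /cval /= /comb -[j.+1]addn1 iotaD /ads foldl_cat /= add0n; congr (adb _ _ _).
Qed.

Lemma coccS z j x : cocc (z, j.+1) x =
  (cocc (z, j) x + \sum_(l < q) cocc (cgen (z (j * q + l).+1)) x)%N.
Proof.
rewrite /cocc /=.
rewrite -(big_mkord xpredT (fun p => nat_of_bool (z p == x))).
rewrite -(big_mkord xpredT (fun p => nat_of_bool (z p == x))).
rewrite (@big_cat_nat _ _ _ (q * j).+1) //=; last by rewrite mulnS; lia.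
congr (_ + _)%N; rewrite -{1}[(q * j).+1]add0n big_addn.
rewrite (_ : ((q * j.+1).+1 - (q * j).+1 = q)%N); last by rewrite mulnS; lia.
rewrite big_mkord; apply: eq_bigr => l _; rewrite muln0 big_ord1.
by congr (nat_of_bool (z _ == x)); lia.
Qed.

Lemma cval_app D (y : 'I_q -> X) : exists D',
  cval D' = ad (cval D) [ffun t => cval (cgen (y t))] /\
  forall x, cocc D' x = (cocc D x + \sum_(t < q) cocc (cgen (y t)) x)%N.
Proof.
case: D => z j.
pose z' p := if (p <= j * q)%N then z p else
  if insub (p - (j * q).+1)%N is Some t then y t else z p.
have z'l (l : 'I_q) : z' (j * q + l).+1 = y l.
  rewrite /z' ifN; last lia.
  by rewrite (_ : (_ - _)%N = l) ?valK //; lia.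
have cv : cval (z', j) = cval (z, j).
  rewrite /cval /comb /= /z' leq0n; apply: eq_ads => i t; rewrite mem_iota add0n => /= hi.
  by rewrite ifT //; have := ltn_ord t; nia.
exists (z', j.+1); split.
  rewrite cvalS cv; congr (adb _ _ _); apply/ffunP => l; rewrite !ffunE z'l //.
move=> x; rewrite coccS; congr (_ + _)%N.
  by rewrite /cocc /=; apply: eq_bigr => p _; rewrite /z' ifT //; have := ltn_ord p; nia.
by apply: eq_bigr => l _; rewrite z'l.
Qed.

Definition cvals (y : {ffun 'I_q -> cdata}) : {ffun 'I_q -> F} := [ffun t => cval (y t)].
Definition coccs (y : {ffun 'I_q -> cdata}) x := (\sum_(t < q) cocc (y t) x)%N.

Definition csize (y : {ffun 'I_q -> cdata}) : nat := (\sum_(t < q) (y t).2)%N.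

Lemma cvals_upd y t D : cvals (upd y t D) = upd (cvals y) t (cval D).
Proof. by apply/ffunP => s; rewrite !ffunE; case: (s == t). Qed.

Lemma sum_upd (G : cdata -> nat) (y : {ffun 'I_q -> cdata}) t D :
  (\sum_(s < q) G (upd y t D s) + G (y t) = \sum_(s < q) G (y s) + G D)%N.
Proof.
rewrite (bigD1 t) //= upd_at eqxx [X in _ = (X + _)%N](bigD1 t) //=.
rewrite (eq_bigr (fun s => G (y s))); last by move=> s /negbTE h; rewrite upd_at h.
by rewrite [LHS]addnC -[RHS]addnA; congr (_ + _)%N; exact: addnC.
Qed.

Lemma csize_upd y t D : (csize (upd y t D) + (y t).2 = csize y + D.2)%N.
Proof. exact: (sum_upd snd). Qed.

Lemma coccs_upd y t D x : (coccs (upd y t D) x + cocc (y t) x = coccs y x + cocc D x)%N.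
Proof. exact: (sum_upd (cocc^~ x)). Qed.

Lemma cspan_ad_gens o u (y : 'I_q -> X) : cspan o u ->
  cspan (fun x => o x + \sum_(t < q) cocc (cgen (y t)) x)%N (ad u [ffun t => cval (cgen (y t))]).
Proof.
elim=> [|a D v hD _ IH]; first by rewrite adb0 //; exact: cspan0.
rewrite adbP //; apply: cspan_add => //; apply: cspan_scale.
have [D' [<- h]] := cval_app D y.
by apply: cspan_cval => x; rewrite h hD.
Qed.

(** Induction on the number of brackets in the arguments: an argument [c,
    d_1, ..., d_q] is opened by [adb_nested], in which every term has fewer
    brackets in the arguments that remain to be absorbed. *)
Lemma cspan_ad_cvals o u (y : {ffun 'I_q -> cdata}) : cspan o u ->
  cspan (fun x => o x + coccs y x)%N (ad u (cvals y)).
Proof.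
move: {2}(csize y) (leqnn (csize y)) => N.
elim: N o u y => [|N IH] o u y hN hu.
  have y0 t : (y t).2 = 0%N.
    by apply/eqP; rewrite -leqn0; apply: leq_trans hN; rewrite /csize (bigD1 t) //= leq_addr.
  have -> : cvals y = [ffun t => cval (cgen ((y t).1 0%N))].
    apply/ffunP => t; rewrite !ffunE /cval y0 //.
  apply: cspan_ext (cspan_ad_gens _ hu) => x; congr (_ + _)%N.
  apply: eq_bigr => t _; rewrite cocc_gen /cocc y0 muln0 big_ord1 //.
case: (boolP [exists t, (y t).2 != 0%N]) => [/existsP [t0 ht0]|]; last first.
  rewrite negb_exists => /forallP h; apply: IH => //.
  by rewrite /csize big1 // => t _; apply/eqP; have := h t; rewrite negbK.
case ey : (y t0) ht0 => [z [|j]] //= _.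
pose d : {ffun 'I_q -> cdata} := [ffun l : 'I_q => cgen (z (j * q + l).+1)].
have d0 : csize d = 0%N by rewrite /csize big1 // => t _; rewrite ffunE.
have dE : [ffun l : 'I_q => cval (cgen (z (j * q + l).+1))] = cvals d.
  by apply/ffunP => l; rewrite !ffunE.
have -> : cvals y = upd (cvals y) t0 (ad (cval (z, j)) (cvals d)).
  by rewrite -dE -cvalS -ey -[in LHS](upd_id y t0) cvals_upd.
have oy x : (cocc (z, j) x + coccs d x = cocc (y t0) x)%N.
  rewrite ey coccS; congr (_ + _)%N; apply: eq_bigr => l _; by rewrite ffunE.
rewrite adb_nested //; apply: cspan_add.
  rewrite -cvals_upd.
  have s1 := csize_upd y t0 (z, j); rewrite ey /= in s1.
  have h1 := IH o u (upd y t0 (z, j)) ltac:(lia) hu.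
  have h2 := IH _ _ d ltac:(lia) h1.
  apply: cspan_ext h2 => x; have := oy x; have := coccs_upd y t0 (z, j) x.
  by lia.
apply: cspan_opp; apply: cspan_sum => l.
rewrite [cvals d l]ffunE -!cvals_upd.
have s1 := csize_upd y t0 (d l); rewrite ey /= in s1.
have s2 := csize_upd d l (z, j); rewrite /= in s2.
have dl0 : (d l).2 = 0%N by rewrite ffunE.
have h1 := IH o u (upd y t0 (d l)) ltac:(lia) hu.
have h2 := IH _ _ (upd d l (z, j)) ltac:(lia) h1.
apply: cspan_ext h2 => x; have := oy x; have := coccs_upd y t0 (d l) x.
have := coccs_upd d l (z, j) x.
by lia.
Qed.

(** The positions in S hold arbitrary elements of the span; they are
    expanded one at a time into single combs. *)
Lemma cspan_ad (S : {set 'I_q}) o u (oy : 'I_q -> X -> nat) (y : {ffun 'I_q -> F}) :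
  cspan o u -> (forall t, cspan (oy t) (y t)) ->
  (forall t, t \notin S -> exists D, y t = cval D /\ cocc D =1 oy t) ->
  cspan (fun x => o x + \sum_(t < q) oy t x)%N (ad u y).
Proof.
move: {2}#|S| (erefl #|S|) => N; elim: N S y => [|N IH] S y hN hu hy hS.
  have /fin_all_exists [D hD] : forall t, exists D, y t = cval D /\ cocc D =1 oy t.
    by move=> t; apply: hS; rewrite (cards0_eq hN) inE.
  have -> : y = cvals [ffun t => D t].
    by apply/ffunP => t; rewrite !ffunE; have [] := hD t.
  apply: cspan_ext (cspan_ad_cvals _ hu) => x; congr (_ + _)%N.
  by apply: eq_bigr => t _; rewrite ffunE; have [_ ->] := hD t.
have [t0 ht0] : exists t, t \in S by apply/set0Pn; rewrite -card_gt0 hN.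
have cS : #|S :\ t0| = N by have := cardsD1 t0 S; rewrite ht0 hN; lia.
rewrite -[y](upd_id y t0); elim: (hy t0) => [|a D v hD hv IHv].
  have -> : ad u (upd y t0 0) = 0.
    apply: (@addrI _ (ad u (upd y t0 0))).
    by have := adbPr brP 1 u y t0 0 0; rewrite !scale1r !addr0 => <-.
  exact: cspan0.
rewrite adbPr //; apply: cspan_add => //; apply: cspan_scale.
apply: (IH (S :\ t0)) => // [t|t]; rewrite upd_at; case: (altP (t =P t0)) => [->|nt] //.
- exact: cspan_cval.
- by move=> _; exists D.
by rewrite !inE nt /=; exact: hS.
Qed.

Lemma cspan_word (w : bword q.+1 X) : cspan (fun x => wocc x w) (wval K w).
Proof.
(* The arguments of a bracket form a finite function, through which the
   automatic induction principle does not pass. *)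
move: w; fix IH 1; case=> [x|f] /=.
  rewrite -cval_gen; apply: cspan_cval => y; exact: cocc_gen.
have h (i : 'I_q.+1) : cspan (fun x => wocc x (f i)) (wval K (f i)) := IH (f i).
clear IH.
have -> : fbr [ffun i => wval K (f i)] =
    ad (wval K (f ord0)) [ffun t => wval K (f (lift ord0 t))].
  congr fbr; apply/ffunP => i; rewrite !ffunE.
  by case: unliftP => [t ->|->]; rewrite ?ffunE.
apply: cspan_ext (@cspan_ad setT _ _ (fun t x => wocc x (f (lift ord0 t))) _ (h ord0) _ _).
- by move=> x; rewrite big_ord_recl.
- by move=> t; rewrite ffunE; exact: h.
by move=> t; rewrite inE.
Qed.

Definition wcomb (z : nat -> X) (j : nat) : bword q.+1 X :=
  foldl (fun w i => WBr [ffun i' : 'I_q.+1 =>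
    if unlift ord0 i' is Some t then WGen q.+1 (z (i * q + t).+1) else w])
    (WGen q.+1 (z 0%N)) (iota 0 j).

Lemma wcombS z j : wcomb z j.+1 = WBr [ffun i' : 'I_q.+1 =>
    if unlift ord0 i' is Some t then WGen q.+1 (z (j * q + t).+1) else wcomb z j].
Proof. by rewrite /wcomb -[j.+1]addn1 iotaD foldl_cat /= add0n. Qed.

Lemma wval_comb z j : wval K (wcomb z j) = cval (z, j).
Proof.
elim: j => // j IH; rewrite wcombS cvalS -IH /=; congr fbr; apply/ffunP => i.
by case: (unliftP ord0 i) => [t ->|->]; rewrite !ffunE ?liftK ?unlift_none ?ffunE.
Qed.

Lemma wocc_comb z j x : wocc x (wcomb z j) = cocc (z, j) x.
Proof.
elim: j => [|j IH]; first by rewrite /cocc muln0 big_ord1.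
rewrite wcombS coccS -IH /= big_ord_recl ffunE unlift_none; congr (_ + _)%N.
by apply: eq_bigr => t _; rewrite ffunE liftK cocc_gen.
Qed.

End Generation.

Lemma wrelabel_comb q (X Y : eqType) (s : X -> Y) (z : nat -> X) j :
  wrelabel s (@wcomb q X z j) = wcomb q (fun p => s (z p)) j.
Proof.
elim: j => // j IH; rewrite !wcombS -IH /=; congr WBr; apply/ffunP => i.
by rewrite !ffunE; case: (unlift ord0 i).
Qed.

Section Multilinear.
Variables (K : fieldType) (q k : nat).
Hypotheses (q0 : (0 < q)%N) (k0 : (0 < k)%N).
Notation m := (q * k).+1.
Notation F := (freeLAnKe K q.+1 'I_m).

Definition gens (s : 'S_m) : 'I_m -> F := fun p => fgen K q.+1 (s p).
Definition combperm (s : 'S_m) : F := T (@fbr K q.+1 'I_m) (gens s).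
Definition wperm (s : 'S_m) : bword q.+1 'I_m := wcomb q (fun p => s (inord p)) k.

Lemma wval_wperm s : wval K (wperm s) = combperm s.
Proof. exact: wval_comb. Qed.

Lemma wrelabel_wperm (s t : 'S_m) : wrelabel t (wperm s) = wperm (s * t)%g.
Proof.
rewrite /wperm wrelabel_comb; congr wcomb; apply/funext => p.
by rewrite permM.
Qed.

Lemma sum_cocc D : (\sum_(x : 'I_m) cocc q D x = (q * D.2).+1)%N.
Proof.
rewrite exchange_big /= (eq_bigr (fun=> 1%N)) ?sum1_card ?card_ord // => p _.
rewrite (bigD1 (D.1 p)) //= eqxx big1 // => x /negbTE.
by rewrite eq_sym => ->.
Qed.

Lemma wperm_multilinear s : multilinear_word (wperm s).
Proof.
move=> x; rewrite /wperm wocc_comb /cocc /=.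
rewrite (bigD1 ((s^-1)%g x)) //= inord_val permKV eqxx big1 // => p np.
by rewrite inord_val; case: (s p =P x) => // e; rewrite -e permK eqxx in np.
Qed.

Lemma cval_one (D : cdata 'I_m) : cocc q D =1 (fun=> 1%N) ->
  exists s, cval K q D = combperm s.
Proof.
case: D => z j h.
have ej : j = k.
  have := sum_cocc (z, j); rewrite (eq_bigr (fun=> 1%N)) ?sum1_card ?card_ord /= => [e|x _]; last exact: h.
  by case: e => /eqP; rewrite eqn_pmul2l // => /eqP.
subst j; have inj : injective (fun p : 'I_m => z p).
  move=> p p' e; apply/eqP/negPn/negP => np; have := h (z p).
  by rewrite /cocc /= (bigD1 p) //= eqxx (bigD1 p') 1?eq_sym //= -e eqxx.
exists (perm inj).
have hz p : (p < m)%N -> slotw (gens (perm inj)) p = fgen K q.+1 (z p).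
  by move=> hp; rewrite /slotw /gens permE /= inordK.
rewrite /cval /combperm /T /comb hz //=; apply: eq_ads => i t.
by rewrite mem_iota add0n => /= hi; rewrite hz //; have := ltn_ord t; nia.
Qed.

Lemma cspan_combperm (P : F -> Prop) :
  P 0 -> (forall a s v, P v -> P (a *: combperm s + v)) ->
  forall x : F, cspan (fun=> 1%N) x -> P x.
Proof.
move=> P0 PD x; elim=> // a D v hD _ Pv.
by have [s ->] := cval_one hD; apply: PD.
Qed.

Lemma Lie_comp_combperm (P : F -> Prop) :
  P 0 -> (forall a s v, P v -> P (a *: combperm s + v)) ->
  forall x : F, Lie_comp x -> P x.
Proof.
move=> P0 PD x [N [a [w [hw ->]]]]; apply: cspan_combperm => //.
apply: cspan_sum => i; apply: cspan_scale; apply: cspan_ext (cspan_word K (w i)) => y.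
exact: hw.
Qed.

Lemma Lie_comp_wval w : multilinear_word w -> Lie_comp (wval K w : F).
Proof.
by move=> hw; exists 1%N, (fun=> 1), (fun=> w); split=> //; rewrite big_ord1 scale1r.
Qed.

End Multilinear.

(** * From Littlewood-Richardson words to 0-1 matrices *)

(** A, B and C are the column lengths of three consecutive diagrams of a
    chain with vertical strips as steps. The hypothesis says that the second
    strip, column by column, stays behind the first one; the conclusion
    counts the boxes of both strips from the row p on. *)
Lemma suffix_le (A B C : nat -> nat) (p k : nat) :
  (forall i, (A i <= B i <= C i)%N) ->
  (forall i, (i.+1 < k)%N -> (B i.+1 <= A i)%N) ->
  (forall i, (i.+1 < k)%N -> (C i.+1 <= B i)%N) ->
  (forall i, (i < k)%N -> (\sum_(i' < i.+1) (C i' - B i') <= \sum_(i' < i) (B i' - A i'))%N) ->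
  (\sum_(i < k) (maxn (C i) p - maxn (B i) p) <= \sum_(i < k) (maxn (B i) p - maxn (A i) p))%N.
Proof.
move=> le BA CB ss.
have Cdec i j : (i <= j)%N -> (j < k)%N -> (C j <= C i)%N.
  elim: j => [|j IH]; first by rewrite leqn0 => /eqP ->.
  rewrite leq_eqVlt => /orP [/eqP -> //|h1] h2; apply: leq_trans (IH h1 (ltnW h2)).
  by have := CB j h2; have := le j; lia.
pose S (f : nat -> nat) n := (\sum_(i' < n) f i')%N.
have SS f n : S f n.+1 = (S f n + f n)%N by rewrite /S big_ord_recr.
have S0 f : S f 0%N = 0%N by rewrite /S big_ord0.
have ext f f' n : (forall i, (i < n)%N -> f i = f' i) -> S f n = S f' n.
  by move=> h; apply: eq_bigr => i _; exact: h.
pose cb i := (C i - B i)%N; pose ba i := (B i - A i)%N.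
pose cbp i := (maxn (C i) p - maxn (B i) p)%N; pose bap i := (maxn (B i) p - maxn (A i) p)%N.
have ss' i : (i < k)%N -> (S cb i.+1 <= S ba i)%N by exact: ss.
suff H i : (i <= k)%N -> (S cbp i <= S bap i)%N by exact: H.
clearbody S.
elim: i => [|i IH] hi; first by rewrite !S0.
(* If the column i of C is longer than p, then the boxes added in the
   columns before it all lie in the rows from p on, and the truncations by
   p can be dropped there. *)
case: (leqP (C i) p) => hC.
  rewrite !SS leq_add ?IH ?(ltnW hi) // /cbp /bap.
  by have := le i; lia.
have full : S cbp i = S cb i.
  apply: ext => i' hi'; have h : (B i' > p)%N.
    by have := CB i' ltac:(lia); have := Cdec i'.+1 i hi' hi; lia.
  by have := le i'; rewrite /cbp /cb; lia.
have ss1 := ss' i hi; rewrite SS in ss1.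
rewrite SS full [X in (_ <= X)%N]SS.
case: i IH hi hC full ss1 => [|i] IH hi hC full ss1.
  by move: ss1; rewrite !S0 /cb /cbp; have := le 0%N; lia.
have ss0 := ss' i (ltnW hi).
have full2 : S bap i = S ba i.
  apply: ext => i' hi'; have h : (A i' > p)%N.
    have := BA i' ltac:(lia); have := CB i'.+1 ltac:(lia).
    by have := Cdec i'.+2 i.+1 ltac:(lia) hi; lia.
  by have := le i'; rewrite /bap /ba; lia.
rewrite [X in (_ <= X + _)%N]SS full2; rewrite [X in (_ <= X)%N]SS in ss1.
have l1 := le i; have l2 := le i.+1; have b1 := BA i hi; have c1 := CB i hi.
move: ss0 ss1; rewrite /cb /cbp /ba /bap; case: (leqP p (A i)) => hA; lia.
Qed.

Section Count.
Variables (q k : nat).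
Hypotheses (q0 : (0 < q)%N) (k1 : (1 < k)%N).
Notation m := (q * k).+1.
Variables (N : nat) (nu : seq nat) (col : 'I_m -> nat).
Let l := head 0%N nu.
Hypothesis nus : sorted geq nu.
Hypothesis Nbig : (q + k.-1 <= N)%N.
Hypothesis col_lt : forall x, (col x < l)%N.
Hypothesis colE : forall c, (c < l)%N -> #|[set x | col x == c]| = conjp nu c.
Notation word := {ffun 'I_m -> 'I_k}.
Implicit Types g : word.

(** The i-th part of mu'. *)
Definition mucol (i : nat) : nat := minn (k - 2) (k.-1 - i).
(** The difference of the parts i and i+1 of mu', for i+1 < k. *)
Definition lowt (i : nat) : nat := i != 0%N.

(** The length of the column i of the diagram reached before the step c. *)
Definition kap g (c i : nat) : nat :=
  (mucol i + #|[set x | (col x < c)%N && (g x == i :> nat)]|)%N.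

Definition wmat g : bmat N l :=
  mkb (fun j c => [exists i : 'I_k, (kap g c i <= j < kap g c.+1 i)%N]).

Section Word.
Variable g : word.
Hypothesis gP : lrword col lowt (colsize q) g.

Lemma kapS c i : kap g c.+1 i = (kap g c i + #|[set x | (col x == c) && (g x == i :> nat)]|)%N.
Proof. by rewrite /kap card_colS addnA. Qed.

(** The lattice condition for g says exactly that the steps of the chain are
    vertical strips. *)
Lemma kap_interlace c i : (i.+1 < k)%N -> (kap g c.+1 i.+1 <= kap g c i)%N.
Proof.
move=> hi; have [_ h _] := gP.
have h' : (#|[set x | (col x < c.+1)%N && (g x == i.+1 :> nat)]| <=
    lowt i + #|[set x | (col x < c)%N && (g x == i :> nat)]|)%N.
  exact: (h (Ordinal (ltnW hi)) (Ordinal hi) c (erefl _)).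
by move: h'; rewrite /kap /mucol /lowt; lia.
Qed.

Lemma kap_dec c i i' : (i <= i')%N -> (i' < k)%N -> (kap g c i' <= kap g c i)%N.
Proof.
elim: i' => [|i' IH]; first by rewrite leqn0 => /eqP ->.
rewrite leq_eqVlt => /orP [/eqP -> //|h1] h2; apply: leq_trans (IH h1 (ltnW h2)).
by apply: leq_trans (kap_interlace c h2); rewrite kapS leq_addr.
Qed.

Lemma kap_final i : (i < k)%N -> kap g l i = (q + k.-1 - i)%N.
Proof.
move=> hi; have [h _ _] := gP; have := h (Ordinal hi); rewrite /kap /colsize /mucol /=.
rewrite (eq_card (B := [set x | (col x < l)%N && (g x == i :> nat)])); last first.
  by move=> x; rewrite !inE col_lt.
by move=> ->; case: i hi => [|i] hi /=; lia.
Qed.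

Lemma kap_mono c c' i : (c <= c')%N -> (kap g c i <= kap g c' i)%N.
Proof. by move=> h; rewrite -(subnKC h); elim: (c' - c)%N => [|x IH]; rewrite ?addn0 // addnS kapS; lia. Qed.

Lemma kap_le c i : (c <= l)%N -> (i < k)%N -> (kap g c i <= N)%N.
Proof. by move=> hc hi; apply: leq_trans (kap_mono i hc) _; rewrite kap_final //; lia. Qed.

Let inside c j (i : 'I_k) := (kap g c i <= j < kap g c.+1 i)%N.

Let inside_uniq c j i i' : inside c j i -> inside c j i' -> i = i'.
Proof.
move=> h h'; apply: val_inj; case: (ltngtP i i') => // lt; exfalso.
  have := kap_dec c.+1 lt (ltn_ord i'); have := @kap_interlace c i.
  by have := ltn_ord i'; move: h h'; rewrite /inside; lia.
have := kap_dec c.+1 lt (ltn_ord i); have := @kap_interlace c i'.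
by have := ltn_ord i; move: h h'; rewrite /inside; lia.
Qed.

Lemma ent_wmat j c : (j < N)%N -> (c < l)%N ->
  ent (wmat g) j c = (\sum_(i < k) inside c j i)%N :> nat.
Proof.
move=> hj hc; rewrite ent_mk hj hc /=; case: existsP => [[i hi]|h].
  rewrite (bigD1 i) //= big1 ?addn0; first by rewrite [inside _ _ _]hi.
  by move=> i' ni; case: (boolP (inside c j i')) => // h'; case/eqP: ni; exact: inside_uniq h' hi.
by rewrite big1 // => i _; case: (boolP (inside c j i)) => // hi; case: h; exists i.
Qed.

(** The lengths of the rows of the diagrams, counted through their columns. *)
Lemma psum_wmat (mu : nat -> nat) c j : (c <= l)%N -> (j < N)%N ->
  mu j = (\sum_(i < k) (j < mucol i))%N ->
  psum mu (wmat g) c j = (\sum_(i < k) (j < kap g c i))%N.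
Proof.
move=> hc hj hmu; elim: c hc => [|c IH] hc.
  rewrite /psum big_geq // addn0 hmu; apply: eq_bigr => i _; congr (nat_of_bool (_ < _)%N).
  by rewrite /kap (_ : #|_| = 0%N) ?addn0 //; apply: eq_card0 => x; rewrite !inE.
rewrite psumS IH ?(ltnW hc) // ent_wmat // -big_split /=; apply: eq_bigr => i _.
have := kap_mono i (leqnSn c); rewrite /inside; lia.
Qed.

Lemma sum_interval p a b : (a <= b)%N -> (b <= N)%N -> (p <= N)%N ->
  (\sum_(p <= j < N) (a <= j < b) = maxn b p - maxn a p)%N.
Proof.
move=> ab bN pN; case: (leqP b p) => hbp.
  rewrite big_nat big1 => [|j hj]; first by lia.
  by rewrite (_ : (_ && _) = false) //; lia.
rewrite (@big_cat_nat _ _ _ (maxn a p)) /=; [|lia|lia].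
rewrite big_nat big1 ?add0n; last by move=> j hj; rewrite (_ : (_ && _) = false) //; lia.
rewrite (@big_cat_nat _ _ _ b) /=; [|lia|lia].
rewrite [X in (_ + X)%N]big_nat [X in (_ + X)%N]big1 ?addn0; last first.
  by move=> j hj; rewrite (_ : (_ && _) = false) //; lia.
rewrite (eq_big_nat _ _ (F2 := fun=> 1%N)); last by move=> j hj; rewrite (_ : (_ && _)) //; lia.
by rewrite sum_nat_const_nat muln1.
Qed.

Lemma sum_wmat p c : (p <= N)%N -> (c < l)%N ->
  (\sum_(p <= j < N) ent (wmat g) j c =
   \sum_(i < k) (maxn (kap g c.+1 i) p - maxn (kap g c i) p))%N.
Proof.
move=> hp hc; rewrite (eq_big_nat _ _ (F2 := fun j => (\sum_(i < k) inside c j i)%N)).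
  rewrite exchange_big /=; apply: eq_bigr => i _; rewrite sum_interval //; last exact: kap_le.
  exact: kap_mono.
by move=> j hj; rewrite ent_wmat //; lia.
Qed.

Lemma mu_mucol j : nth 0%N (LAnKe_mu k) j = (\sum_(i < k) (j < mucol i))%N.
Proof.
rewrite /LAnKe_mu; case: (ltnP j (k - 2)) => hj.
  rewrite nth_rev ?size_iota // nth_iota; last lia.
  have h : (k.-1 - j <= k)%N by lia.
  rewrite (eq_bigr (fun i : 'I_k => nat_of_bool (i < k.-1 - j)%N)); last first.
    by move=> i _; congr nat_of_bool; rewrite /mucol; lia.
  by rewrite -big_mkcond /= (big_ord_narrow h) sum1_card card_ord; lia.
rewrite nth_default ?size_rev ?size_iota // big1 // => i _.
by rewrite (_ : (_ < _)%N = false) // /mucol; lia.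
Qed.

Lemma la_lacol j : nth 0%N (LAnKe_la q.+1 k) j = (\sum_(i < k) (j < q + k.-1 - i))%N.
Proof.
rewrite /LAnKe_la nth_cat size_nseq nth_nseq /=; case: (ltnP j q) => hj.
  rewrite (eq_bigr (fun=> 1%N)) ?sum1_card ?card_ord // => i _.
  by rewrite (_ : (_ < _)%N) //; have := ltn_ord i; lia.
case: (ltnP (j - q) k.-1) => hj2.
  rewrite nth_rev ?size_iota // nth_iota; last lia.
  have h : (q + k.-1 - j <= k)%N by lia.
  rewrite (eq_bigr (fun i : 'I_k => nat_of_bool (i < q + k.-1 - j)%N)); last first.
    by move=> i _; congr nat_of_bool; lia.
  by rewrite -big_mkcond /= (big_ord_narrow h) sum1_card card_ord; lia.
rewrite nth_default ?size_rev ?size_iota // big1 // => i _.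
by rewrite (_ : (_ < _)%N = false) //; lia.
Qed.

(** The vertical strips come from the lattice condition on g and the suffix
    condition from its row-strictness; the chain ends at la because g has
    content la' - mu'. *)
Lemma wmat_LRmat : LRmat (nth 0%N (LAnKe_mu k)) (conjp nu) (wmat g) &&
  [forall j : 'I_N, (nth 0 (LAnKe_mu k) j + rowsum (wmat g) j == nth 0 (LAnKe_la q.+1 k) j)%N].
Proof.
have ps c j : (c <= l)%N -> (j < N)%N ->
    psum (nth 0%N (LAnKe_mu k)) (wmat g) c j = (\sum_(i < k) (j < kap g c i))%N.
  by move=> hc hj; apply: psum_wmat => //; exact: mu_mucol.
apply/andP; split; last first.
  apply/forallP => j; rewrite -[(_ + _)%N]psum_all ps // la_lacol; apply/eqP.
  by apply: eq_bigr => i _; rewrite kap_final.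
apply/and3P; split.
- apply/always_dominantP => c j hc hj; rewrite !ps ?(ltnW hj) //.
  by apply: leq_sum => i _; case: (ltnP j.+1 (kap g c i)) => //= h; rewrite (_ : (_ < _)%N) //; lia.
- apply/always_dominantP => t c ht hc; rewrite /suffix !sum_wmat ?leq_subr //; last exact: ltnW.
  apply: suffix_le.
  + by move=> i; rewrite !kap_mono.
  + by move=> i; exact: kap_interlace.
  + by move=> i; exact: kap_interlace.
  move=> i hi; have [_ _ ss] := gP; have := ss c (Ordinal hi) => /=.
  have cardE c' (i' : nat) : (i' <= k)%N -> #|[set x | (col x == c') && (g x < i')%N]| =
      (\sum_(j < i') (kap g c'.+1 j - kap g c' j))%N.
    elim: i' => [|i' IH] hi'; first by rewrite big_ord0; apply: eq_card0 => x; rewrite !inE andbF.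
    rewrite big_ord_recr /= -IH ?(ltnW hi') // kapS addKn -cardsUI.
    rewrite [X in (_ = _ + X)%N](_ : _ = 0%N) ?addn0.
      by apply: eq_card => x; rewrite !inE -andb_orr ltnS leq_eqVlt orbC.
    apply/eqP; rewrite cards_eq0; apply/eqP/setP => x; rewrite !inE.
    by case: (ltngtP (g x) i'); rewrite ?andbF.
  rewrite -!cardE //; last exact: ltnW.
apply/forallP => c; rewrite -colE //; apply/eqP.
rewrite /colsum sum_wmat //.
rewrite (eq_bigr (fun i : 'I_k => #|[set x | (col x == c) && (g x == i :> nat)]|)); last first.
  by move=> i _; rewrite !maxn0 kapS addKn.
rewrite -sum1dep_card (partition_big g xpredT) //=; apply: eq_bigr => i _.
by rewrite sum1dep_card; apply: eq_card => x; rewrite !inE.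
Qed.

End Word.

(** The matrix gives the chain of diagrams, and the strip of step c has as
    many boxes in the column i as there are letters i in the column c of the
    tableau. *)
Lemma wmat_inj g g' : lrword col lowt (colsize q) g -> lrword col lowt (colsize q) g' ->
  wmat g = wmat g' -> forall c a, wcount col g c a = wcount col g' c a.
Proof.
move=> hg hg' e.
have ps c j : (c <= l)%N -> (j < N)%N ->
    (\sum_(i < k) (j < kap g c i) = \sum_(i < k) (j < kap g' c i))%N.
  by move=> hc hj; rewrite -(psum_wmat hg hc hj (mu_mucol j)) e (psum_wmat hg' hc hj (mu_mucol j)).
have cnt h (hh : lrword col lowt (colsize q) h) c j i : (i < k)%N ->
    (j < kap h c i)%N = (i < \sum_(i' < k) (j < kap h c i'))%N.
  move=> hi; case: (ltnP j (kap h c i)) => hj.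
    apply/esym; apply: (@leq_trans (\sum_(i' < k) (i' < i.+1))%N).
      by rewrite -big_mkcond /= (big_ord_narrow hi) sum1_card card_ord.
    apply: leq_sum => i' _; case: (ltnP i' i.+1) => //= h'.
    have -> // : (j < kap h c i')%N.
    by have := @kap_dec h hh c i' i ltac:(lia) hi; lia.
  apply/esym/negbTE; rewrite -leqNgt; apply: (@leq_trans (\sum_(i' < k) (i' < i))%N).
    apply: leq_sum => i' _; case: (ltnP i' i) => [_|h']; first exact: leq_b1.
    have -> // : (j < kap h c i')%N = false.
    by have := kap_dec hh c h' (ltn_ord i'); lia.
  by rewrite -big_mkcond /= (big_ord_narrow (ltnW hi)) sum1_card card_ord.
have kapE c i : (c <= l)%N -> (i < k)%N -> kap g c i = kap g' c i.
  move=> hc hi; have le1 := kap_le hg hc hi; have le2 := kap_le hg' hc hi.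
  case: (ltngtP (kap g c i) (kap g' c i)) => // lt.
    have := cnt g hg c (kap g c i) i hi; rewrite ps //; last by lia.
    by rewrite -(cnt g' hg') // ltnn lt.
  have := cnt g' hg' c (kap g' c i) i hi; rewrite -ps //; last by lia.
  by rewrite -(cnt g hg) // ltnn lt.
move=> c a; case: (ltnP c l) => hc; last first.
  by rewrite /wcount !eq_card0 // => x; rewrite !inE; have := col_lt x; case: eqP => // ->; lia.
have := kapE c.+1 a hc (ltn_ord a); rewrite !kapS (kapE c a (ltnW hc)) // => /addnI.
exact.
Qed.

End Count.

(** * Polytabloids and the Specht module *)

Section SpechtPairing.
Variables (K : fieldType) (charK : [pchar K] =i pred0) (m : nat) (nu : seq nat).
Variable t0 : {ffun 'I_m -> cell nu}.
Hypothesis t0i : injective t0.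
Hypothesis cardm : #|cell nu| = m.
Hypothesis nus : sorted geq nu.

Notation Mx := (@tabloid_mx K m nu).
Notation tab := (tabloid m nu).
Notation act := (@tabloid_act m nu).
Let f0 : tab := tableau_tabloid t0.
Let e0 : 'rV[K]_#|tab| := polytabloid K t0.
Definition tcol (x : 'I_m) : nat := ccol (t0 x).

Lemma t0_surj c : exists x, t0 x = c.
Proof.
have b : bijective t0 by apply: inj_card_bij => //; rewrite cardm card_ord.
by case: b => g _ gK; exists (g c).
Qed.

Lemma col_stabP (s : 'S_m) : reflect (forall x, tcol (s x) = tcol x) (col_stab t0 s).
Proof.
apply: (iffP forallP) => h x; first by rewrite /tcol (eqP (h x)).
by apply/eqP/val_inj; exact: h.
Qed.

Lemma actM f s t : act f (s * t)%g = act (act f s) t.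
Proof. by apply/ffunP => x; rewrite !ffunE invMg permM. Qed.

Lemma act1 f : act f 1%g = f.
Proof. by apply/ffunP => x; rewrite ffunE invg1 perm1. Qed.

Lemma MxM s t : Mx (s * t)%g = Mx s *m Mx t.
Proof. by have [_ ->] := tabloid_mx_repr K m nu; rewrite ?inE. Qed.

Lemma Mx1 : Mx 1%g = 1%:M.
Proof. by have [-> _] := tabloid_mx_repr K m nu. Qed.

(** Permutation matrices are orthogonal; this is the invariance of the form
    on tabloids. *)
Lemma Mx_tr s : (Mx s)^T = Mx (s^-1)%g.
Proof.
apply/matrixP => i j; rewrite !mxE; congr (_%:R); congr nat_of_bool.
apply/eqP/eqP => [<-|<-]; first by rewrite -actM mulgV act1.
by rewrite -actM mulVg act1.
Qed.

Lemma tabloid_vec_mx f s : tabloid_vec K f *m Mx s = tabloid_vec K (act f s).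
Proof.
rewrite /tabloid_vec -rowE; apply/rowP => j; rewrite !mxE enum_rankK eqxx /=.
by rewrite -(inj_eq enum_val_inj) enum_rankK eq_sym.
Qed.

Lemma polytabloid_mx s : e0 *m Mx s =
  \sum_(p : 'S_m | col_stab t0 p) (-1) ^+ p *: tabloid_vec K (act f0 (p * s)%g).
Proof.
rewrite mulmx_suml; apply: eq_bigr => p _.
by rewrite -scalemxAl tabloid_vec_mx -actM.
Qed.

Lemma polytabloid_col s : col_stab t0 s -> e0 *m Mx s = (-1) ^+ s *: e0.
Proof.
move=> /col_stabP hs; rewrite polytabloid_mx [in RHS]/e0 /polytabloid.
rewrite [in RHS](reindex_inj (mulIg s)) /= scaler_sumr.
apply: eq_big => [p|p _].
  apply/col_stabP/col_stabP => h x; first by rewrite permM hs h.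
  by have := h x; rewrite permM hs.
by rewrite scalerA odd_permM signr_addb mulrCA -expr2 sqrr_sign mulr1.
Qed.

(** Two letters of Y in the same row: the terms for s and for s composed
    with their transposition cancel. *)
Lemma antisym_tabloid (f : tab) (Y : {set 'I_m}) x y : x \in Y -> y \in Y -> x != y ->
  f x = f y -> \sum_(s : 'S_m | perm_on Y s) (-1) ^+ s *: tabloid_vec K (act f s) = 0.
Proof.
move=> xY yY nxy exy; set S := \sum_(s | _) _.
have tY : perm_on Y (tperm x y).
  apply/subsetP => z; rewrite inE; case: tpermP => [->|->|] //.
  by rewrite eqxx.
have ft : act f (tperm x y) = f.
  apply/ffunP => z; rewrite ffunE tpermV; case: tpermP => [->|->|] //.
have e : S = - S.
  rewrite {1}/S (reindex_inj (mulgI (tperm x y))) /= -sumrN.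
  apply: eq_big => [s|s _]; last first.
    by rewrite odd_permM odd_tperm nxy signr_addb expr1 mulN1r scaleNr actM ft.
  apply/idP/idP => h; last exact: perm_onM.
  by rewrite -[s](mulKg (tperm x y)) tpermV perm_onM.
apply/eqP; have /eqP : S + S = 0 by rewrite {1}e addNr.
rewrite -mulr2n -scaler_nat scaler_eq0 => /orP [|//].
by have /pcharf0P -> := charK.
Qed.

(** More letters than the length of a column, taken from the columns c and
    c+1: by the pigeonhole principle two of them are in the same row, in
    each of the tabloids that make up the polytabloid. *)
Lemma polytabloid_garnir c (Y : {set 'I_m}) :
  (forall x, x \in Y -> tcol x = c \/ tcol x = c.+1) ->
  (#|[set x | tcol x == c]| < #|Y|)%N ->
  \sum_(s : 'S_m | perm_on Y s) (-1) ^+ s *: (e0 *m Mx s) = 0.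
Proof.
move=> hY big; under eq_bigr do rewrite polytabloid_mx scaler_sumr.
rewrite exchange_big /= big1 // => p /col_stabP hp.
pose f := act f0 p.
have [x [y [xY yY nxy exy]]] : exists x y, [/\ x \in Y, y \in Y, x != y & f x = f y].
  apply: contrapT => hno.
  have finj : {in Y &, injective f}.
    move=> x y xY yY e; apply/eqP/negPn/negP => n; apply: hno.
    by exists x, y; split.
  have : (#|f @: Y| <= #|(fun x => crow (t0 x)) @: [set x | tcol x == c]|)%N.
    apply: subset_leq_card; apply/subsetP => r /imsetP [x xY ->].
    rewrite ffunE /f0 ffunE; set x' := (p^-1)%g x.
    have cx' : tcol x' = c \/ tcol x' = c.+1.
      by rewrite -(hp x') permKV; exact: hY.
    have : (c < nth 0%N nu (crow (t0 x')))%N.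
      have := cellP (t0 x'); rewrite -/(tcol x').
      by case: cx' => ->; lia.
    move=> /(cell_ex nus) [cl [e1 e2]]; have [z ez] := t0_surj cl.
    apply/imsetP; exists z; first by rewrite inE /tcol ez e2.
    by rewrite ez; apply: val_inj.
  rewrite (card_in_imset finj) => h; have := leq_trans h (leq_imset_card _ _).
  by lia.
transitivity ((-1) ^+ p *: \sum_(s : 'S_m | perm_on Y s) (-1) ^+ s *: tabloid_vec K (act f s)).
  rewrite scaler_sumr; apply: eq_bigr => s _.
  by rewrite !scalerA mulrC actM.
by rewrite (antisym_tabloid xY yY nxy exy) scaler0.
Qed.

(** The tabloids of the polytabloid are distinct, so its norm is the order
    of the column stabiliser, which is not zero in characteristic zero. *)
Lemma polytabloid_norm : (e0 *m e0^T) 0 0 != 0.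
Proof.
have e0E f : e0 0 (enum_rank f) =
    \sum_(p : 'S_m | col_stab t0 p && (act f0 p == f)) (-1) ^+ p.
  rewrite /e0 /polytabloid summxE big_mkcondr /=; apply: eq_bigr => p _.
  rewrite !mxE eqxx /= (inj_eq enum_rank_inj) eq_sym.
  by case: eqP; rewrite ?mulr1 ?mulr0.
have inj p p' : col_stab t0 p -> col_stab t0 p' -> act f0 p = act f0 p' -> p = p'.
  move=> /col_stabP hp /col_stabP hp' e; apply: invg_inj; apply/permP => x.
  apply: t0i; apply: cell_inj.
    by have := congr1 (fun f : tab => val (f x)) e; rewrite !ffunE.
  by rewrite -!/(tcol _) -(hp (_ x)) permKV -(hp' (_ x)) permKV.
rewrite mxE (eq_bigr (fun i => \sum_(p : 'S_m | col_stab t0 p && (act f0 p == enum_val i)) 1)).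
  rewrite (exchange_big_dep (col_stab t0)) /=; last by move=> i p _ /andP [].
  rewrite (eq_bigr (fun=> 1)); last first.
    move=> p hp; rewrite (big_pred1 (enum_rank (act f0 p))) // => i.
    by rewrite hp /= eq_sym -(inj_eq enum_rank_inj) enum_valK.
  rewrite sumr_const; have /pcharf0P -> := charK.
  rewrite -lt0n; apply/card_gt0P; exists 1%g.
  by apply/col_stabP => x; rewrite perm1.
move=> i _; rewrite mxE -[i]enum_valK e0E enum_rankK.
case: (pickP [pred p | col_stab t0 p && (act f0 p == enum_val i)]) => [p0 /= /andP [h1 h2]|h0].
  have u p : col_stab t0 p && (act f0 p == enum_val i) = (p == p0).
    apply/andP/eqP => [[h3 /eqP h4]|->] //; apply: inj => //; by rewrite h4 (eqP h2).
  rewrite !(big_pred1 p0) // -expr2 sqrr_sign //.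
by rewrite !big_pred0 ?mulr0.
Qed.

Lemma polytabloid_specht : (e0 <= specht_mx K m nu)%MS.
Proof.
apply: submx_trans (cyclic_mx_id _ _) _; rewrite /specht_mx.
by apply: (sumsmx_sup t0); [apply/injectiveP|].
Qed.

(** The vectors with all translates orthogonal to the polytabloid form a
    submodule. It meets the simple Specht module in zero or contains it, and
    the second case is excluded because the polytabloid is not orthogonal to
    itself. *)
Lemma specht_nondeg (w : 'rV[K]_#|tab|) : mxsimple (tabloid_repr K m nu) (specht_mx K m nu) ->
  (w <= specht_mx K m nu)%MS -> (forall s, (w *m Mx s *m e0^T) 0 0 = 0) -> w = 0.
Proof.
move=> [Smod _ Smin] wS h; apply/eqP/negPn/negP => w0.
pose W : 'M[K]_#|tab| := (\bigcap_(s : 'S_m) kermx (Mx s *m e0^T))%MS.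
have WP n (A : 'M_(n, #|tab|)) : (A <= W)%MS <-> forall s, A *m Mx s *m e0^T = 0.
  split=> [/sub_bigcapmxP hA s|hA]; first by rewrite -mulmxA; apply/sub_kermxP/hA.
  by apply/sub_bigcapmxP => s _; apply/sub_kermxP; rewrite mulmxA.
have Wmod : mxmodule (tabloid_repr K m nu) W.
  apply/mxmoduleP => s _; apply/WP => t.
  rewrite -[W *m _ *m _]mulmxA -[tabloid_repr K m nu s]/(Mx s) -MxM.
  exact: (WP _ W).1.
have := Smin _ (capmx_module Smod Wmod) (capmxSl _ _).
have wI : (w <= specht_mx K m nu :&: W)%MS.
  rewrite sub_capmx wS; apply/WP => s; apply/matrixP => i j.
  by rewrite !ord1 h mxE.
have nz : (specht_mx K m nu :&: W)%MS != 0.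
  by apply: contraNneq w0 => e; rewrite e submx0 in wI.
move=> /(_ nz) sub; have := submx_trans polytabloid_specht sub.
rewrite sub_capmx => /andP [_ /WP /(_ 1%g)]; rewrite Mx1 mulmx1 => e.
by have := polytabloid_norm; rewrite e mxE eqxx.
Qed.

End SpechtPairing.

(** * The word function of a linear functional *)

Section Functional.
Variables (K : fieldType) (d : nat) (y : 'cV[K]_d).
Definition ev (v : 'rV[K]_d) : K := (v *m y) 0 0.
Lemma evD u v : ev (u + v) = ev u + ev v.
Proof. by rewrite /ev mulmxDl mxE. Qed.
Lemma evZ (a : K) v : ev (a *: v) = a * ev v.
Proof. by rewrite /ev -scalemxAl mxE. Qed.
Lemma evN v : ev (- v) = - ev v.
Proof. by rewrite -scaleN1r evZ mulN1r. Qed.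
Lemma ev_sum (I : finType) (P : pred I) (G : I -> 'rV[K]_d) :
  ev (\sum_(i | P i) G i) = \sum_(i | P i) ev (G i).
Proof. by rewrite /ev mulmx_suml summxE. Qed.
End Functional.

Lemma signr_twice (R : comPzRingType) (b : bool) (x : R) : (-1) ^+ b * ((-1) ^+ b * x) = x.
Proof. by rewrite mulrA -expr2 sqrr_sign mul1r. Qed.

Lemma sign_permM (R : comPzRingType) (I : finType) (s t : {perm I}) :
  (-1) ^+ (s * t)%g = (-1) ^+ s * (-1) ^+ t :> R.
Proof. by rewrite odd_permM signr_addb. Qed.

Section Orbit.
Variables (K : fieldType) (charK : [pchar K] =i pred0) (q k : nat).
Hypotheses (q0 : (0 < q)%N) (k1 : (1 < k)%N).
Let k0 : (0 < k)%N := ltnW k1.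
Notation m := (q * k).+1.
Notation F := (freeLAnKe K q.+1 'I_m).
Variables (d : nat) (rho : mx_representation K [set: 'S_m] d).
Variable phi : {linear 'rV[K]_d -> F}.
Hypothesis phi_inj : injective phi.
Variable v0 : 'rV[K]_d.
Hypothesis phiV : forall s : 'S_m, phi (v0 *m rho s) = combperm K s.

(** The coordinates of the left comb with letters s_0, s_1, ..., s_(m-1). *)
Definition vperm (s : 'S_m) : 'rV[K]_d := v0 *m rho s.

Let brP : is_LAnKe (@fbr K q.+1 'I_m) := @fbr_is_LAnKe K q.+1 'I_m.

Lemma combperm_mul (s t : 'S_m) :
  combperm K (s * t)%g = T (@fbr K q.+1 'I_m) (fun p => gens K t (s p)).
Proof. by apply: eq_T => p; rewrite /gens permM. Qed.

Lemma vperm_perm (s t : 'S_m) : (forall p, sblk (s p) = sblk p) ->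
  vperm (s * t)%g = (-1) ^+ s *: vperm t.
Proof.
move=> hs; apply: phi_inj; rewrite linearZ /= !phiV combperm_mul.
exact: (T_perm q0 k0 brP _ hs).
Qed.

Lemma vperm_exchange i (t : 'S_m) : (0 < i)%N -> (i.+1 < k)%N ->
  vperm t = vperm (bswap q0 k0 i * t)%g + (q%:R *: vperm t -
    \sum_(x : 'I_m | sblk x == i) \sum_(y : 'I_m | sblk y == i.+1) vperm (tperm x y * t)%g).
Proof.
move=> i0 hi; apply: phi_inj; rewrite linearD linearB linearZ /= linear_sum /= !phiV.
rewrite combperm_mul [LHS](T_exchange q0 k0 brP _ i0 hi); congr (_ + (_ - _)).
apply: eq_bigr => x _; rewrite linear_sum /=; apply: eq_bigr => y _.
by rewrite phiV combperm_mul.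
Qed.

Lemma vperm_first (t : 'S_m) :
  vperm t = vperm (bswap q0 k0 0 * t)%g -
    \sum_(i < q) vperm (bswap q0 k0 0 * (tperm ord0 (@slot q k 0 i) * t))%g.
Proof.
apply: phi_inj; rewrite linearB /= linear_sum /= !phiV.
rewrite combperm_mul [LHS](T_first q0 k0 brP _ k1); congr (_ - _).
apply: eq_bigr => i _; rewrite phiV combperm_mul; apply: eq_T => p.
by rewrite /gens permM.
Qed.

Section Functional.
Variable y : 'cV[K]_d.

(** The sign makes the function invariant, rather than alternating, under
    permutations inside the blocks. *)
Definition ufun (s : 'S_m) : K := (-1) ^+ s * ev y (vperm s).

Lemma ufun_perm (s t : 'S_m) : (forall p, sblk (s p) = sblk p) -> ufun (s * t)%g = ufun t.
Proof.
move=> hs; rewrite /ufun vperm_perm // evZ odd_permM signr_addb.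
by rewrite mulrACA -expr2 sqrr_sign mul1r.
Qed.

Lemma ufun_exchange i (t : 'S_m) : (0 < i)%N -> (i.+1 < k)%N ->
  ufun t = (-1) ^+ (bswap q0 k0 i) * ufun (bswap q0 k0 i * t)%g + (q%:R * ufun t +
    \sum_(x : 'I_m | sblk x == i) \sum_(z : 'I_m | sblk z == i.+1) ufun (tperm x z * t)%g).
Proof.
move=> i0 hi; rewrite {1}/ufun {1}(vperm_exchange t i0 hi) !evD evN evZ ev_sum.
rewrite !mulrDr; congr (_ + (_ + _)).
- by rewrite /ufun odd_permM signr_addb -mulrA signr_twice.
- by rewrite mulrCA.
rewrite -sumrN mulr_sumr; apply: eq_bigr => x /eqP hx.
rewrite ev_sum -sumrN mulr_sumr; apply: eq_bigr => z /eqP hz.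
rewrite /ufun odd_permM odd_tperm.
have -> : x != z by apply/eqP => e; move: hx; rewrite e hz; lia.
by rewrite signr_addb expr1 mulN1r mulNr mulrN.
Qed.

Lemma ufun_first (t : 'S_m) :
  ufun t = (-1) ^+ (bswap q0 k0 0) *
    \sum_(x : 'I_m | sblk x == 0%N) ufun (bswap q0 k0 0 * (tperm ord0 x * t))%g.
Proof.
rewrite big_slot0 // tperm1 mul1g {1}/ufun {1}vperm_first.
rewrite evD evN ev_sum !mulrDr; congr (_ + _).
  by rewrite /ufun odd_permM signr_addb -mulrA signr_twice.
rewrite -sumrN !mulr_sumr; apply: eq_bigr => i _.
rewrite /ufun !sign_permM [in RHS]odd_tperm eq_sym slot_neq0 //.
by rewrite expr1 -!mulrA signr_twice mulN1r mulrN.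
Qed.

Definition wordfun : {ffun 'I_m -> 'I_k} -> K := wfun q0 k0 ufun.

Lemma wordfunE s : wordfun (wordof q0 k0 s) = ufun s.
Proof. exact: (wfun_wordof q0 k0 ufun_perm). Qed.

Lemma permw_wordof (s t : 'S_m) :
  permw (wordof q0 k0 t) s = wordof q0 k0 (t * s^-1)%g.
Proof. by apply/ffunP => x; rewrite !ffunE invMg invgK permM. Qed.

Lemma wordfun0 g : ~ (exists s, wordof q0 k0 s = g) -> wordfun g = 0.
Proof.
move=> h; rewrite /wordfun /wfun; case: pickP => // s /eqP e; case: h.
by exists s.
Qed.

Lemma wordof_permw (s : 'S_m) g : (exists t, wordof q0 k0 t = permw g s) ->
  exists t, wordof q0 k0 t = g.
Proof.
move=> [t e]; exists (t * s)%g; rewrite -[s in (t * s)%g]invgK -permw_wordof e.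
by apply/ffunP => x; rewrite !ffunE permKV.
Qed.

Variable col : 'I_m -> nat.
Hypothesis col_sign : forall (s t : 'S_m), (forall x, col (s x) = col x) ->
  ev y (vperm (t * s)%g) = (-1) ^+ s * ev y (vperm t).
Hypothesis col_garnir : forall c (Y : {set 'I_m}) (t : 'S_m),
  (forall x, x \in Y -> col x = c \/ col x = c.+1) ->
  (#|[set x | col x == c]| < #|Y|)%N ->
  \sum_(s : 'S_m | perm_on Y s) (-1) ^+ s * ev y (vperm (t * s^-1)%g) = 0.

(** The raising equations come from the bracket, the two remaining relations
    are assumed of the linear form: they will hold for the pairing with a
    polytabloid. *)
Lemma wordfun_lrfun : lrfun col lowt (colsize q) wordfun.
Proof.
have Up := ufun_perm.
have Ue := ufun_exchange.
have Uf : forall t : 'S_m, (1 < k)%N -> ufun t = (-1) ^+ (bswap q0 k0 0) *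
    \sum_(x : 'I_m | sblk x == 0%N) ufun (bswap q0 k0 0 * (tperm ord0 x * t))%g.
  by move=> t _; exact: ufun_first.
split.
- by move=> g a; apply: wfun_content.
- move=> a b ab g; rewrite /lowt; case: (posnP a) => a0 /=.
    by apply: (wfun_raise1 charK Up Uf) => //; rewrite ab a0.
  by exact: (wfun_raise2 charK Up Ue).
- move=> s g hs; case: (pselect (exists t, wordof q0 k0 t = g)) => [[t <-]|h]; last first.
    by rewrite !wordfun0 // => /wordof_permw.
  rewrite permw_wordof !wordfunE /ufun sign_permM odd_permV col_sign.
    by rewrite odd_permV -mulrA signr_twice.
  by move=> x; rewrite -[in RHS](permKV s x) hs.
move=> c Y g hY big; case: (pselect (exists t, wordof q0 k0 t = g)) => [[t <-]|h]; last first.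
  by rewrite big1 // => s _; rewrite wordfun0 // => /wordof_permw.
rewrite (eq_bigr (fun s : 'S_m => (-1) ^+ t * ((-1) ^+ s * ev y (vperm (t * s^-1)%g)))).
  by rewrite -mulr_sumr (@col_garnir c) // mulr0.
by move=> s _; rewrite permw_wordof wordfunE /ufun sign_permM odd_permV mulrA.
Qed.

End Functional.

Lemma wordfun_linear (I : finType) (a : I -> K) (Y : I -> 'cV[K]_d) g :
  wordfun (\sum_i a i *: Y i) g = \sum_i a i * wordfun (Y i) g.
Proof.
case: (pselect (exists t, wordof q0 k0 t = g)) => [[t <-]|h]; last first.
  rewrite wordfun0 // big1 // => i _; by rewrite wordfun0 // mulr0.
rewrite wordfunE /ufun /ev mulmx_sumr summxE mulr_sumr; apply: eq_bigr => i _.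
by rewrite wordfunE /ufun /ev -scalemxAr mxE mulrCA.
Qed.

End Orbit.

(** * Homomorphisms into the Specht module *)

Section Homs.
Variables (F : fieldType) (gT : finGroupType) (G : {group gT}).
Variables (dV n : nat) (rV : mx_representation F G dV) (rT : mx_representation F G n).
Variables (S : 'M[F]_n) (Smod : mxmodule rT S).

(** The projection to the summand W i along the others, followed by its
    isomorphism with S. *)
Lemma summand_hom t (W : 'I_t -> 'M[F]_dV) (Wmod : forall i, mxmodule rV (W i)) i :
  mxdirect (\sum_i W i) -> (\sum_i W i :=: 1%:M)%MS -> W i != 0 ->
  mx_rsim (submod_repr (Wmod i)) (submod_repr Smod) ->
  exists H : 'M[F]_(dV, n),
    [/\ forall x, x \in G -> rV x *m H = H *m rT x,
        (H <= S)%MS,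
        forall j, j != i -> W j *m H = 0
      & W i *m H != 0].
Proof.
move=> dxW W1 Wi0 [B _ Bfree Bhom].
pose V := (\sum_(j | true && (j != i)) W j)%MS.
have dxV : (W i :&: V = 0)%MS by apply: (mxdirect_sumsP dxW).
have Vmod : mxmodule rV V by apply: sumsmx_module => j _; exact: Wmod.
have WV : (1%:M <= W i + V)%MS.
  by rewrite -W1 (bigD1 i).
pose P := proj_mx (W i) V.
have Phom x : x \in G -> rV x *m P = P *m rV x.
  have /hom_mxP h := submx_trans WV (proj_mx_hom dxV (Wmod i) Vmod).
  by move=> xG; have := h x xG; rewrite !mul1mx.
have PW : (P <= W i)%MS by rewrite -[P]mul1mx proj_mx_sub.
have HE m (C : 'M_(m, dV)) : C *m val_submod (in_submod (W i) P *m B) =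
    val_submod (in_submod (W i) (C *m P) *m B) :> 'M_(m, n).
  by rewrite val_submodE [in RHS]val_submodE [in RHS]in_submodE [in_submod _ P]in_submodE !mulmxA.
exists (val_submod (in_submod (W i) P *m B)); split.
- move=> x xG; rewrite HE Phom // (in_submodJ (Wmod i)) // -mulmxA.
  by rewrite (Bhom x xG) mulmxA (val_submodJ Smod).
- exact: val_submodP.
- move=> j nj; rewrite HE (_ : W j *m P = 0).
    by rewrite in_submodE mul0mx mul0mx val_submodE mul0mx.
  by apply: proj_mx_0 => //; apply: (sumsmx_sup j).
rewrite HE proj_mx_id //; apply: contraNneq Wi0 => e.
rewrite -(in_submodK (submx_refl (W i))).
have : in_submod (W i) (W i) *m B = 0 *m B.
  by apply: (@val_submod_inj _ _ S); rewrite e mul0mx val_submodE mul0mx.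
by move/(row_free_inj Bfree)=> ->; rewrite val_submodE mul0mx.
Qed.

(** The homomorphisms obtained from r summands are independent, since each
    of them vanishes on the other summands. *)
Lemma multiplicity_homs r : is_multiplicity (submod_repr Smod) rV r ->
  ((0 < r)%N -> mxsimple rT S) /\
  exists H : 'I_r -> 'M[F]_(dV, n),
    [/\ forall i x, x \in G -> rV x *m H i = H i *m rT x,
        forall i, (H i <= S)%MS
      & forall a : 'I_r -> F, \sum_i a i *: H i = 0 -> forall i, a i = 0].
Proof.
case=> t [W [Wmod [A [Wsimple dxW W1 AP rA]]]]; subst r; split.
  case/card_gt0P => i /AP sim.
  exact/(submod_mx_irr Smod)/(mx_rsim_irr sim)/(submod_mx_irr (Wmod i))/Wsimple.
have /fin_all_exists [H hH] (x : 'I_#|A|) := summand_hom dxW W1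
  (let: And3 _ h _ := Wsimple (enum_val x) in h) (iffLR (AP _) (enum_valP x)).
exists H; split=> [x|x|a e x]; try by have [] := hH x.
have [_ _ _ nz] := hH x.
have := congr1 (mulmx (W (enum_val x))) e; rewrite mulmx0 mulmx_sumr (bigD1 x) //= big1.
  by rewrite addr0 -scalemxAr => /eqP; rewrite scaler_eq0 (negbTE nz) orbF => /eqP.
move=> z nz'; have [_ _ h _] := hH z; rewrite -scalemxAr h ?scaler0 //.
by rewrite (inj_eq enum_val_inj) eq_sym.
Qed.
End Homs.

Section Shapes.
Variable nu : seq nat.
Hypothesis nus : sorted geq nu.

Lemma sum_nth_sumn (s : seq nat) : (\sum_(i < size s) nth 0 s i = sumn s)%N.
Proof. by rewrite sumnE (big_nth 0%N) big_mkord. Qed.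

Lemma card_cell : #|cell nu| = sumn nu.
Proof.
rewrite card_sig -sum1_card -sum_nth_sumn.
rewrite (eq_bigl (fun c : 'I_(size nu) * 'I_(head 0%N nu) => true && (c.2 < nth 0 nu c.1)%N)) //.
rewrite -(pair_big_dep xpredT (fun (i : 'I_(size nu)) (j : 'I_(head 0%N nu)) => (j < nth 0 nu i)%N) (fun _ _ => 1%N)) /=.
by apply: eq_bigr => i _; rewrite (big_ord_narrow (nth_le_head i nus)) sum1_card card_ord.
Qed.

Lemma card_tcol m (t0 : {ffun 'I_m -> cell nu}) c : injective t0 -> #|cell nu| = m ->
  (c < head 0%N nu)%N -> #|[set x | tcol t0 x == c]| = conjp nu c.
Proof.
move=> t0i cardm hc; have := sum_col nus (fun=> 1%N) (Ordinal hc).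
rewrite [in RHS]sum1_card card_ord => <-.
have b : bijective t0 by apply: inj_card_bij => //; rewrite cardm card_ord.
rewrite (reindex t0); last exact: onW_bij.
by rewrite sum1dep_card; apply: eq_card => x; rewrite !inE.
Qed.
End Shapes.

Lemma sorted_rev_iota i j : sorted geq (rev (iota i j)).
Proof.
rewrite rev_sorted (eq_sorted (e' := leq)) ?iota_sorted //.
Qed.

Lemma mu_partn k : sorted geq (LAnKe_mu k) /\ 0%N \notin LAnKe_mu k.
Proof. by split; [exact: sorted_rev_iota|rewrite mem_rev mem_iota]. Qed.

Lemma la_partn q k : (1 < k)%N ->
  is_partn (sumn (LAnKe_mu k) + (q * k).+1) (LAnKe_la q.+1 k).
Proof.
move=> k1; apply/and3P; split.
- rewrite /LAnKe_la /=; elim: q => [|[|q] IH]; first exact: sorted_rev_iota.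
    have := sorted_rev_iota 1 k.-1; rewrite /=; case e : (rev _) => [|x s] //= ->.
    have : x \in rev (iota 1 k.-1) by rewrite e mem_head.
    by rewrite mem_rev mem_iota; lia.
  by rewrite /= leqnn.
- rewrite mem_cat mem_nseq mem_rev mem_iota; lia.
rewrite /LAnKe_la /LAnKe_mu sumn_cat sumn_nseq !sumn_rev /=.
by case: k k1 => [|[|k]] // _ /=; rewrite subn2 /=; apply/eqP; lia.
Qed.

Section Bound.
Variables (K : fieldType) (charK : [pchar K] =i pred0) (q k : nat).
Hypotheses (q0 : (0 < q)%N) (k1 : (1 < k)%N).
Let k0 : (0 < k)%N := ltnW k1.
Notation m := (q * k).+1.
Notation F := (freeLAnKe K q.+1 'I_m).
Variables (d : nat) (rho : mx_representation K [set: 'S_m] d).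
Variable phi : {linear 'rV[K]_d -> F}.
Hypothesis phi_inj : injective phi.
Hypothesis phi_Lie : forall v, Lie_comp (phi v).
Variable v0 : 'rV[K]_d.
Hypothesis phiV : forall s : 'S_m, phi (v0 *m rho s) = combperm K s.
Variables (nu : seq nat) (t0 : {ffun 'I_m -> cell nu}).
Hypotheses (t0i : injective t0) (nus : sorted geq nu) (cardm : #|cell nu| = m).
Hypothesis simS : mxsimple (tabloid_repr K m nu) (specht_mx K m nu).
Notation e0 := (polytabloid K t0).
Notation tab := (tabloid m nu).

Section OneHom.
Variable H : 'M[K]_(d, #|tab|).
Hypothesis homH : forall s : 'S_m, rho s *m H = H *m tabloid_mx K nu s.
Hypothesis subH : (H <= specht_mx K m nu)%MS.
Notation y := (H *m e0^T).

(** Moving the permutation s across the homomorphism H and the invariant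
    form lets it act on the polytabloid. *)
Lemma ev_vperm (s t : 'S_m) :
  ev y (vperm rho v0 (t * s)%g) = (vperm rho v0 t *m H *m (e0 *m tabloid_mx K nu (s^-1)%g)^T) 0 0.
Proof.
rewrite /ev /vperm repr_mxM ?inE // trmx_mul Mx_tr invgK !mulmxA.
by rewrite -[_ *m rho s *m H]mulmxA homH !mulmxA.
Qed.

Lemma wordfun_hom_lrfun : lrfun (tcol t0) lowt (colsize q) (wordfun q0 k1 rho v0 y).
Proof.
apply: (wordfun_lrfun charK q0 k1 phi_inj phiV) => [s t hs|c Y t hY big].
  rewrite ev_vperm (polytabloid_col K); last first.
    by apply/col_stabP => x; rewrite -[in RHS](permKV s x) hs.
  by rewrite odd_permV linearZ /= -scalemxAr mxE -mulmxA.
rewrite (eq_bigr (fun s : 'S_m => (vperm rho v0 t *m H *m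
    ((-1) ^+ s *: (e0 *m tabloid_mx K nu s))^T) 0 0)); last first.
  by move=> s _; rewrite ev_vperm invgK [in RHS]linearZ /= -scalemxAr [RHS]mxE.
rewrite -summxE -mulmx_sumr -linear_sum (polytabloid_garnir charK t0i cardm nus hY big).
by rewrite linear0 mulmx0 mxE.
Qed.

(** If u = 0 then all translates of h(v_1) are orthogonal to the
    polytabloid, so h(v_1) = 0; but v_1 generates the multilinear component. *)
Lemma wordfun_hom_eq0 : (forall g, wordfun q0 k1 rho v0 y g = 0) -> H = 0.
Proof.
move=> h0; have v0H : v0 *m H = 0.
  apply: (specht_nondeg charK t0i simS); first exact: mulmx_sub.
  move=> s; have := h0 (wordof q0 k0 s); rewrite (wordfunE q0 k1 phi_inj phiV) /ufun.
  move/eqP; rewrite mulf_eq0 signr_eq0 /= => /eqP <-.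
  by rewrite /ev /vperm -[_ *m H *m _]mulmxA -homH !mulmxA.
have vH (v : 'rV_d) : v *m H = 0.
  have : exists2 v', phi v' = phi v & v' *m H = 0.
    apply: (Lie_comp_combperm q0 k0
        (P := fun x => exists2 v', phi v' = x & v' *m H = 0)) (phi_Lie v).
      by exists 0; rewrite ?linear0 ?mul0mx.
    move=> a s w [v' <- hv']; exists (a *: (v0 *m rho s) + v').
      by rewrite linearP phiV.
    by rewrite mulmxDl hv' -scalemxAl -mulmxA homH mulmxA v0H mul0mx scaler0 addr0.
  by case=> v' /phi_inj ->.
by apply/row_matrixP => i; rewrite rowE vH row0.
Qed.
End OneHom.

(** The values of the r word functions at one word for each matrix that
    comes from an LR word form a matrix with independent rows. *)
Lemma homs_leq_LR (N r : nat) (H : 'I_r -> 'M[K]_(d, #|tab|)) :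
  (q + k.-1 <= N)%N ->
  (forall i (s : 'S_m), rho s *m H i = H i *m tabloid_mx K nu s) ->
  (forall i, (H i <= specht_mx K m nu)%MS) ->
  (forall a : 'I_r -> K, \sum_i a i *: H i = 0 -> forall i, a i = 0) ->
  (r <= #|[set M : bmat N (head 0%N nu) |
    LRmat (nth 0%N (LAnKe_mu k)) (conjp nu) M &&
    [forall j : 'I_N, (nth 0 (LAnKe_mu k) j + rowsum M j == nth 0 (LAnKe_la q.+1 k) j)%N]]|)%N.
Proof.
move=> Nbig homH subH freeH; set S := [set M | _].
have col_lt x : (tcol t0 x < head 0 nu)%N by exact: ltn_ord.
have colE c : (c < head 0 nu)%N -> #|[set x | tcol t0 x == c]| = conjp nu c.
  exact: card_tcol.
pose lr (g : {ffun 'I_m -> 'I_k}) := lrword (tcol t0) lowt (colsize q) g.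
pose w (g : {ffun 'I_m -> 'I_k}) : bmat N (head 0%N nu) := wmat N nu (tcol t0) g.
have /fin_all_exists [rep repP] (M : bmat N (head 0%N nu)) :
    exists g, (exists2 g', lr g' & w g' = M) -> lr g /\ w g = M.
  case: (pselect (exists2 g', lr g' & w g' = M)) => [[g h1 h2]|no]; first by exists g.
  by exists [ffun=> Ordinal k0] => /no.
pose Y i := H i *m e0^T.
pose D := \matrix_(i < r, s < #|S|) wordfun q0 k1 rho v0 (Y i) (rep (enum_val s)).
suff /eqP <- : row_free D by exact: rank_leq_col.
apply: inj_row_free => a aD; apply/rowP => i; rewrite mxE.
pose Ha := \sum_i a 0 i *: H i.
have yE : Ha *m e0^T = \sum_i a 0 i *: Y i.
  by rewrite mulmx_suml; apply: eq_bigr => j _; rewrite -scalemxAl.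
suff : Ha = 0 by move/freeH.
have homHa s : rho s *m Ha = Ha *m tabloid_mx K nu s.
  rewrite mulmx_sumr mulmx_suml; apply: eq_bigr => j _.
  by rewrite -scalemxAl -scalemxAr homH.
have subHa : (Ha <= specht_mx K m nu)%MS.
  by apply: summx_sub => j _; apply: scalemx_sub.
apply: (wordfun_hom_eq0 homHa subHa).
have uP := wordfun_hom_lrfun homHa.
apply: (lrfun_eq0 charK uP) => g hg.
have [hr er] := repP (w g) (ex_intro2 _ _ g hg erefl).
have wS : w g \in S by rewrite inE; exact: wmat_LRmat.
rewrite -(lrfun_wcount uP (wmat_inj q0 k1 nus Nbig col_lt hg hr (esym er))).
rewrite yE (wordfun_linear q0 k1 phi_inj phiV).
have /rowP /(_ (enum_rank_in wS (w g))) := aD; rewrite !mxE => aE; rewrite -[RHS]aE.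
by apply: eq_bigr => j _; rewrite mxE enum_rankK_in.
Qed.

End Bound.

Theorem corollary6p3 (K : fieldType) (charK : [pchar K] =i pred0)
    (n k m : nat) (hn : (3 <= n)%N) (hk : (2 <= k)%N)
    (hm : m = ((n - 1) * k + 1)%N)
    (nu : seq nat) (hnu : is_partn m nu)
    (d : nat) (rho : mx_representation K [set: 'S_m] d)
    (hrho : affords_Lie n rho)
    (r : nat) (hr : is_multiplicity (specht_repr K m nu) rho r)
    (c : int) (hc : is_LR_coef (LAnKe_la n k) (LAnKe_mu k) nu c) :
  r%:Z <= c.
Proof.
case: n hn hm hrho hc => // q hq; rewrite subn1 addn1 /= => hm.
subst m => hrho hc.
have q0 : (0 < q)%N by lia.
have [nus _ /eqP numE] := and3P hnu.
have [mus mu0] := mu_partn k.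
have laP := la_partn q hk.
rewrite (LR_coefE mus mu0 nus _ hc) ?numE //.
have [simS [H [homH subH freeH]]] := multiplicity_homs hr.
case: r hr simS H homH subH freeH => [|r] // _ simS H homH subH freeH.
have {}simS := simS isT.
have [t0 t0i] : exists t0 : {ffun 'I_(q * k).+1 -> cell nu}, injective t0.
  have [_ + _] := simS; rewrite /specht_mx; case: (pickP (fun t : {ffun 'I_(q * k).+1 -> cell nu} => injectiveb t)).
    by move=> t /injectiveP ti; exists t.
  by move=> no; rewrite big_pred0 ?eqxx.
have [phi [phi_inj phiLie act]] := hrho.
have [v0 v0E] : exists v0, phi v0 = wval K (wperm (1 : 'S_(q * k).+1)).
  exact/phiLie/Lie_comp_wval/wperm_multilinear.
have phiV (s : 'S_(q * k).+1) : phi (v0 *m rho s) = combperm K s.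
  by rewrite (act s _ _ (wperm_multilinear _) v0E) wrelabel_wperm mul1g wval_wperm.
rewrite lez_nat; apply: (homs_leq_LR charK q0 hk phi_inj _ phiV t0i nus) => //.
- by move=> v; apply/phiLie; exists v.
- by rewrite card_cell.
- by nia.
by move=> i s; apply: homH; rewrite inE.
Qed.
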